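(* Let $\mu(de)=h(e)\,de$ be a signed measure on the space $\mathbf E$ of planes in $\mathbf R^3$ with continuous density $h$, and let its flag density $\rho$ be a $C^2$ function on the space of flags. Let $\mathrm A\subset\mathbf S^2$ be a spherical disc of spherical radius $\alpha<\pi/2$, and use spherical coordinates $(\varphi,\nu)$ on $\mathbf S^2$ with the centre of $\mathrm A$ as pole, so that $\partial\mathrm A=\{l=(\varphi,\alpha):0\le\varphi<2\pi\}$. Then $$2\pi\int_{\mathrm A}h^*(s)\,ds=\int_{\mathrm A}M(s)\,ds+\int_{\mathrm A}\frac{\partial M(s)}{\partial n}\,ds+\cos\alpha\int_0^{2\pi}M(l)\,d\varphi-\sin\alpha\int_0^{2\pi}\rho'_\Phi(l)\,d\varphi-2\cos\alpha\int_0^{2\pi}\rho(l)\,d\varphi-\sin\alpha\int_0^{2\pi}\rho'_y(l)\,d\varphi,$$ where $n$ is the outer normal direction to $\mathbf S^2$ at $s$, $ds$ is the area element of $\mathbf S^2$.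
   Context: $\mathbf E$ is the space of planes in $\mathbf R^3$, with invariant measure $de=dp\,d\xi$ ($p$ = distance from origin, $\xi\in\mathbf S^2$ = normal). For $x\in\mathbf R^3$, $h_x(\xi)=h(e_\xi)$ where $e_\xi$ is the plane through $x$ with normal $\xi$. A flag is $f=(x,g,e)$ ($x$ a point, $g\ni x$ a directed line, $e\supset g$ an oriented plane), equivalently $(x,\omega,\varphi)$ with $\omega$ the positive normal of $e$ and $\varphi$ the angle of $g$ in $e$. The flag density of $\mu$ is $\rho(x,\omega,\varphi)=\frac12\int_{\mathbf S^2}\cos^2(\varphi-\psi(\xi))h_x(\xi)\,d\xi$, $\psi(\xi)$ the angle of the orthogonal projection of $\xi$ onto the plane of the flag. The bundle mass is $M(x)=\frac12\int_{\mathbf S^2}h_x(\xi)\,d\xi$. For $s\in\mathbf S^2$, $h^*(s)=h(t(s))$ where $t(s)$ is the plane tangent to $\mathbf S^2$ at $s$. The tangent flag to $\mathrm A$ at $l\in\partial\mathrm A$ is the flag located at $l$ whose plane is tangent to $\mathbf S^2$ at $l$ with positive normal equal to the outer normal of $\mathbf S^2$, whose line is tangent to $\partial\mathrm A$ at $l$, directed so that motion along $\partial\mathrm A$ leaves $\mathrm A$ locally on the left; $\rho(l),\rho'_\Phi(l),\rho'_y(l)$ denote values at this flag. Axes of a flag: $x_1$ along $g$; $x_2$ in $e$, orthogonal to $x_1$, directed into the right half of $e$ bounded by $g$; $x_3$ along the positive normal; left triad. $\rho'_\Phi$ is the derivative under rotation of the flag around $g$ (positive = clockwise looking along $g$); $\rho'_y$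 is the derivative under translation of the location in direction $x_2$. *)

(* Defs.v *)
From Stdlib Require Import Reals Lra ClassicalEpsilon.
Open Scope R_scope.

Record V3 := mkV { vx : R; vy : R; vz : R }.

Definition vadd (u v : V3) : V3 := mkV (vx u + vx v) (vy u + vy v) (vz u + vz v).
Definition vscal (t : R) (u : V3) : V3 := mkV (t * vx u) (t * vy u) (t * vz u).
Definition vsub (u v : V3) : V3 := vadd u (vscal (-1) v).
Definition dot (u v : V3) : R := vx u * vx v + vy u * vy v + vz u * vz v.
Definition cross (u v : V3) : V3 :=
  mkV (vy u * vz v - vz u * vy v) (vz u * vx v - vx u * vz v) (vx u * vy v - vy u * vx v).
Definition vnorm2 (u : V3) : R := dot u u.
Definition unit_vec (u : V3) : Prop := dot u u = 1.

(** * Total versions of the 1-D Riemann integral and of the derivative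
    (meaningful when the integral / derivative exists). *)
Definition RInt (f : R -> R) (a b : R) : R :=
  epsilon (inhabits 0) (fun v => exists pr : Riemann_integrable f a b, RiemannInt pr = v).
Definition Deriv (f : R -> R) (x : R) : R :=
  epsilon (inhabits 0) (fun l => derivable_pt_lim f x l).

Definition sph_pt (th ph : R) : V3 := mkV (sin th * cos ph) (sin th * sin ph) (cos th).
Definition sphere_int (f : V3 -> R) : R :=
  RInt (fun ph => RInt (fun th => f (sph_pt th ph) * sin th) 0 PI) 0 (2 * PI).

(** * Planes.  A plane with unit normal xi is {y | dot y xi = p}, p in R; the
    pair (p,xi) and (-p,-xi) describe the same plane.  A density on E is thus
    a function h : R -> V3 -> R with h p xi = h (-p) (-xi) (for unit xi). *)
Definition plane_fun_wd (h : R -> V3 -> R) : Prop :=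
  forall p xi, unit_vec xi -> h p xi = h (- p) (vscal (-1) xi).

Definition plane_fun_continuous (h : R -> V3 -> R) : Prop :=
  forall p xi, unit_vec xi -> forall eps, eps > 0 -> exists delta, delta > 0 /\
    forall p' xi', unit_vec xi' -> Rabs (p' - p) < delta -> vnorm2 (vsub xi' xi) < delta ->
      Rabs (h p' xi' - h p xi) < eps.

(** h_x(xi) = h(plane through x with normal xi) *)
Definition hx (h : R -> V3 -> R) (x xi : V3) : R := h (dot x xi) xi.

(** h^*(s) = h(plane tangent to S^2 at s) = h(1, s) *)
Definition hstar (h : R -> V3 -> R) (s : V3) : R := h 1 s.

Definition Mass (h : R -> V3 -> R) (x : V3) : R := / 2 * sphere_int (hx h x).

(** Flags: (x, u, om) with u unit direction of g, om unit positive normal of e,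
    dot u om = 0.  cos^2(phi - psi(xi)) = (dot u xi)^2 / |xi - (dot xi om) om|^2. *)
Definition is_flag (x u om : V3) : Prop :=
  unit_vec u /\ unit_vec om /\ dot u om = 0.

Definition rho (h : R -> V3 -> R) (x u om : V3) : R :=
  / 2 * sphere_int (fun xi =>
      (dot u xi) ^ 2 / vnorm2 (vsub xi (vscal (dot xi om) om)) * hx h x xi).

(** axis x2 of a flag (left triad x1 = u, x2, x3 = om) *)
Definition flag_x2 (u om : V3) : V3 := cross u om.

(** rho'_Phi : rotation of the flag about g (clockwise looking along g) *)
Definition rhoPhi (h : R -> V3 -> R) (x u om : V3) : R :=
  Deriv (fun t => rho h x u (vadd (vscal (cos t) om) (vscal (sin t) (flag_x2 u om)))) 0.

Definition rhoY (h : R -> V3 -> R) (x u om : V3) : R :=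
  Deriv (fun t => rho h (vadd x (vscal t (flag_x2 u om))) u om) 0.

Definition dMdn (h : R -> V3 -> R) (s : V3) : R :=
  Deriv (fun t => Mass h (vadd s (vscal t s))) 0.

Definition upd (x : nat -> R) (i : nat) (s : R) : nat -> R :=
  fun j => if Nat.eqb j i then s else x j.

Definition contn (n : nat) (f : (nat -> R) -> R) : Prop :=
  forall x eps, eps > 0 -> exists delta, delta > 0 /\
    forall y, (forall i, (i < n)%nat -> Rabs (y i - x i) < delta) -> Rabs (f y - f x) < eps.

Definition C1n (n : nat) (f : (nat -> R) -> R) : Prop :=
  exists D : nat -> (nat -> R) -> R,
    (forall i x, (i < n)%nat -> derivable_pt_lim (fun s => f (upd x i s)) (x i) (D i x)) /\
    (forall i, (i < n)%nat -> contn n (D i)) /\ contn n f.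

Definition C2n (n : nat) (f : (nat -> R) -> R) : Prop :=
  exists D : nat -> (nat -> R) -> R,
    (forall i x, (i < n)%nat -> derivable_pt_lim (fun s => f (upd x i s)) (x i) (D i x)) /\
    (forall i, (i < n)%nat -> C1n n (D i)) /\ contn n f.

Definition rotX (t : R) (v : V3) : V3 :=
  mkV (vx v) (cos t * vy v - sin t * vz v) (sin t * vy v + cos t * vz v).
Definition rotY (t : R) (v : V3) : V3 :=
  mkV (cos t * vx v + sin t * vz v) (vy v) (- sin t * vx v + cos t * vz v).
Definition rotZ (t : R) (v : V3) : V3 :=
  mkV (cos t * vx v - sin t * vy v) (sin t * vx v + cos t * vy v) (vz v).
Definition rot3 (a b c : R) (v : V3) : V3 := rotX a (rotY b (rotZ c v)).

(** Chart of the flag space around a base flag (x0,u0,om0): 6 real parameters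
    (translation, Euler angles); smooth and a local diffeomorphism near 0. *)
Definition flag_chart_fun (F : V3 -> V3 -> V3 -> R) (x0 u0 om0 : V3)
  : (nat -> R) -> R :=
  fun v => F (vadd x0 (mkV (v 0%nat) (v 1%nat) (v 2%nat)))
             (rot3 (v 3%nat) (v 4%nat) (v 5%nat) u0)
             (rot3 (v 3%nat) (v 4%nat) (v 5%nat) om0).

Definition flag_C2 (F : V3 -> V3 -> V3 -> R) : Prop :=
  forall x0 u0 om0, is_flag x0 u0 om0 -> C2n 6 (flag_chart_fun F x0 u0 om0).

(** * The spherical disc A with centre c and radius alpha, described in
    spherical coordinates (phi, nu) with pole c, w.r.t. a right-handed
    orthonormal frame (a, b, c). *)
Definition disc_pt (a b c : V3) (nu ph : R) : V3 :=
  vadd (vscal (sin nu) (vadd (vscal (cos ph) a) (vscal (sin ph) b))) (vscal (cos nu) c).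

Definition disc_int (a b c : V3) (alpha : R) (f : V3 -> R) : R :=
  RInt (fun ph => RInt (fun nu => f (disc_pt a b c nu ph) * sin nu) 0 alpha) 0 (2 * PI).

(** boundary point l = (phi, alpha) and the unit tangent to dA at l, directed
    so that A lies locally on the left (increasing phi) *)
Definition bd_pt (a b c : V3) (alpha ph : R) : V3 := disc_pt a b c alpha ph.
Definition bd_tan (a b : V3) (ph : R) : V3 :=
  vadd (vscal (- sin ph) a) (vscal (cos ph) b).

(** int_0^{2pi} G(tangent flag at l(phi)) dphi; tangent flag = (l, tangent, l) *)
Definition bd_int (a b c : V3) (alpha : R) (G : V3 -> V3 -> V3 -> R) : R :=
  RInt (fun ph => G (bd_pt a b c alpha ph) (bd_tan a b ph) (bd_pt a b c alpha ph)) 0 (2 * PI).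

(* Main.v *)
(* Fix a normal xi, let l = l(nu, ph) run over the sphere and let x, y, z be the components of xi along the
   direction of the parallel circle, along its outer conormal and along l.  Then dz/dph = sin nu * x and
   dz/dnu = y, and writing O for the integral over ph in [0, 2 pi] one has, for functions k and F of z,
     (sin^2 nu * O(x^2 k))' = sin nu * cos nu * O((1 - z^2) k) + sin^2 nu * O(z y k),
     (sin nu * O(y F))'     = sin nu * O((1 - z^2) F' - 2 z F).
   Take k = q_n(z) h(z, xi) and F = z k with the polynomial q_n = (1 - z^(2n)) / (1 - z^2), and average over
   xi.  As n grows, x^2 q_n h tends to the kernel of the flag density, while the source 2n z^(2n) h produced
   by F concentrates at xi = l and xi = -l and yields 2 pi h^*(l).  Two integrations in nu give
     sin^2 alpha * O(rho) = int_0^alpha sin b (cos b * O(M) + int_(A_b) (M + dM/dn - 2 pi h^* )) db,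
   whose alpha-derivative is the claim, because moving the tangent flag along a meridian differentiates rho
   to rho'_Phi + rho'_y.  Since h is only continuous, the identity is first proved for the averages of h over
   parallel planes, for which p h(p, xi) is differentiable in p; the average is removed at the end because M
   is C^1. *)
Require Import Defs.
From Stdlib Require Import Reals Lra Lia Classical ClassicalEpsilon.
From Coquelicot Require Import Coquelicot.
Open Scope R_scope.

(** * Continuity and integrals depending on parameters *)

(** The kernel x^2 / (1 - z^2) of the flag density has no limit at xi = l and xi = -l, so neither
    differentiation in nu nor the exchange of integrals applies to it directly; the polynomials q_n
    keep every integrand continuous, at the price of the source 2n z^(2n) h. As z^(2n) has integral
    4 pi / (2n + 1) over the sphere, this source has total weight tending to 4 pi, and the factor
    1/2 of the definitions leaves 2 pi. Both poles carry the same value, since (1, l) and (-1, -l)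
    are one plane. The cross term z y k of the first formula is the flux of F = z k, so only the
    product p h(p, xi) is ever differentiated. At p = z this derivative is that of r h(r z, xi) at r
    = 1, whence the sum M + dM/dn. The averaging is radial for the same reason: the mass of the
    difference quotient of p h is the difference quotient of r M(r l), which converges because M
    inherits its regularity from the flag density. Integrals and derivatives in the statement are
    values of a choice operator, so existence has to precede every computation with them. *)

Definition cts {U V : UniformSpace} (f : U -> V) := forall u, continuous f u.

Section Closure.
Context {U : UniformSpace}.
Implicit Types f g : U -> R.

Lemma cts_id : cts (fun u : U => u).
Proof. intros u; apply continuous_id. Qed.
Lemma cts_const {V : UniformSpace} (k : V) : cts (fun _ : U => k).
Proof. intros u; apply continuous_const. Qed.
Lemma cts_comp {V W : UniformSpace} (f : U -> V) (g : V -> W) :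
  cts f -> cts g -> cts (fun u => g (f u)).
Proof. intros Hf Hg u; apply continuous_comp; [apply Hf | apply Hg]. Qed.
Lemma cts_fst {V W : UniformSpace} (g : U -> V * W) : cts g -> cts (fun u => fst (g u)).
Proof. intros H u; apply (continuous_comp g fst); [apply H | apply continuous_fst]. Qed.
Lemma cts_snd {V W : UniformSpace} (g : U -> V * W) : cts g -> cts (fun u => snd (g u)).
Proof. intros H u; apply (continuous_comp g snd); [apply H | apply continuous_snd]. Qed.
Lemma continuous_pair {V W : UniformSpace} (f : U -> V) (g : U -> W) (u : U) :
  continuous f u -> continuous g u -> continuous (fun u => (f u, g u)) u.
Proof.
intros Hf Hg; apply (continuous_comp_2 f g (fun a b => (a, b)) u Hf Hg).
apply continuous_ext with (fun x => x); [now intros [a b] | apply continuous_id].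
Qed.
Lemma cts_pair {V W : UniformSpace} (f : U -> V) (g : U -> W) :
  cts f -> cts g -> cts (fun u => (f u, g u)).
Proof. intros Hf Hg u; apply continuous_pair; [apply Hf | apply Hg]. Qed.
Lemma cts_ext {V : UniformSpace} (f g : U -> V) : (forall u, f u = g u) -> cts f -> cts g.
Proof. intros E H u; apply continuous_ext with f; [exact E | apply H]. Qed.

Lemma cts_plus f g : cts f -> cts g -> cts (fun u => f u + g u).
Proof. intros Hf Hg u; apply (continuous_plus f g); [apply Hf | apply Hg]. Qed.
Lemma cts_opp f : cts f -> cts (fun u => - f u).
Proof. intros Hf u; apply (continuous_opp f), Hf. Qed.
Lemma cts_minus f g : cts f -> cts g -> cts (fun u => f u - g u).
Proof. intros Hf Hg u; apply (continuous_minus f g); [apply Hf | apply Hg]. Qed.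
Lemma continuous_Rmult f g u :
  continuous f u -> continuous g u -> continuous (fun u => f u * g u) u.
Proof. intros Hf Hg; apply (continuous_mult f g); assumption. Qed.
Lemma cts_mult f g : cts f -> cts g -> cts (fun u => f u * g u).
Proof. intros Hf Hg u; apply continuous_Rmult; [apply Hf | apply Hg]. Qed.
Lemma cts_pow f n : cts f -> cts (fun u => f u ^ n).
Proof.
intros Hf; induction n as [|n IH]; cbn; [apply cts_const | now apply cts_mult].
Qed.
Lemma continuous_R_comp (phi : R -> R) f u :
  ex_derive phi (f u) -> continuous f u -> continuous (fun u => phi (f u)) u.
Proof. intros Hp Hf; apply continuous_comp; [exact Hf | exact (ex_derive_continuous (V := R_NormedModule) phi (f u) Hp)]. Qed.
Lemma cts_sin f : cts f -> cts (fun u => sin (f u)).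
Proof. intros Hf u; apply continuous_R_comp; [auto_derive; exact I | apply Hf]. Qed.
Lemma cts_cos f : cts f -> cts (fun u => cos (f u)).
Proof. intros Hf u; apply continuous_R_comp; [auto_derive; exact I | apply Hf]. Qed.
Lemma cts_Rabs f : cts f -> cts (fun u => Rabs (f u)).
Proof. intros Hf u; apply (continuous_comp f Rabs); [apply Hf | apply continuous_Rabs]. Qed.
End Closure.

Lemma cts_ex_RInt (f : R -> R) a b : cts f -> ex_RInt f a b.
Proof. intros Hf; apply (ex_RInt_continuous f); intros; apply Hf. Qed.

(** Tube lemma: by compactness of the segment, the radii of the neighbourhoods of the points (u0, t)
    can be replaced by a single one. *)
Lemma locally_forall_segment {U : UniformSpace} (Q : U -> R -> Prop) (u0 : U) a b :
  (forall t, a <= t <= b -> locally ((u0, t) : U * R) (fun p => Q (fst p) (snd p))) ->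
  locally u0 (fun u => forall t, a <= t <= b -> Q u t).
Proof.
intros H.
assert (D : forall t, exists d : posreal, a <= t <= b ->
   forall u s, ball u0 d u -> ball t d s -> Q u s).
{ intros t; destruct (classic (a <= t <= b)) as [Ht|Ht].
  - destruct (H t Ht) as [d Hd]; exists d; intros _ u s Hu Hs.
    apply (Hd (u, s)); now split.
  - exists (mkposreal 1 Rlt_0_1); tauto. }
destruct (ClassicalEpsilon.choice _ D) as [delta Hdelta].
destruct (compactness_value_1d a b delta) as [d Hd].
exists d; intros u Hu t Ht.
(* [compactness_value_1d] provides the covering point only under a double negation. *)
apply NNPP; intros HQ; apply (Hd t Ht); intros [s [Hs [Hts Hds]]]; apply HQ.
apply (Hdelta s Hs).
- now apply ball_le with d.
- exact Hts.
Qed.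

Lemma RInt_dist (f g : R -> R) a b e :
  a <= b -> ex_RInt f a b -> ex_RInt g a b ->
  (forall t, a <= t <= b -> Rabs (f t - g t) <= e) ->
  Rabs (RInt f a b - RInt g a b) <= (b - a) * e.
Proof.
intros Hab Hf Hg H.
change (Rabs (minus (RInt f a b) (RInt g a b)) <= (b - a) * e).
rewrite <- (RInt_minus (V := R_CompleteNormedModule) f g a b Hf Hg).
apply (abs_RInt_le_const (fun t => minus (f t) (g t)) a b e Hab).
- now apply (ex_RInt_minus (V := R_NormedModule)).
- exact H.
Qed.

(** The tube lemma makes the integrands uniformly close on the segment, which bounds the difference
    of the integrals; reversed bounds follow by a sign. *)
Lemma cts_RInt {U : UniformSpace} (f : U -> R -> R) a b :
  cts (fun p : U * R => f (fst p) (snd p)) -> cts (fun u => RInt (f u) a b).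
Proof.
assert (P : forall a b, a <= b -> cts (fun p : U * R => f (fst p) (snd p)) ->
   cts (fun u => RInt (f u) a b)).
{ clear a b; intros a b Hab Hf u0.
  assert (I : forall u, ex_RInt (f u) a b).
  { intros u; apply cts_ex_RInt.
    refine (cts_comp (fun t : R => ((u, t) : U * R)) (fun p => f (fst p) (snd p)) _ Hf).
    apply cts_pair; [apply cts_const | apply cts_id]. }
  apply filterlim_locally; intros eps.
  (* The summand 1 keeps the quotient meaningful for a = b and makes the final bound strict. *)
  pose (e := eps / (b - a + 1)).
  assert (He : 0 < e) by (apply Rdiv_lt_0_compat; [apply eps | lra]).
  assert (He2 : (b - a) * e < eps).
  { pose proof (cond_pos eps). unfold e; replace (pos eps) with ((b - a + 1) * (eps / (b-a+1))) at 2 by (field; lra).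
    fold e; nra. }
  generalize (locally_forall_segment (fun u t => Rabs (f u t - f u0 t) <= e) u0 a b).
  intros H; eapply filter_imp; [|apply H].
  - intros u Hu. change (Rabs (RInt (f u) a b - RInt (f u0) a b) < eps).
    eapply Rle_lt_trans; [apply RInt_dist with (e := e)|exact He2]; auto.
  - intros t Ht.
    assert (C : continuous (fun p : U * R => f (fst p) (snd p) - f u0 (snd p)) (u0, t)).
    { apply (continuous_minus (fun p : U * R => f (fst p) (snd p)) (fun p => f u0 (snd p))); [apply Hf|].
      refine (cts_comp (fun p : U * R => ((u0, snd p) : U * R)) (fun p => f (fst p) (snd p)) _ Hf _).
      apply cts_pair; [apply cts_const | apply cts_snd, cts_id]. }
    generalize (proj1 (filterlim_locally _ _) C (mkposreal e He)).
    apply filter_imp; intros p Hp; cbn in Hp.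
    change (Rabs (f (fst p) (snd p) - f u0 (snd p) - (f u0 t - f u0 t)) < e) in Hp.
    replace (f (fst p) (snd p) - f u0 (snd p) - (f u0 t - f u0 t)) with (f (fst p) (snd p) - f u0 (snd p)) in Hp by ring.
    lra. }
intros Hf; destruct (Rle_or_lt a b) as [Hab|Hab]; [now apply P|].
apply cts_ext with (fun u => - RInt (f u) b a).
- intros u; apply (opp_RInt_swap (f u) b a).
  apply cts_ex_RInt.
  refine (cts_comp (fun t : R => ((u, t) : U * R)) (fun p => f (fst p) (snd p)) _ Hf).
  apply cts_pair; [apply cts_const | apply cts_id].
- apply cts_opp, P; [lra | exact Hf].
Qed.

(** Rescaling by [b u] moves the variable bound into an integrand over the fixed segment [0, 1]. *)
Lemma cts_RInt_upper {U : UniformSpace} (f : U -> R -> R) (b : U -> R) :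
  cts (fun p : U * R => f (fst p) (snd p)) -> cts b -> cts (fun u => RInt (f u) 0 (b u)).
Proof.
intros Hf Hb.
apply cts_ext with (fun u => RInt (fun t => b u * f u (b u * t + 0)) 0 1).
- intros u; etransitivity; [apply (RInt_comp_lin (f u) (b u) 0 0 1)|f_equal; ring].
  apply cts_ex_RInt.
  refine (cts_comp (fun t : R => ((u, t) : U * R)) (fun p => f (fst p) (snd p)) _ Hf).
  apply cts_pair; [apply cts_const | apply cts_id].
- apply (cts_RInt (fun u t => b u * f u (b u * t + 0))).
  assert (B : cts (fun p : U * R => b (fst p))) by (apply (cts_comp fst b); [apply cts_fst, cts_id | exact Hb]).
  apply cts_mult; [exact B|].
  refine (cts_comp (fun p : U * R => ((fst p, b (fst p) * snd p + 0) : U * R)) (fun p => f (fst p) (snd p)) _ Hf).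
  apply cts_pair; [apply cts_fst, cts_id|].
  apply cts_plus; [apply cts_mult; [exact B | apply cts_snd, cts_id] | apply cts_const].
Qed.

Lemma cts_slice {U : UniformSpace} (f : U -> R -> R) (u : U) :
  cts (fun p : U * R => f (fst p) (snd p)) -> cts (f u).
Proof.
intros Hf.
refine (cts_comp (fun t : R => ((u, t) : U * R)) (fun p => f (fst p) (snd p)) _ Hf).
apply cts_pair; [apply cts_const | apply cts_id].
Qed.

Lemma continuity_2d_pt_pair (f : R -> R -> R) x y :
  continuous (fun p : R * R => f (fst p) (snd p)) (x, y) -> continuity_2d_pt f x y.
Proof.
intros H eps.
destruct (proj1 (filterlim_locally _ _) H eps) as [d Hd].
exists d; intros u v Hu Hv; apply (Hd (u, v)); now split.
Qed.

Lemma is_derive_RInt_upper (f : R -> R) a b : cts f -> is_derive (fun b => RInt f a b) b (f b).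
Proof.
intros Hf; apply (is_derive_RInt f (fun b => RInt f a b) a b); [|apply Hf].
apply filter_forall; intros x; apply (RInt_correct f a x), cts_ex_RInt, Hf.
Qed.

Lemma is_derive_RInt_cts (f df : R -> R -> R) a b x :
  (forall x t, is_derive (fun x => f x t) x (df x t)) ->
  (forall x, cts (f x)) ->
  cts (fun p : R * R => df (fst p) (snd p)) ->
  is_derive (fun x => RInt (f x) a b) x (RInt (df x) a b).
Proof.
intros Hd Hf Hc.
replace (RInt (df x) a b) with (RInt (fun t => Derive (fun u => f u t) x) a b).
2:{ apply RInt_ext; intros t _; apply is_derive_unique, Hd. }
apply (is_derive_RInt_param f a b x).
- apply filter_forall; intros u t _; eexists; apply Hd.
- intros t _; apply continuity_2d_pt_pair.
  apply continuous_ext with (fun p : R * R => df (fst p) (snd p)); [|apply Hc].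
  intros p; symmetry; apply is_derive_unique, Hd.
- apply filter_forall; intros u; now apply cts_ex_RInt.
Qed.

Lemma derive_eq_0_const (f : R -> R) a b : (forall x, is_derive f x 0) -> f a = f b.
Proof.
intros H.
assert (E : RInt (fun _ => 0) a b = f b - f a).
{ apply is_RInt_unique, (is_RInt_derive f (fun _ => 0)); intros; [apply H | apply continuous_const]. }
rewrite RInt_const in E; change (scal (b - a) 0) with ((b - a) * 0) in E; lra.
Qed.

Lemma eq_of_derive (f g df : R -> R) a b :
  (forall x, is_derive f x (df x)) -> (forall x, is_derive g x (df x)) ->
  f a = g a -> f b = g b.
Proof.
intros Hf Hg E.
assert (f a - g a = f b - g b); [|lra].
apply (derive_eq_0_const (fun x => f x - g x)); intros x.
replace 0 with (minus (df x) (df x)) by (apply (minus_eq_zero (G := R_AbelianGroup))).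
now apply (is_derive_minus f g).
Qed.

(** Fubini by differentiation: as functions of [b], both sides have the inner integral at [b] as
    derivative, and both vanish for b = a. *)
Lemma RInt_swap (f : R -> R -> R) a b c d :
  cts (fun p : R * R => f (fst p) (snd p)) ->
  RInt (fun x => RInt (fun y => f x y) c d) a b = RInt (fun y => RInt (fun x => f x y) a b) c d.
Proof.
intros Hf.
assert (Hs : cts (fun p : R * R => f (snd p) (fst p))).
{ refine (cts_comp (fun p : R * R => ((snd p, fst p) : R * R)) (fun p => f (fst p) (snd p)) _ Hf).
  apply cts_pair; [apply cts_snd, cts_id | apply cts_fst, cts_id]. }
assert (Hs' : forall y, cts (fun x => f x y)) by (intros y; exact (cts_slice (fun y x => f x y) y Hs)).
apply (eq_of_derive (fun b => RInt (fun x => RInt (fun y => f x y) c d) a b)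
        (fun b => RInt (fun y => RInt (fun x => f x y) a b) c d)
        (fun x => RInt (fun y => f x y) c d) a b).
- intros x; apply (is_derive_RInt_upper (fun x => RInt (fun y => f x y) c d)).
  now apply (cts_RInt (fun x y => f x y)).
- intros x; apply (is_derive_RInt_cts (fun b y => RInt (fun x => f x y) a b) f).
  + intros u t; now apply (is_derive_RInt_upper (fun x => f x t)).
  + intros u; now apply (cts_RInt (fun y x => f x y)).
  + exact Hf.
- rewrite RInt_point; symmetry; rewrite (RInt_ext _ (fun _ => 0)).
  + rewrite RInt_const; apply Rmult_0_r.
  + intros y _; exact (RInt_point a (fun x => f x y)).
Qed.

(** The form in which integration by parts is used: a total derivative integrates to zero when its
    primitive takes equal values at the ends, as on a closed circle. *)
Lemma RInt_period_derive (f df : R -> R) a b :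
  (forall x, is_derive f x (df x)) -> cts df -> f a = f b -> RInt df a b = 0.
Proof.
intros Hd Hc E.
rewrite (is_RInt_unique df a b (f b - f a)); [lra|].
apply (is_RInt_derive f df); intros; [apply Hd | apply Hc].
Qed.

(** Integrability of the limit is the point: it is applied to integrals of the singular flag kernel,
    for which no continuity is at hand. *)
Lemma RInt_unif_lim (f : nat -> R -> R) (g : R -> R) a b :
  a <= b ->
  (forall n, ex_RInt (f n) a b) ->
  (forall e, 0 < e -> exists N, forall n, (N <= n)%nat ->
      forall t, a <= t <= b -> Rabs (f n t - g t) <= e) ->
  ex_RInt g a b.
Proof.
intros Hab If H.
(* [filterlim_RInt] asks for uniform convergence on the whole line; clamping the argument extends
   what is known on [a, b]. *)
pose (cl := fun t => Rmax a (Rmin b t)).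
assert (C : forall t, a <= cl t <= b).
{ intros t; unfold cl; split; [apply Rmax_l|]; apply Rmax_lub; [exact Hab | apply Rmin_l]. }
assert (Ci : forall t, Rmin a b < t < Rmax a b -> cl t = t).
{ intros t; rewrite Rmin_left, Rmax_right by exact Hab; intros Ht.
  unfold cl; rewrite Rmin_right by lra; apply Rmax_right; lra. }
destruct (filterlim_RInt (V := R_CompleteNormedModule) (fun n t => f n (cl t)) a b eventually _
   (fun t => g (cl t)) (fun n => RInt (f n) a b)) as [If' [_ HI]].
- intros n; apply (is_RInt_ext (f n)); [|apply (RInt_correct (f n)), If].
  intros t Ht; now rewrite Ci.
- apply filterlim_locally; intros eps.
  destruct (H (eps / 2)) as [N HN]; [apply is_pos_div_2|].
  exists N; intros n Hn t.
  change (Rabs (f n (cl t) - g (cl t)) < eps).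
  eapply Rle_lt_trans; [apply HN; auto|].
  pose proof (cond_pos eps); lra.
- exists If'; apply (is_RInt_ext (fun t => g (cl t))); [|exact HI].
  intros t Ht; now rewrite Ci.
Qed.

Ltac cts :=
  repeat (intros; cbn [fst snd];
  first [ assumption |
  lazymatch goal with
  | |- cts (fun u => u) => apply cts_id
  | |- cts (fun u => Rplus (@?f u) (@?g u)) => apply cts_plus
  | |- cts (fun u => Rminus (@?f u) (@?g u)) => apply cts_minus
  | |- cts (fun u => Ropp (@?f u)) => apply cts_opp
  | |- cts (fun u => Rmult (@?f u) (@?g u)) => apply cts_mult
  | |- cts (fun u => pow (@?f u) _) => apply cts_pow
  | |- cts (fun u => sin (@?f u)) => apply cts_sin
  | |- cts (fun u => cos (@?f u)) => apply cts_cos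
  | |- cts (fun u => Rabs (@?f u)) => apply cts_Rabs
  | |- cts (fun u => fst (@?f u)) => apply cts_fst
  | |- cts (fun u => snd (@?f u)) => apply cts_snd
  | |- cts (fun u => (@?f u, @?g u)) => apply cts_pair
  | |- cts sin => apply (cts_sin (fun u => u))
  | |- cts cos => apply (cts_cos (fun u => u))
  | |- cts Rabs => apply (cts_Rabs (fun u => u))
  | |- cts fst => apply (cts_fst (fun u => u))
  | |- cts snd => apply (cts_snd (fun u => u))
  | |- cts _ => apply cts_const
  end ]).

(* Coquelicot often types real equations in a structure convertible to [R], which [ring] and [field]
   do not recognize. *)
Ltac Rring := match goal with |- @eq _ ?a ?b => change (@eq R a b) end; ring.
Ltac Rfield := match goal with |- @eq _ ?a ?b => change (@eq R a b) end; field.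

Lemma RInt_Rplus (f g : R -> R) a b : ex_RInt f a b -> ex_RInt g a b ->
  RInt (fun t => f t + g t) a b = RInt f a b + RInt g a b.
Proof. exact (RInt_plus (V := R_CompleteNormedModule) f g a b). Qed.
Lemma RInt_Rminus (f g : R -> R) a b : ex_RInt f a b -> ex_RInt g a b ->
  RInt (fun t => f t - g t) a b = RInt f a b - RInt g a b.
Proof. exact (RInt_minus (V := R_CompleteNormedModule) f g a b). Qed.
Lemma RInt_Rmult (f : R -> R) k a b : ex_RInt f a b ->
  RInt (fun t => k * f t) a b = k * RInt f a b.
Proof. exact (RInt_scal (V := R_CompleteNormedModule) f a b k). Qed.

(** * Integration along the circles of latitude *)

Section Circle.
(** Coordinates of a unit normal xi in the frame whose third vector is the pole. Below, [w] is the
    component of xi along the horizontal radius at longitude [ph]. *)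
Variables A B C : R.
Hypothesis HABC : A ^ 2 + B ^ 2 + C ^ 2 = 1.

Let w (ph : R) := A * cos ph + B * sin ph.
Let x (ph : R) := B * cos ph - A * sin ph.
Let z (nu ph : R) := sin nu * w ph + cos nu * C.
Let y (nu ph : R) := cos nu * w ph - sin nu * C.

Lemma circle_wz nu ph : sin nu * z nu ph + cos nu * y nu ph = w ph.
Proof.
transitivity (((sin nu)² + (cos nu)²) * w ph); [unfold z, y, Rsqr; Rring | rewrite sin2_cos2; Rring].
Qed.

Lemma circle_norm nu ph : x ph ^ 2 + y nu ph ^ 2 + z nu ph ^ 2 = 1.
Proof.
transitivity ((sin nu ^ 2 + cos nu ^ 2) * w ph ^ 2 + (sin nu ^ 2 + cos nu ^ 2) * C ^ 2 + x ph ^ 2).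
- unfold z, y; Rring.
- rewrite <- !Rsqr_pow2, sin2_cos2, !Rsqr_pow2.
  transitivity ((A ^ 2 + B ^ 2) * (sin ph ^ 2 + cos ph ^ 2) + C ^ 2).
  + unfold w, x; Rring.
  + rewrite <- (Rsqr_pow2 (sin ph)), <- (Rsqr_pow2 (cos ph)), sin2_cos2; lra.
Qed.

(* With [K' = k], integrating [d/dph (x K(z))] over the circle turns [sin nu * (integral of x^2 k(z))] into
   the integral of [w K(z)], where [w] does not depend on [nu]; this lets [k] be merely continuous. *)
Lemma circle_kernel_derive (k : R -> R) (nu : R) : cts k ->
  is_derive (fun nu => sin nu ^ 2 * RInt (fun ph => x ph ^ 2 * k (z nu ph)) 0 (2 * PI)) nu
    (sin nu * cos nu * RInt (fun ph => (1 - z nu ph ^ 2) * k (z nu ph)) 0 (2 * PI)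
     + sin nu ^ 2 * RInt (fun ph => z nu ph * y nu ph * k (z nu ph)) 0 (2 * PI)).
Proof.
intros Hk.
assert (EK : exists K : R -> R, forall t, is_derive K t (k t)).
{ exists (fun t => RInt k 0 t); intros; now apply is_derive_RInt_upper. }
destruct EK as [K HK].
assert (DK : forall t, Derive (fun t => K t) t = k t) by (intros; apply is_derive_unique, HK).
assert (cK : cts K).
{ intros t; apply (ex_derive_continuous (V := R_NormedModule) K); eexists; apply HK. }
assert (cw : cts w) by (unfold w; cts).
assert (cx : cts x) by (unfold x; cts).
assert (Hkk : forall (f : R -> R), cts f -> cts (fun t => k (f t))) by (intros f Hf; exact (cts_comp f k Hf Hk)).
assert (HKK : forall (f : R -> R), cts f -> cts (fun t => K (f t))) by (intros f Hf; exact (cts_comp f K Hf cK)).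
assert (cz : forall nu, cts (z nu)) by (intros; unfold z; cts).
assert (cy : forall nu, cts (y nu)) by (intros; unfold y; cts).
assert (P : forall nu, sin nu * RInt (fun ph => x ph ^ 2 * k (z nu ph)) 0 (2 * PI)
                     = RInt (fun ph => w ph * K (z nu ph)) 0 (2 * PI)).
{ intros u.
  rewrite <- RInt_Rmult by (apply cts_ex_RInt; pose proof (Hkk _ (cz u)); cts).
  apply Rminus_diag_uniq.
  rewrite <- RInt_Rminus by (apply cts_ex_RInt; pose proof (Hkk _ (cz u)); pose proof (HKK _ (cz u)); cts).
  apply (RInt_period_derive (fun ph => x ph * K (z u ph))).
  - intros ph; unfold x, z, w.
    auto_derive; [repeat split; exact (ex_intro _ _ (HK _))|].
    rewrite DK.
    Rring.
  - pose proof (Hkk _ (cz u)); pose proof (HKK _ (cz u)); cts.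
  - unfold x, z, w; rewrite sin_2PI, cos_2PI, sin_0, cos_0; reflexivity. }
apply is_derive_ext with (fun nu => sin nu * RInt (fun ph => w ph * K (z nu ph)) 0 (2 * PI)).
{ intros u; rewrite <- P; Rring. }
assert (D : is_derive (fun nu => RInt (fun ph => w ph * K (z nu ph)) 0 (2 * PI)) nu
      (RInt (fun ph => w ph * (y nu ph * k (z nu ph))) 0 (2 * PI))).
{ apply (is_derive_RInt_cts (fun nu ph => w ph * K (z nu ph)) (fun nu ph => w ph * (y nu ph * k (z nu ph)))).
  - intros u ph; unfold z, y, w.
    auto_derive; [repeat split; exact (ex_intro _ _ (HK _))|].
    rewrite DK.
    Rring.
  - intros u; pose proof (HKK _ (cz u)); cts.
  - assert (cts (fun p : R * R => k (z (fst p) (snd p)))).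
    { apply (cts_comp (fun p : R * R => z (fst p) (snd p)) k); [unfold z, w; cts | exact Hk]. }
    unfold w, y, w; cts. }
assert (Q := is_derive_mult (fun nu => sin nu : R_AbsRing) _ nu (cos nu) _ ltac:(auto_derive; [exact I | Rring]) D Rmult_comm).
eapply (is_derive_ext) in Q; [|intros t; reflexivity].
match goal with |- is_derive _ _ ?v => match type of Q with is_derive _ _ ?v' => replace v with v' end end;
  [exact Q|].
unfold plus, mult; cbn -[RInt pow].
rewrite <- P.
assert (cxk : cts (fun ph => x ph ^ 2 * k (z nu ph))) by (pose proof (Hkk _ (cz nu)); cts).
assert (czk : cts (fun ph => z nu ph * y nu ph * k (z nu ph))) by (pose proof (Hkk _ (cz nu)); pose proof (cz nu); pose proof (cy nu); cts).
assert (cyk : cts (fun ph => y nu ph ^ 2 * k (z nu ph))) by (pose proof (Hkk _ (cz nu)); pose proof (cy nu); cts).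
(* Resolving [w] as sin nu z + cos nu y separates the two integrals of the claim; the part with y^2
   joins x^2 to form 1 - z^2. *)
rewrite (RInt_ext (fun ph => w ph * _) (fun ph => sin nu * (z nu ph * y nu ph * k (z nu ph)) + cos nu * (y nu ph ^ 2 * k (z nu ph)))).
2:{ intros ph _; rewrite <- (circle_wz nu ph); Rring. }
rewrite (RInt_ext (fun ph => (1 - _) * _) (fun ph => x ph ^ 2 * k (z nu ph) + y nu ph ^ 2 * k (z nu ph))).
2:{ intros ph _; replace (1 - z nu ph ^ 2) with (x ph ^ 2 + y nu ph ^ 2) by (pose proof (circle_norm nu ph); lra); Rring. }
rewrite !RInt_Rplus, !RInt_Rmult by (apply cts_ex_RInt; cts).
Rring.
Qed.

(* Divergence theorem for the field [F(z) (xi - z s)] on the sphere, whose flux through the parallel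
   circle is differentiated. *)
Lemma circle_flux_derive (F dF : R -> R) (nu : R) :
  (forall t, is_derive F t (dF t)) -> cts dF ->
  is_derive (fun nu => sin nu * RInt (fun ph => y nu ph * F (z nu ph)) 0 (2 * PI)) nu
    (sin nu * RInt (fun ph => (1 - z nu ph ^ 2) * dF (z nu ph) - 2 * z nu ph * F (z nu ph)) 0 (2 * PI)).
Proof.
intros HF cdF.
assert (DF : forall t, Derive (fun t => F t) t = dF t) by (intros; apply is_derive_unique, HF).
assert (cF : cts F).
{ intros t; apply (ex_derive_continuous (V := R_NormedModule) F); eexists; apply HF. }
assert (cw : cts w) by (unfold w; cts).
assert (cx : cts x) by (unfold x; cts).
assert (cz : forall nu, cts (z nu)) by (intros; unfold z; cts).
assert (cy : forall nu, cts (y nu)) by (intros; unfold y; cts).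
assert (cFz : forall u, cts (fun ph => F (z u ph))) by (intros u; exact (cts_comp (z u) F (cz u) cF)).
assert (cdFz : forall u, cts (fun ph => dF (z u ph))) by (intros u; exact (cts_comp (z u) dF (cz u) cdF)).
assert (D : is_derive (fun nu => RInt (fun ph => y nu ph * F (z nu ph)) 0 (2 * PI)) nu
      (RInt (fun ph => y nu ph ^ 2 * dF (z nu ph) - z nu ph * F (z nu ph)) 0 (2 * PI))).
{ apply (is_derive_RInt_cts (fun nu ph => y nu ph * F (z nu ph))
           (fun nu ph => y nu ph ^ 2 * dF (z nu ph) - z nu ph * F (z nu ph))).
  - intros u ph; unfold z, y, w.
    auto_derive; [repeat split; exact (ex_intro _ _ (HF _))|].
    rewrite DF.
    Rring.
  - intros u; pose proof (cFz u); pose proof (cy u); cts.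
  - assert (cts (fun p : R * R => z (fst p) (snd p))) as cz2 by (unfold z, w; cts).
    pose proof (cts_comp _ _ cz2 cF); pose proof (cts_comp _ _ cz2 cdF).
    unfold y, w; cts. }
(* The total derivative of x F(z) along the parallel trades sin nu x^2 F' for w F; this supplies the
   x^2 missing from y^2 in 1 - z^2. *)
assert (P : RInt (fun ph => x ph ^ 2 * dF (z nu ph) * sin nu - w ph * F (z nu ph)) 0 (2 * PI) = 0).
{ apply (RInt_period_derive (fun ph => x ph * F (z nu ph))).
  - intros ph; unfold x, z, w.
    auto_derive; [repeat split; exact (ex_intro _ _ (HF _))|].
    rewrite DF.
    Rring.
  - pose proof (cFz nu); pose proof (cdFz nu); cts.
  - unfold x, z, w; rewrite sin_2PI, cos_2PI, sin_0, cos_0; reflexivity. }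
assert (Q := is_derive_mult (fun nu => sin nu : R_AbsRing) _ nu (cos nu) _ ltac:(auto_derive; [exact I | Rring]) D Rmult_comm).
match goal with |- is_derive _ _ ?v => match type of Q with is_derive _ _ ?v' => replace v with v' end end;
  [exact Q|].
unfold plus, mult; cbn -[RInt pow].
apply Rminus_diag_uniq_sym; etransitivity; [|exact P].
pose proof (cFz nu); pose proof (cdFz nu); pose proof (cy nu); pose proof (cz nu).
rewrite <- !RInt_Rmult by (apply cts_ex_RInt; cts).
rewrite <- RInt_Rplus by (apply cts_ex_RInt; cts).
rewrite <- RInt_Rminus by (apply cts_ex_RInt; cts).
apply RInt_ext; intros ph _.
rewrite <- (circle_norm nu ph).
rewrite <- (circle_wz nu ph).
Rring.
Qed.
End Circle.

(** Hides the exponent 2m + 1 behind a variable, so that the factors [INR k] and [pred k] produced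
    by [auto_derive] are rewritten instead of computed. *)
Lemma odd_pow_facts m : exists k : nat, INR k = 2 * INR m + 1 /\ Init.Nat.pred k = (2 * m)%nat /\
  forall r, r ^ k = r ^ (2 * m) * r.
Proof.
exists (2 * m + 1)%nat; split; [|split; [lia|]].
- rewrite plus_INR, mult_INR; reflexivity.
- intros r; rewrite pow_add; ring.
Qed.

(* Wallis' recurrence. *)
Lemma RInt_cos_sin_pow (a b : R) n : a ^ 2 + b ^ 2 <= 1 ->
  0 <= RInt (fun t => (a * cos t + b * sin t) ^ (2 * n)) 0 PI <= PI / sqrt (2 * INR n + 1).
Proof.
intros H.
pose (c := fun t => a * cos t + b * sin t).
assert (cc : cts c) by (unfold c; cts).
pose (W := fun n => RInt (fun t => c t ^ (2 * n)) 0 PI).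
change (0 <= W n <= PI / sqrt (2 * INR n + 1)).
assert (W0 : forall n, 0 <= W n).
{ intros m; apply RInt_ge_0; [apply Rlt_le, PI_RGT_0 | apply cts_ex_RInt; cts |].
  intros t _; rewrite pow_mult; apply pow_le, pow2_ge_0. }
split; [apply W0|].
assert (R1 : forall m, (2 * INR m + 2) * W (S m) <= (2 * INR m + 1) * W m).
{ intros m.
  (* The integrand is the derivative of c^(2m+1) c', with c'^2 = a^2 + b^2 - c^2. Between 0 and pi
     both c and c' change sign, so the boundary terms cancel. *)
  assert (E : RInt (fun t => (2 * INR m + 1) * (a ^ 2 + b ^ 2) * c t ^ (2 * m) - (2 * INR m + 2) * c t ^ (2 * S m)) 0 PI = 0).
  { destruct (odd_pow_facts m) as [k [Ek [Pk Hk]]].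
    apply (RInt_period_derive (fun t => c t ^ k * (b * cos t - a * sin t))).
    - intros t; unfold c; auto_derive; [exact I|].
      rewrite Ek, Pk, Hk.
      replace (2 * S m)%nat with (2 * m + 2)%nat by lia.
      rewrite pow_add.
      generalize ((a * cos t + b * sin t) ^ (2 * m)); intros Q.
      pose proof (sin2_cos2 t) as E; unfold Rsqr in E.
      replace (a ^ 2 + b ^ 2) with ((a * cos t + b * sin t) * (a * cos t + b * sin t) + (b * cos t - a * sin t) * (b * cos t - a * sin t)).
      2:{ transitivity ((a*a+b*b) * (sin t * sin t + cos t * cos t)); [|rewrite E]; ring. }
      ring.
    - cts.
    - unfold c; rewrite cos_PI, sin_PI, cos_0, sin_0, !Hk, !pow_mult.
      replace ((a * -1 + b * 0) ^ 2) with ((a * 1 + b * 0) ^ 2) by ring.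
      ring. }
  rewrite RInt_Rminus, !RInt_Rmult in E by (apply cts_ex_RInt; cts).
  fold (W m) (W (S m)) in E.
  pose proof (W0 m); pose proof (pos_INR m).
  assert (0 <= (2 * INR m + 1) * W m * (1 - (a^2+b^2))) by (repeat apply Rmult_le_pos; lra).
  lra. }
(* By [R1] and (2m + 1)(2m + 3) <= (2m + 2)^2, the quantity W_m^2 (2m + 1) does not increase with m;
   at m = 0 it is pi^2. *)
assert (R2 : forall m, W m ^ 2 * (2 * INR m + 1) <= PI ^ 2).
{ induction m as [|m IH].
  - unfold W. rewrite (RInt_ext _ (fun _ => 1)) by (intros; apply pow_O).
    rewrite RInt_const; unfold scal; cbn; unfold mult; cbn. apply Req_le; Rring.
  - rewrite S_INR. pose proof (pos_INR m) as Hm. pose proof (W0 m) as Hp; pose proof (W0 (S m)) as Hq.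
    set (p := W m) in *; set (q := W (S m)) in *; pose proof (R1 m) as HR; fold p q in HR.
    set (r := INR m) in *.
    assert (((2 * r + 2) * q) ^ 2 <= ((2 * r + 1) * p) ^ 2) by (apply pow_incr; nra).
    eapply Rle_trans; [|exact IH].
    apply Rmult_le_reg_l with ((2 * r + 2) ^ 2); [nra|].
    replace ((2 * r + 2) ^ 2 * (q ^ 2 * (2 * (r + 1) + 1))) with (((2 * r + 2) * q) ^ 2 * (2 * r + 3)) by Rring.
    apply Rle_trans with (((2 * r + 1) * p) ^ 2 * (2 * r + 3)); [apply Rmult_le_compat_r; lra|].
    replace (((2 * r + 1) * p) ^ 2 * (2 * r + 3)) with ((p ^ 2 * (2 * r + 1)) * ((2 * r + 1) * (2 * r + 3))) by Rring.
    rewrite (Rmult_comm ((2*r+2)^2)).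
    apply Rmult_le_compat_l; [pose proof (pow2_ge_0 p); nra | nra]. }
pose proof (pos_INR n).
assert (0 < sqrt (2 * INR n + 1)) by (apply sqrt_lt_R0; lra).
apply Rmult_le_reg_r with (sqrt (2 * INR n + 1)); [assumption|].
replace (PI / sqrt (2 * INR n + 1) * sqrt (2 * INR n + 1)) with PI by (field; lra).
apply Rsqr_incr_0_var; [|apply Rlt_le, PI_RGT_0].
rewrite Rsqr_mult, Rsqr_sqrt by lra.
rewrite !Rsqr_pow2; apply R2.
Qed.

(** * Integration over the sphere *)

(** Integrability makes the specification of the choice satisfiable, and the value of [RiemannInt]
    does not depend on the proof of integrability. *)
Lemma Defs_RInt_eq (f : R -> R) a b : ex_RInt f a b -> Defs.RInt f a b = RInt f a b.
Proof.
intros H; unfold Defs.RInt.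
pose proof (ex_RInt_Reals_0 _ _ _ H) as pr.
assert (E := epsilon_spec (inhabits 0) (fun v => exists pr : Riemann_integrable f a b, RiemannInt pr = v)
  (ex_intro _ _ (ex_intro _ pr eq_refl))).
destruct E as [pr' E]; rewrite <- E; symmetry; apply RInt_Reals.
Qed.

Lemma Deriv_eq (f : R -> R) x l : is_derive f x l -> Deriv f x = l.
Proof.
intros H; apply is_derive_Reals in H; unfold Deriv.
assert (E := epsilon_spec (inhabits 0) (fun l => derivable_pt_lim f x l) (ex_intro _ _ H)).
exact (uniqueness_limite f x _ _ E H).
Qed.

Lemma Defs_RInt_cts (f : R -> R) a b : cts f -> Defs.RInt f a b = RInt f a b.
Proof. intros H; now apply Defs_RInt_eq, cts_ex_RInt. Qed.

Definition sint (f : V3 -> R) : R :=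
  RInt (fun ps => RInt (fun th => f (sph_pt th ps) * sin th) 0 PI) 0 (2 * PI).

Definition sph_cts (f : V3 -> R) := cts (fun q : R * R => f (sph_pt (snd q) (fst q))).

Lemma sph_cts_slice f ps : sph_cts f -> cts (fun th => f (sph_pt th ps) * sin th).
Proof. intros H; pose proof (cts_slice (fun ps th => f (sph_pt th ps)) ps H); cts. Qed.

Lemma cts_sint {U : UniformSpace} (f : U -> V3 -> R) :
  cts (fun q : (U * R) * R => f (fst (fst q)) (sph_pt (snd q) (snd (fst q)))) ->
  cts (fun u => sint (f u)).
Proof.
intros H; unfold sint.
apply (cts_RInt (fun u ps => RInt (fun th => f u (sph_pt th ps) * sin th) 0 PI)).
apply (cts_RInt (fun (p : U * R) th => f (fst p) (sph_pt th (snd p)) * sin th)).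
cts.
Qed.

Lemma sint_inner_cts f : sph_cts f -> cts (fun ps => RInt (fun th => f (sph_pt th ps) * sin th) 0 PI).
Proof.
intros H; apply (cts_RInt (fun ps th => f (sph_pt th ps) * sin th)).
unfold sph_cts in H; cts.
Qed.

Lemma sphere_int_eq f : sph_cts f -> sphere_int f = sint f.
Proof.
intros H; unfold sphere_int, sint.
replace (fun ph => Defs.RInt (fun th => f (sph_pt th ph) * sin th) 0 PI)
  with (fun ph => RInt (fun th => f (sph_pt th ph) * sin th) 0 PI).
- now apply Defs_RInt_cts, sint_inner_cts.
- apply FunctionalExtensionality.functional_extensionality; intros ph; symmetry.
  now apply Defs_RInt_cts, sph_cts_slice.
Qed.

Lemma unit_sph_pt th ps : unit_vec (sph_pt th ps).
Proof.
unfold unit_vec, dot; cbn.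
transitivity ((sin th)² * ((sin ps)² + (cos ps)²) + (cos th)²); [unfold Rsqr; Rring|].
rewrite sin2_cos2, Rmult_1_r; apply sin2_cos2.
Qed.

Lemma sint_ext f g : (forall xi, unit_vec xi -> f xi = g xi) -> sint f = sint g.
Proof.
intros H; apply RInt_ext; intros ps _; apply RInt_ext; intros th _; rewrite H; [reflexivity | apply unit_sph_pt].
Qed.

Lemma sint_plus f g : sph_cts f -> sph_cts g -> sint (fun xi => f xi + g xi) = sint f + sint g.
Proof.
intros Hf Hg; unfold sint.
rewrite <- RInt_Rplus by (apply cts_ex_RInt; now apply sint_inner_cts).
apply RInt_ext; intros ps _.
rewrite <- RInt_Rplus by (apply cts_ex_RInt; now apply sph_cts_slice).
apply RInt_ext; intros; Rring.
Qed.

Lemma sint_scal k f : sph_cts f -> sint (fun xi => k * f xi) = k * sint f.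
Proof.
intros Hf; unfold sint.
rewrite <- RInt_Rmult by (apply cts_ex_RInt; now apply sint_inner_cts).
apply RInt_ext; intros ps _.
rewrite <- RInt_Rmult by (apply cts_ex_RInt; now apply sph_cts_slice).
apply RInt_ext; intros; Rring.
Qed.

Lemma sint_minus f g : sph_cts f -> sph_cts g -> sint (fun xi => f xi - g xi) = sint f - sint g.
Proof.
intros Hf Hg.
transitivity (sint f + sint (fun xi => -1 * g xi)).
- rewrite <- sint_plus by (unfold sph_cts in *; cts).
  apply sint_ext; intros; Rring.
- rewrite sint_scal by assumption; Rring.
Qed.

Lemma sint_le f g : sph_cts f -> sph_cts g -> (forall th ps, 0 <= th <= PI -> 0 <= ps <= 2 * PI -> f (sph_pt th ps) <= g (sph_pt th ps)) ->
  sint f <= sint g.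
Proof.
intros Hf Hg H; unfold sint.
pose proof PI_RGT_0.
apply RInt_le; [lra | apply cts_ex_RInt; now apply sint_inner_cts | apply cts_ex_RInt; now apply sint_inner_cts |].
intros ps Hps.
apply RInt_le; [lra | apply cts_ex_RInt; now apply sph_cts_slice | apply cts_ex_RInt; now apply sph_cts_slice |].
intros th Hth; apply Rmult_le_compat_r; [apply sin_ge_0; lra | apply H; lra].
Qed.

Lemma sint_abs f g : sph_cts f -> sph_cts g -> (forall th ps, 0 <= th <= PI -> 0 <= ps <= 2 * PI -> Rabs (f (sph_pt th ps)) <= g (sph_pt th ps)) ->
  Rabs (sint f) <= sint g.
Proof.
intros Hf Hg H; apply Rabs_le; split.
- replace (- sint g) with (sint (fun xi => -1 * g xi)) by (rewrite sint_scal by assumption; Rring).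
  apply sint_le; [unfold sph_cts in *; cts | assumption |].
  intros th ps H1 H2; specialize (H th ps H1 H2); apply Rabs_le_between in H; lra.
- apply sint_le; try assumption.
  intros th ps H1 H2; specialize (H th ps H1 H2); apply Rabs_le_between in H; lra.
Qed.

Lemma sint_RInt (f : R -> V3 -> R) a b :
  cts (fun q : (R * R) * R => f (fst (fst q)) (sph_pt (snd q) (snd (fst q)))) ->
  sint (fun xi => RInt (fun t => f t xi) a b) = RInt (fun t => sint (f t)) a b.
Proof.
intros H; unfold sint.
rewrite (RInt_swap (fun t ps => RInt (fun th => f t (sph_pt th ps) * sin th) 0 PI)).
2:{ apply (cts_RInt (fun (p : R * R) th => f (fst p) (sph_pt th (snd p)) * sin th)); cts. }
apply RInt_ext; intros ps _.
assert (H1 : cts (fun q : R * R => f (fst q) (sph_pt (snd q) ps))).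
{ refine (cts_comp (fun q : R * R => ((fst q, ps), snd q) : (R * R) * R) _ _ H); cts. }
rewrite (RInt_swap (fun t th => f t (sph_pt th ps) * sin th)) by cts.
apply RInt_ext; intros th _.
rewrite Rmult_comm, <- RInt_Rmult.
- apply RInt_ext; intros; Rring.
- apply cts_ex_RInt.
  refine (cts_comp (fun t : R => (t, th) : R * R) _ _ H1); cts.
Qed.

Lemma dot_sph_pt s th ps :
  dot s (sph_pt th ps) = sin th * (vx s * cos ps + vy s * sin ps) + cos th * vz s.
Proof. unfold dot; cbn; Rring. Qed.

Lemma sph_cts_dot s : sph_cts (dot s).
Proof. unfold sph_cts, dot; cbn; cts. Qed.

(** Divergence theorem on the whole sphere with F(z) = z^(2m+1): the flux vanishes at nu = 0 and nu
    = pi, which leaves (2m + 1) I_m = (2m + 3) I_(m+1) for the moments. This treats any position of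
    [s] relative to the axis without rotating the sphere. *)
Lemma sint_dot_pow s n : unit_vec s -> sint (fun xi => dot s xi ^ (2 * n)) = 4 * PI / (2 * INR n + 1).
Proof.
intros Hs.
assert (C : forall n, sph_cts (fun xi => dot s xi ^ n)).
{ intros m; pose proof (sph_cts_dot s); unfold sph_cts in *; cts. }
assert (R1 : forall n, (2 * INR n + 1) * sint (fun xi => dot s xi ^ (2 * n))
     = (2 * INR n + 3) * sint (fun xi => dot s xi ^ (2 * S n))).
{ intros m; destruct (odd_pow_facts m) as [k [Ek [Pk Hk]]].
  rewrite <- !sint_scal by apply C.
  apply Rminus_diag_uniq.
  rewrite <- sint_minus by (pose proof (C (2 * m)%nat); pose proof (C (2 * S m)%nat); unfold sph_cts in *; cts).
  unfold sint.
  rewrite <- (RInt_swap (fun th ps => ((2 * INR m + 1) * dot s (sph_pt th ps) ^ (2 * m) - (2 * INR m + 3) * dot s (sph_pt th ps) ^ (2 * S m)) * sin th)).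
  2:{ unfold dot; cbn [vx vy vz sph_pt]; cts. }
  etransitivity; [|apply (RInt_period_derive (fun nu => sin nu * RInt (fun ph => (cos nu * (vx s * cos ph + vy s * sin ph) - sin nu * vz s) * (sin nu * (vx s * cos ph + vy s * sin ph) + cos nu * vz s) ^ k) 0 (2 * PI))
    (fun nu => sin nu * RInt (fun ph => (1 - (sin nu * (vx s * cos ph + vy s * sin ph) + cos nu * vz s) ^ 2)
       * ((2 * INR m + 1) * (sin nu * (vx s * cos ph + vy s * sin ph) + cos nu * vz s) ^ (2 * m))
       - 2 * (sin nu * (vx s * cos ph + vy s * sin ph) + cos nu * vz s) * (sin nu * (vx s * cos ph + vy s * sin ph) + cos nu * vz s) ^ k) 0 (2 * PI)) 0 PI)].
  - apply RInt_ext; intros th _.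
    rewrite <- RInt_Rmult by (apply cts_ex_RInt; cts).
    apply RInt_ext; intros ps _; rewrite dot_sph_pt.
    replace (2 * S m)%nat with (2 * m + 2)%nat by lia; rewrite Hk, pow_add; Rring.
  - intros nu.
    apply (circle_flux_derive (vx s) (vy s) (vz s)) with (F := fun t => t ^ k) (dF := fun t => (2 * INR m + 1) * t ^ (2 * m)).
    + unfold unit_vec, dot in Hs; rewrite <- Hs; Rring.
    + intros t; auto_derive; [exact I|].
      rewrite Ek, Pk; Rring.
    + cts.
  - apply cts_mult; [cts|].
    apply (cts_RInt (fun nu ph => (1 - (sin nu * (vx s * cos ph + vy s * sin ph) + cos nu * vz s) ^ 2)
       * ((2 * INR m + 1) * (sin nu * (vx s * cos ph + vy s * sin ph) + cos nu * vz s) ^ (2 * m))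
       - 2 * (sin nu * (vx s * cos ph + vy s * sin ph) + cos nu * vz s) * (sin nu * (vx s * cos ph + vy s * sin ph) + cos nu * vz s) ^ k)).
    cts.
  - rewrite sin_PI, sin_0; Rring. }
induction n as [|n IH].
- unfold sint.
  rewrite (RInt_ext _ (fun _ => 2)).
  + rewrite RInt_const; unfold scal; cbn; unfold mult; cbn; field.
  + intros ps _; rewrite (RInt_ext _ (fun t => sin t)) by (intros; simpl; Rring).
    apply is_RInt_unique; replace 2 with (minus (- cos PI) (- cos 0))
      by (rewrite cos_PI, cos_0; unfold minus, plus, opp; cbn; Rring).
    apply (is_RInt_derive (fun t => - cos t) sin).
    * intros; auto_derive; [exact I | Rring].
    * intros; apply continuous_R_comp with (phi := sin) (f := fun t : R => t); [auto_derive; exact I | apply continuous_id].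
- rewrite S_INR; pose proof (pos_INR n) as Hn.
  specialize (R1 n); rewrite IH in R1.
  apply Rmult_eq_reg_l with (2 * INR n + 3); [|lra].
  rewrite <- R1; field; lra.
Qed.

(** * Plane densities and the flag density *)

(** [V3] is a bare record without uniform structure, so continuity of vector functions is
    componentwise. *)
Definition ctsV {U : UniformSpace} (f : U -> V3) :=
  cts (fun u => vx (f u)) /\ cts (fun u => vy (f u)) /\ cts (fun u => vz (f u)).

(** Continuity stated as stability under composition with continuous parameters: the normals range
    over unit vectors only, and this form fits syntax-directed continuity proofs. *)
Definition plane_cts (k : R -> V3 -> R) : Prop :=
  forall (U : UniformSpace) (p : U -> R) (xi : U -> V3),
    cts p -> ctsV xi -> (forall u, unit_vec (xi u)) -> cts (fun u => k (p u) (xi u)).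

Lemma plane_fun_continuous_cts h : plane_fun_continuous h -> plane_cts h.
Proof.
intros Hh U p xi Hp [H1 [H2 H3]] Hu u0.
apply filterlim_locally; intros eps.
destruct (Hh (p u0) (xi u0) (Hu u0) eps (cond_pos eps)) as [d [Hd H]].
assert (L1 := proj1 (filterlim_locally _ _) (Hp u0) (mkposreal d Hd)).
assert (N : cts (fun u => vnorm2 (vsub (xi u) (xi u0)))).
{ unfold vnorm2, dot, vsub, vadd, vscal; cbn [vx vy vz]; cts. }
assert (L2 := proj1 (filterlim_locally _ _) (N u0) (mkposreal d Hd)).
generalize (filter_and _ _ L1 L2); apply filter_imp; intros u [B1 B2].
change (Rabs (p u - p u0) < d) in B1.
change (Rabs (vnorm2 (vsub (xi u) (xi u0)) - vnorm2 (vsub (xi u0) (xi u0))) < d) in B2.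
change (Rabs (h (p u) (xi u) - h (p u0) (xi u0)) < eps).
apply H; [apply Hu | exact B1 |].
replace (vnorm2 (vsub (xi u0) (xi u0))) with 0 in B2
  by (unfold vnorm2, dot, vsub, vadd, vscal; cbn [vx vy vz]; Rring).
rewrite Rminus_0_r in B2; apply Rabs_def2 in B2; apply B2.
Qed.

(* [geom n z = (1 - z^(2n)) / (1 - z^2)]: a polynomial cutoff of [1 / (1 - z^2)]. *)
Fixpoint geom (n : nat) (z : R) : R :=
  match n with O => 0 | S m => geom m z + z ^ (2 * m) end.

Lemma geom_mul n z : (1 - z ^ 2) * geom n z = 1 - z ^ (2 * n).
Proof.
induction n as [|n IH]; [simpl; Rring|].
cbn [geom]; rewrite Rmult_plus_distr_l, IH.
replace (2 * S n)%nat with (2 * n + 2)%nat by lia; rewrite pow_add; Rring.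
Qed.

Lemma cts_geom {U : UniformSpace} n (f : U -> R) : cts f -> cts (fun u => geom n (f u)).
Proof. intros Hf; induction n as [|n IH]; cbn [geom]; cts. Qed.

(** The last clause is the origin of the source term: it comes from differentiating (1 - z^2) q_n =
    1 - z^(2n). The factor z raises the exponent 2n - 1 to 2n. *)
Lemma geom_derive n : exists dq : R -> R,
  (forall z, is_derive (geom n) z (dq z)) /\ cts dq /\
  (forall z, z * ((1 - z ^ 2) * dq z - 2 * z * geom n z) = - (2 * INR n * z ^ (2 * n))).
Proof.
assert (E : exists dq : R -> R, (forall z, is_derive (geom n) z (dq z)) /\ cts dq).
{ induction n as [|n [dq [H1 H2]]]; cbn [geom].
  - exists (fun _ => 0); split; [intros; auto_derive; [exact I | reflexivity] | cts].
  - pose (k := (2 * n)%nat).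
    exists (fun z => dq z + INR k * z ^ (Init.Nat.pred k)); split; [|cts].
    intros z; apply (is_derive_plus (geom n) (fun z => z ^ k)); [apply H1|].
    auto_derive; [exact I | Rring]. }
destruct E as [dq [H1 H2]]; exists dq; split; [exact H1|]; split; [exact H2|].
intros z.
assert (D : forall t, Derive (fun t => geom n t) t = dq t) by (intros; apply is_derive_unique, H1).
assert (D1 : is_derive (fun z => (1 - z ^ 2) * geom n z) z ((1 - z ^ 2) * dq z - 2 * z * geom n z)).
{ auto_derive; [exact (ex_intro _ _ (H1 _))|]. rewrite D; Rring. }
assert (D0 : (1 - z ^ 2) * dq z - 2 * z * geom n z = Derive (fun z => 1 - z ^ (2 * n)) z).
{ rewrite <- (Derive_ext (fun z => (1 - z ^ 2) * geom n z)) by (intros; apply geom_mul).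
  symmetry; apply is_derive_unique, D1. }
rewrite D0.
pose (k := (2 * n)%nat).
assert (D2 : is_derive (fun z => 1 - z ^ k) z (- (INR k * z ^ Init.Nat.pred k))).
{ auto_derive; [exact I | Rring]. }
replace (Derive _ z) with (- (INR k * z ^ Init.Nat.pred k)) by (symmetry; apply is_derive_unique, D2).
fold k.
assert (Ek : INR k = 2 * INR n) by (unfold k; rewrite mult_INR; reflexivity).
(* For n = 0 the truncated predecessor is wrong as an exponent, but its coefficient is zero. *)
destruct k as [|k].
- simpl in *; rewrite <- Ek; Rring.
- rewrite <- Ek; cbn [Init.Nat.pred pow]; Rring.
Qed.

(** * Bounds on the flag kernel and its integrability *)

Lemma bessel u om xi : unit_vec u -> unit_vec om -> dot u om = 0 -> unit_vec xi ->
  dot u xi ^ 2 + dot om xi ^ 2 <= 1.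
Proof.
unfold unit_vec; intros Hu Ho Huo Hx.
set (a := dot u xi); set (b := dot om xi).
assert (E : (vx xi - a * vx u - b * vx om) ^ 2 + (vy xi - a * vy u - b * vy om) ^ 2 + (vz xi - a * vz u - b * vz om) ^ 2
  = dot xi xi - 2 * a * dot u xi - 2 * b * dot om xi + a ^ 2 * dot u u + b ^ 2 * dot om om + 2 * a * b * dot u om).
{ unfold dot; Rring. }
rewrite Hx, Hu, Ho, Huo in E; fold a b in E.
pose proof (pow2_ge_0 (vx xi - a * vx u - b * vx om)).
pose proof (pow2_ge_0 (vy xi - a * vy u - b * vy om)).
pose proof (pow2_ge_0 (vz xi - a * vz u - b * vz om)).
lra.
Qed.

Lemma dot_sq_le_1 om xi : unit_vec om -> unit_vec xi -> dot om xi ^ 2 <= 1.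
Proof.
unfold unit_vec; intros Ho Hx.
assert (E : (vx xi - dot om xi * vx om) ^ 2 + (vy xi - dot om xi * vy om) ^ 2 + (vz xi - dot om xi * vz om) ^ 2
  = dot xi xi - 2 * dot om xi * dot om xi + dot om xi ^ 2 * dot om om).
{ unfold dot; Rring. }
rewrite Hx, Ho in E.
pose proof (pow2_ge_0 (vx xi - dot om xi * vx om)).
pose proof (pow2_ge_0 (vy xi - dot om xi * vy om)).
pose proof (pow2_ge_0 (vz xi - dot om xi * vz om)).
lra.
Qed.

Lemma vnorm2_reject om xi : unit_vec om -> unit_vec xi ->
  vnorm2 (vsub xi (vscal (dot xi om) om)) = 1 - dot om xi ^ 2.
Proof.
unfold unit_vec; intros Ho Hx.
transitivity (dot xi xi - 2 * dot om xi ^ 2 + dot om xi ^ 2 * dot om om).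
- unfold vnorm2, vsub, vscal, vadd, dot; cbn [vx vy vz]; Rring.
- rewrite Ho, Hx; Rring.
Qed.

Lemma even_pow_bounds z n : z ^ 2 <= 1 -> 0 <= z ^ (2 * n) <= 1.
Proof.
intros H; rewrite pow_mult; pose proof (pow2_ge_0 z).
split; [now apply pow_le|].
rewrite <- (pow1 n); now apply pow_incr.
Qed.

(* At [z^2 = 1] both sides vanish, since then [x = 0] and Rocq's division by zero is harmless. *)
Lemma kernel_err x z n : x ^ 2 + z ^ 2 <= 1 ->
  Rabs (x ^ 2 / (1 - z ^ 2) - x ^ 2 * geom n z) <= z ^ (2 * n).
Proof.
intros H; pose proof (pow2_ge_0 x); pose proof (pow2_ge_0 z).
destruct (even_pow_bounds z n) as [P _]; [lra|].
destruct (Req_dec (1 - z ^ 2) 0) as [E|E].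
- replace (x ^ 2) with 0 by lra; unfold Rdiv; rewrite !Rmult_0_l, Rminus_0_r, Rabs_R0; exact P.
- replace (x ^ 2 / (1 - z ^ 2) - x ^ 2 * geom n z) with (x ^ 2 / (1 - z ^ 2) * z ^ (2 * n)).
  2:{ replace (z ^ (2 * n)) with (1 - (1 - z ^ 2) * geom n z) by (rewrite geom_mul; Rring); field; exact E. }
  assert (0 < 1 - z ^ 2) by lra.
  assert (0 <= x ^ 2 / (1 - z ^ 2) <= 1).
  { split; [apply Rle_div_r; lra | apply Rle_div_l; lra]. }
  rewrite Rabs_pos_eq by nra; nra.
Qed.

(** The kernel has no limit on the sphere at the two poles of the plane of the flag, but a single
    meridian either avoids them or sees a constant kernel. Here (p, q) and (a, b) are the components
    of the line and of the normal of the flag along the axes of the meridian. *)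
Lemma meridian_ex_RInt (p q a b : R) (g : R -> R) :
  (forall t, (p * cos t + q * sin t) ^ 2 + (a * cos t + b * sin t) ^ 2 <= 1) ->
  a ^ 2 + b ^ 2 <= 1 -> cts g ->
  ex_RInt (fun t => (p * cos t + q * sin t) ^ 2 / (1 - (a * cos t + b * sin t) ^ 2) * g t) 0 PI.
Proof.
intros H Hab Hg.
destruct (classic (exists t1, 0 <= t1 <= PI /\ (a * cos t1 + b * sin t1) ^ 2 = 1)) as [[t1 [Ht1 E1]]|N].
- (* The meridian passes through the pole: there the kernel is constant. *)
  pose (kp := q * cos t1 - p * sin t1).
  pose proof (sin2_cos2 t1) as SC; unfold Rsqr in SC.
  assert (X1 : p * cos t1 + q * sin t1 = 0).
  { specialize (H t1); rewrite E1 in H.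
    apply Rsqr_0_uniq; unfold Rsqr; pose proof (Rle_0_sqr (p * cos t1 + q * sin t1)); unfold Rsqr in *; nra. }
  (* z^2 + z'^2 = a^2 + b^2 <= 1 together with z^2 = 1 at t1 forces z' = 0 there. *)
  assert (Z1 : b * cos t1 - a * sin t1 = 0).
  { apply Rsqr_0_uniq; unfold Rsqr.
    assert (E : a ^ 2 + b ^ 2 = (a * cos t1 + b * sin t1) ^ 2 + (b * cos t1 - a * sin t1) * (b * cos t1 - a * sin t1)).
    { transitivity ((a ^ 2 + b ^ 2) * (sin t1 * sin t1 + cos t1 * cos t1)); [rewrite SC|]; Rring. }
    pose proof (Rle_0_sqr (b * cos t1 - a * sin t1)); unfold Rsqr in *; lra. }
  (* Expanded around t1, x = kp sin(t - t1) and z^2 = cos^2(t - t1), so the quotient is kp^2. *)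
  assert (K : forall t, sin (t - t1) <> 0 ->
     kp ^ 2 * g t = (p * cos t + q * sin t) ^ 2 / (1 - (a * cos t + b * sin t) ^ 2) * g t).
  { intros t Hs.
    assert (Ep : forall r s, r * cos t + s * sin t = (r * cos t1 + s * sin t1) * cos (t - t1) + (s * cos t1 - r * sin t1) * sin (t - t1)).
    { intros r s; rewrite cos_minus, sin_minus.
      transitivity ((r * cos t + s * sin t) * (sin t1 * sin t1 + cos t1 * cos t1)); [rewrite SC|]; Rring. }
    rewrite (Ep p q), (Ep a b), X1, Z1; fold kp.
    replace (1 - _ ^ 2) with (sin (t - t1) ^ 2).
    - field; exact Hs.
    - transitivity (1 - (a * cos t1 + b * sin t1) ^ 2 * cos (t - t1) ^ 2); [|Rring].
      rewrite E1; pose proof (sin2_cos2 (t - t1)); unfold Rsqr in *; simpl; lra. }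
  (* Cutting at t1 leaves two open pieces of [0, pi] on which sin(t - t1) has no zero. *)
  apply ex_RInt_Chasles with t1.
  + apply ex_RInt_ext with (fun t => kp ^ 2 * g t); [|apply cts_ex_RInt; cts].
    intros t; rewrite Rmin_left, Rmax_right by lra; intros Ht; apply K.
    pose proof (sin_gt_0 (t1 - t)); replace (t - t1) with (- (t1 - t)) by Rring; rewrite sin_neg; lra.
  + apply ex_RInt_ext with (fun t => kp ^ 2 * g t); [|apply cts_ex_RInt; cts].
    intros t; rewrite Rmin_left, Rmax_right by lra; intros Ht; apply K.
    pose proof (sin_gt_0 (t - t1)); lra.
- apply (ex_RInt_continuous (V := R_CompleteNormedModule)).
  intros t; rewrite Rmin_left, Rmax_right by (pose proof PI_RGT_0; lra); intros Ht.
  apply continuous_Rmult; [|apply Hg].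
  apply continuous_Rmult.
  + assert (C : cts (fun t => (p * cos t + q * sin t) ^ 2)) by cts; apply C.
  + apply continuous_R_comp with (phi := Rinv) (f := fun t => 1 - (a * cos t + b * sin t) ^ 2).
    * auto_derive; intros E; apply N; exists t; split; [exact Ht | lra].
    * assert (C : cts (fun t => 1 - (a * cos t + b * sin t) ^ 2)) by cts; apply C.
Qed.

Lemma RInt_abs_sub_le (f g h : R -> R) a b : a <= b ->
  ex_RInt f a b -> ex_RInt g a b -> ex_RInt h a b ->
  (forall t, a <= t <= b -> Rabs (f t - g t) <= h t) ->
  Rabs (RInt f a b - RInt g a b) <= RInt h a b.
Proof.
intros Hab Hf Hg Hh H.
assert (I : ex_RInt (fun t => f t - g t) a b) by exact (ex_RInt_minus (V := R_NormedModule) f g a b Hf Hg).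
assert (In : ex_RInt (fun t => -1 * h t) a b) by exact (ex_RInt_scal (V := R_NormedModule) h a b (-1) Hh).
rewrite <- RInt_Rminus by assumption.
apply Rabs_le; split.
- replace (- RInt h a b) with (RInt (fun t => -1 * h t) a b) by (rewrite RInt_Rmult by assumption; Rring).
  apply RInt_le; try assumption; intros t Ht.
  specialize (H t ltac:(lra)); apply Rabs_le_between in H; lra.
- apply RInt_le; try assumption; intros t Ht.
  specialize (H t ltac:(lra)); apply Rabs_le_between in H; lra.
Qed.

Lemma inv_sqrt_small K e : 0 < e -> exists N, forall n, (N <= n)%nat -> K / sqrt (2 * INR n + 1) <= e.
Proof.
intros He.
destruct (INR_unbounded ((K / e) ^ 2)) as [N HN].
exists N; intros n Hn; apply le_INR in Hn; pose proof (pos_INR n).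
assert (Hs : 0 < sqrt (2 * INR n + 1)) by (apply sqrt_lt_R0; lra).
apply Rle_div_l; [exact Hs|].
assert (E : K / e <= sqrt (2 * INR n + 1)).
{ destruct (Rle_or_lt (K / e) 0) as [L|L]; [lra|].
  apply Rsqr_incr_0_var; [|lra]; rewrite Rsqr_sqrt by lra; rewrite Rsqr_pow2; lra. }
apply Rmult_le_compat_l with (r := e) in E; [|lra].
replace (e * (K / e)) with K in E by (field; lra); exact E.
Qed.

Definition rho_n (n : nat) (k : R -> V3 -> R) (x u om : V3) : R :=
  / 2 * sint (fun xi => dot u xi ^ 2 * geom n (dot om xi) * hx k x xi).

Lemma ctsV_const {U : UniformSpace} (v : V3) : ctsV (fun _ : U => v).
Proof. repeat split; apply cts_const. Qed.
Lemma ctsV_sph {U : UniformSpace} (f g : U -> R) : cts f -> cts g -> ctsV (fun u => sph_pt (f u) (g u)).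
Proof. intros Hf Hg; repeat split; cbn; cts. Qed.
Lemma cts_dot {U : UniformSpace} (f g : U -> V3) : ctsV f -> ctsV g -> cts (fun u => dot (f u) (g u)).
Proof. intros [A [B C]] [D [E F]]; unfold dot; cts. Qed.
Lemma cts_hx {U : UniformSpace} k (x xi : U -> V3) : plane_cts k -> ctsV x -> ctsV xi ->
  (forall u, unit_vec (xi u)) -> cts (fun u => hx k (x u) (xi u)).
Proof. intros Hk Hx Hxi Hu; apply Hk; [now apply cts_dot | exact Hxi | exact Hu]. Qed.

(** The error of the cutoff is at most B z^(2n), and Wallis' bound integrates this along each
    meridian to B pi / sqrt(2n + 1), whatever the meridian. A bound uniform over meridians is what
    makes the outer integral of the singular kernel exist; the outer length 2 pi and the factor 1/2
    give the second pi. *)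
Lemma rho_approx k x u om B n : plane_cts k -> unit_vec u -> unit_vec om -> dot u om = 0 ->
  (forall th ps, 0 <= th <= PI -> 0 <= ps <= 2 * PI -> Rabs (hx k x (sph_pt th ps)) <= B) ->
  Rabs (rho k x u om - rho_n n k x u om) <= B * PI ^ 2 / sqrt (2 * INR n + 1).
Proof.
intros Hk Hu Ho Huo HB.
pose proof PI_RGT_0 as Hpi.
assert (B0 : 0 <= B).
{ eapply Rle_trans; [apply Rabs_pos | apply (HB 0 0); lra]. }
pose (f := fun xi => (dot u xi) ^ 2 / vnorm2 (vsub xi (vscal (dot xi om) om)) * hx k x xi).
pose (fn := fun n xi => dot u xi ^ 2 * geom n (dot om xi) * hx k x xi).
assert (cn : forall n, sph_cts (fn n)).
{ intros m; unfold sph_cts, fn.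
  assert (ctsV (fun q : R * R => sph_pt (snd q) (fst q))) by (apply ctsV_sph; cts).
  apply cts_mult; [apply cts_mult|].
  - apply cts_pow, cts_dot; [apply ctsV_const | assumption].
  - apply cts_geom, cts_dot; [apply ctsV_const | assumption].
  - apply cts_hx; [assumption | apply ctsV_const | assumption | intros; apply unit_sph_pt]. }
assert (Pt : forall n xi, unit_vec xi -> Rabs (hx k x xi) <= B -> Rabs (f xi - fn n xi) <= B * dot om xi ^ (2 * n)).
{ intros m xi Hxi Hb; unfold f, fn; rewrite vnorm2_reject by assumption.
  rewrite <- Rmult_minus_distr_r, Rabs_mult, Rmult_comm.
  apply Rmult_le_compat; try apply Rabs_pos; [exact Hb|].
  apply kernel_err; now apply bessel. }
assert (mer : forall ps, (vx om * cos ps + vy om * sin ps) ^ 2 + vz om ^ 2 <= 1).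
{ intros ps; unfold unit_vec, dot in Ho.
  pose proof (sin2_cos2 ps) as E; unfold Rsqr in E.
  assert (E2 : vx om * vx om + vy om * vy om = (vx om * cos ps + vy om * sin ps) ^ 2 + (vx om * sin ps - vy om * cos ps) ^ 2).
  { transitivity ((vx om * vx om + vy om * vy om) * (sin ps * sin ps + cos ps * cos ps)); [rewrite E|]; Rring. }
  pose proof (pow2_ge_0 (vx om * sin ps - vy om * cos ps)); lra. }
assert (If : forall ps, ex_RInt (fun th => f (sph_pt th ps) * sin th) 0 PI).
{ intros ps.
  apply ex_RInt_ext with (fun t => (vz u * cos t + (vx u * cos ps + vy u * sin ps) * sin t) ^ 2 /
      (1 - (vz om * cos t + (vx om * cos ps + vy om * sin ps) * sin t) ^ 2) * (hx k x (sph_pt t ps) * sin t)).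
  - intros t _; unfold f; rewrite vnorm2_reject by (assumption || apply unit_sph_pt).
    rewrite !dot_sph_pt.
    replace (sin t * (vx u * cos ps + vy u * sin ps) + cos t * vz u) with (vz u * cos t + (vx u * cos ps + vy u * sin ps) * sin t) by Rring.
    replace (sin t * (vx om * cos ps + vy om * sin ps) + cos t * vz om) with (vz om * cos t + (vx om * cos ps + vy om * sin ps) * sin t) by Rring.
    Rring.
  - apply meridian_ex_RInt.
    + intros t; pose proof (bessel u om _ Hu Ho Huo (unit_sph_pt t ps)) as Hb; rewrite !dot_sph_pt in Hb.
      replace (sin t * (vx u * cos ps + vy u * sin ps) + cos t * vz u) with (vz u * cos t + (vx u * cos ps + vy u * sin ps) * sin t) in Hb by Rring.
      replace (sin t * (vx om * cos ps + vy om * sin ps) + cos t * vz om) with (vz om * cos t + (vx om * cos ps + vy om * sin ps) * sin t) in Hb by Rring.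
      exact Hb.
    + rewrite Rplus_comm; apply mer.
    + apply cts_mult; [|cts].
      apply cts_hx; [assumption | apply ctsV_const | apply ctsV_sph; cts | intros; apply unit_sph_pt]. }
pose (G := fun ps => RInt (fun th => f (sph_pt th ps) * sin th) 0 PI).
pose (Gn := fun n ps => RInt (fun th => fn n (sph_pt th ps) * sin th) 0 PI).
assert (cGn : forall n, cts (Gn n)) by (intros m; now apply sint_inner_cts).
assert (HG : forall n ps, 0 <= ps <= 2 * PI -> Rabs (G ps - Gn n ps) <= B * PI / sqrt (2 * INR n + 1)).
{ intros m ps Hps.
  apply Rle_trans with (RInt (fun t => B * (vz om * cos t + (vx om * cos ps + vy om * sin ps) * sin t) ^ (2 * m)) 0 PI).
  - apply RInt_abs_sub_le; [lra | apply If | apply cts_ex_RInt; now apply sph_cts_slice | apply cts_ex_RInt; cts |].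
    intros t Ht.
    rewrite <- Rmult_minus_distr_r, Rabs_mult.
    replace (vz om * cos t + (vx om * cos ps + vy om * sin ps) * sin t) with (dot om (sph_pt t ps)) by (rewrite dot_sph_pt; Rring).
    pose proof (Pt m (sph_pt t ps) (unit_sph_pt t ps) (HB t ps Ht Hps)) as Hp.
    assert (Rabs (sin t) <= 1) by (apply Rabs_le, SIN_bound).
    pose proof (Rabs_pos (sin t)); pose proof (Rabs_pos (f (sph_pt t ps) - fn m (sph_pt t ps))); nra.
  - rewrite RInt_Rmult by (apply cts_ex_RInt; cts).
    unfold Rdiv; rewrite Rmult_assoc; apply Rmult_le_compat_l; [exact B0|].
    apply RInt_cos_sin_pow; rewrite Rplus_comm; apply mer. }
(* The outer integrand is a uniform limit of the continuous functions [Gn n]. *)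
assert (IG : ex_RInt G 0 (2 * PI)).
{ apply RInt_unif_lim with Gn; [lra | intros; apply cts_ex_RInt, cGn |].
  intros e He; destruct (inv_sqrt_small (B * PI) e He) as [N HN].
  exists N; intros m Hm t Ht; rewrite Rabs_minus_sym; eapply Rle_trans; [now apply HG | now apply HN]. }
assert (E : rho k x u om = / 2 * RInt G 0 (2 * PI)).
{ unfold rho, sphere_int; f_equal.
  rewrite <- Defs_RInt_eq by exact IG; f_equal.
  apply FunctionalExtensionality.functional_extensionality; intros ps.
  apply Defs_RInt_eq, If. }
rewrite E; unfold rho_n, sint; fold (fn n); fold (Gn n).
change (Rabs (/ 2 * RInt G 0 (2 * PI) - / 2 * RInt (Gn n) 0 (2 * PI)) <= B * PI ^ 2 / sqrt (2 * INR n + 1)).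
rewrite <- Rmult_minus_distr_l, Rabs_mult, (Rabs_pos_eq (/ 2)) by lra.
pose proof (RInt_dist G (Gn n) 0 (2 * PI) _ ltac:(lra) IG (cts_ex_RInt _ _ _ (cGn n)) (HG n)) as HD.
replace (B * PI ^ 2 / sqrt (2 * INR n + 1)) with (/ 2 * ((2 * PI - 0) * (B * PI / sqrt (2 * INR n + 1)))).
- apply Rmult_le_compat_l; [lra | exact HD].
- unfold Rdiv; field.
  apply Rgt_not_eq, sqrt_lt_R0; pose proof (pos_INR n); lra.
Qed.

(** * The cap identity at finite cutoff *)

Lemma ctsV_disc_pt {U : UniformSpace} a b c (f g : U -> R) : cts f -> cts g -> ctsV (fun u => disc_pt a b c (f u) (g u)).
Proof. intros Hf Hg; repeat split; cbn; cts. Qed.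
Lemma ctsV_bd_tan {U : UniformSpace} a b (f : U -> R) : cts f -> ctsV (fun u => bd_tan a b (f u)).
Proof. intros Hf; repeat split; cbn; cts. Qed.

Ltac ctsk1 :=
  intros; cbn beta; cbn [fst snd];
  first [ match goal with H : cts _ |- cts _ => exact H | H : ctsV _ |- ctsV _ => exact H | H : plane_cts _ |- plane_cts _ => exact H end |
  lazymatch goal with
  | |- cts (fun _ => ?k) => apply cts_const
  | |- cts (fun u => u) => apply cts_id
  | |- cts (fun u => Rplus (@?f u) (@?g u)) => apply cts_plus
  | |- cts (fun u => Rminus (@?f u) (@?g u)) => apply cts_minus
  | |- cts (fun u => Ropp (@?f u)) => apply cts_opp
  | |- cts (fun u => Rmult (@?f u) (@?g u)) => apply cts_mult
  | |- cts (fun u => pow (@?f u) _) => apply cts_pow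
  | |- cts (fun u => sin (@?f u)) => apply cts_sin
  | |- cts (fun u => cos (@?f u)) => apply cts_cos
  | |- cts (fun u => Rabs (@?f u)) => apply cts_Rabs
  | |- cts (fun u => fst (@?f u)) => apply cts_fst
  | |- cts (fun u => snd (@?f u)) => apply cts_snd
  | |- cts (fun u => (@?f u, @?g u)) => apply cts_pair
  | |- cts (fun u => geom _ (@?f u)) => apply cts_geom
  | |- cts (fun u => dot (@?f u) (@?g u)) => apply cts_dot
  | |- cts (fun u => hx _ (@?f u) (@?g u)) => apply cts_hx
  | |- cts (fun u => RInt (@?f u) 0 (@?g u)) => refine (cts_RInt_upper f g _ _)
  | |- cts (fun u => RInt (@?f u) ?r ?s) => refine (cts_RInt f r s _)
  | |- cts (fun u => sint (@?f u)) => refine (cts_sint f _)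
  | H : plane_cts ?k |- cts (fun u => ?k _ _) => apply H
  | H : plane_cts ?k |- cts (fun u => ?k (@?f u) (@?g u)) => apply H
  | |- sph_cts _ => unfold sph_cts
  | |- ctsV (fun _ => ?k) => apply ctsV_const
  | |- ctsV (fun u => sph_pt (@?f u) (@?g u)) => apply ctsV_sph
  | |- ctsV (fun u => disc_pt _ _ _ (@?f u) (@?g u)) => apply ctsV_disc_pt
  | |- ctsV (fun u => bd_tan _ _ (@?f u)) => apply ctsV_bd_tan
  | |- unit_vec (sph_pt _ _) => apply unit_sph_pt
  | |- ex_RInt _ _ _ => apply cts_ex_RInt
  | |- cts sin => apply (cts_sin (fun u => u))
  | |- cts cos => apply (cts_cos (fun u => u))
  | |- cts Rabs => apply (cts_Rabs (fun u => u))
  | |- cts fst => apply (cts_fst (fun u => u))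
  | |- cts snd => apply (cts_snd (fun u => u))
  end ].
Ltac ctsk := repeat ctsk1.

Section Frame.
Variables a b c : V3.
Hypothesis Ha : unit_vec a.
Hypothesis Hb : unit_vec b.
Hypothesis Hab : dot a b = 0.
Hypothesis Hc : c = cross a b.

Let l := disc_pt a b c.
Let T := bd_tan a b.

Lemma frame_dots : dot c c = 1 /\ dot a c = 0 /\ dot b c = 0.
Proof.
unfold unit_vec in *; rewrite Hc; repeat split.
- transitivity (dot a a * dot b b - dot a b ^ 2); [unfold dot, cross; cbn [vx vy vz]; ring|].
  rewrite Ha, Hb, Hab; ring.
- unfold dot, cross; cbn [vx vy vz]; ring.
- unfold dot, cross; cbn [vx vy vz]; ring.
Qed.

Lemma frame_parseval xi : unit_vec xi -> dot a xi ^ 2 + dot b xi ^ 2 + dot c xi ^ 2 = 1.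
Proof.
intros Hx; unfold unit_vec in *.
(* The squared triple product of a, b, xi is their Gram determinant. *)
assert (E : dot c xi ^ 2 = dot a a * dot b b * dot xi xi + 2 * dot a b * dot a xi * dot b xi
   - dot a a * dot b xi ^ 2 - dot b b * dot a xi ^ 2 - dot xi xi * dot a b ^ 2).
{ rewrite Hc; unfold dot, cross; cbn [vx vy vz]; ring. }
rewrite E, Ha, Hb, Hab, Hx; ring.
Qed.

Lemma dot_l nu ph xi : dot (l nu ph) xi = sin nu * (dot a xi * cos ph + dot b xi * sin ph) + cos nu * dot c xi.
Proof. unfold l, disc_pt, dot, vadd, vscal; cbn [vx vy vz]; ring. Qed.
Lemma dot_T ph xi : dot (T ph) xi = dot b xi * cos ph - dot a xi * sin ph.
Proof. unfold T, bd_tan, dot, vadd, vscal; cbn [vx vy vz]; ring. Qed.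
Lemma dot_comm u v : dot u v = dot v u.
Proof. unfold dot; ring. Qed.

Lemma unit_l nu ph : unit_vec (l nu ph).
Proof.
destruct frame_dots as [Hcc [Hac Hbc]].
unfold unit_vec in *; rewrite dot_l, !(dot_comm _ (l nu ph)), !dot_l.
rewrite Ha, Hb, Hcc, Hab, Hac, Hbc, (dot_comm b a), (dot_comm c a), (dot_comm c b), Hab, Hac, Hbc.
transitivity ((sin nu)² * ((sin ph)² + (cos ph)²) + (cos nu)²); [unfold Rsqr; ring|].
rewrite sin2_cos2, Rmult_1_r; apply sin2_cos2.
Qed.

Lemma unit_T ph : unit_vec (T ph).
Proof.
unfold unit_vec in *; rewrite dot_T, !(dot_comm _ (T ph)), !dot_T.
rewrite Ha, Hb, (dot_comm b a), Hab.
transitivity ((sin ph)² + (cos ph)²); [unfold Rsqr; ring | apply sin2_cos2].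
Qed.

Lemma dot_T_l nu ph : dot (T ph) (l nu ph) = 0.
Proof.
destruct frame_dots as [Hcc [Hac Hbc]]; unfold unit_vec in *.
rewrite dot_T, !(dot_comm _ (l nu ph)), !dot_l.
rewrite Ha, Hb, (dot_comm b a), (dot_comm c a), (dot_comm c b), Hab, Hac, Hbc; ring.
Qed.

Section Pair.
Variables k m : R -> V3 -> R.
Hypothesis ck : plane_cts k.
Hypothesis cm : plane_cts m.
(** The derivative is asked of p k(p, xi) and not of k, which may fail to be differentiable at p =
    0; the flux function F contains k only through this product. *)
Hypothesis Hkm : forall xi, unit_vec xi -> forall p, is_derive (fun p => p * k p xi) p (m p xi).

(** Both circle formulas are integrated from nu = 0, where the factor sin nu kills the boundary
    values. In between, the cross term z y k of the kernel formula is recognised as the flux y F and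
    replaced by the integral of its derivative. *)
Lemma circle_identity n xi alpha : unit_vec xi ->
  sin alpha ^ 2 * RInt (fun ph => dot (T ph) xi ^ 2 * geom n (dot (l alpha ph) xi) * hx k (l alpha ph) xi) 0 (2 * PI)
  = RInt (fun be => sin be * cos be * RInt (fun ph => (1 - dot (l be ph) xi ^ (2 * n)) * hx k (l be ph) xi) 0 (2 * PI)
      + sin be * RInt (fun nu => sin nu * RInt (fun ph =>
          (1 - dot (l nu ph) xi ^ (2 * n)) * hx m (l nu ph) xi - 2 * INR n * dot (l nu ph) xi ^ (2 * n) * hx k (l nu ph) xi) 0 (2 * PI)) 0 be) 0 alpha.
Proof.
intros Hxi.
destruct (geom_derive n) as [dq [D1 [D2 D3]]].
assert (Dq : forall t, Derive (fun t => geom n t) t = dq t) by (intros; apply is_derive_unique, D1).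
assert (ckx : cts (fun z => k z xi)).
{ apply ck; [apply cts_id | apply ctsV_const | intros; exact Hxi]. }
assert (cmx : cts (fun z => m z xi)).
{ apply cm; [apply cts_id | apply ctsV_const | intros; exact Hxi]. }
assert (cg : cts (fun z => geom n z)) by (apply cts_geom, cts_id).
pose (kz := fun z => geom n z * k z xi).
pose (F := fun z => geom n z * (z * k z xi)).
pose (dF := fun z => dq z * (z * k z xi) + geom n z * m z xi).
assert (HF : forall z, is_derive F z (dF z)).
{ intros z; apply (is_derive_mult (geom n) (fun z => z * k z xi) z); [apply D1 | now apply Hkm | exact Rmult_comm]. }
assert (cdF : cts dF) by (unfold dF; cts).
assert (ckz : cts kz) by (unfold kz; cts).
pose (A := dot a xi); pose (B := dot b xi); pose (C := dot c xi).
assert (HABC : A ^ 2 + B ^ 2 + C ^ 2 = 1) by now apply frame_parseval.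
pose (z := fun nu ph => sin nu * (A * cos ph + B * sin ph) + cos nu * C).
pose (y := fun nu ph => cos nu * (A * cos ph + B * sin ph) - sin nu * C).
assert (cz2 : cts (fun p : R * R => z (fst p) (snd p))) by (unfold z; cts).
assert (cy2 : cts (fun p : R * R => y (fst p) (snd p))) by (unfold y; cts).
pose (Bf := fun nu => sin nu * RInt (fun ph => y nu ph * F (z nu ph)) 0 (2 * PI)).
pose (dBf := fun nu => sin nu * RInt (fun ph => (1 - z nu ph ^ (2 * n)) * m (z nu ph) xi - 2 * INR n * z nu ph ^ (2 * n) * k (z nu ph) xi) 0 (2 * PI)).
assert (HB : forall nu, is_derive Bf nu (dBf nu)).
{ intros nu.
  replace (dBf nu) with (sin nu * RInt (fun ph => (1 - z nu ph ^ 2) * dF (z nu ph) - 2 * z nu ph * F (z nu ph)) 0 (2 * PI)).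
  - now apply (circle_flux_derive A B C HABC F dF).
  - unfold dBf; f_equal; apply RInt_ext; intros ph _; unfold dF, F.
    rewrite <- geom_mul.
    transitivity ((1 - z nu ph ^ 2) * geom n (z nu ph) * m (z nu ph) xi + (z nu ph * ((1 - z nu ph ^ 2) * dq (z nu ph) - 2 * z nu ph * geom n (z nu ph))) * k (z nu ph) xi); [Rring|].
    rewrite D3; Rring. }
assert (ckc : cts (fun p : R * R => k (z (fst p) (snd p)) xi)) by exact (cts_comp _ _ cz2 ckx).
assert (cmc : cts (fun p : R * R => m (z (fst p) (snd p)) xi)) by exact (cts_comp _ _ cz2 cmx).
assert (cdB : cts dBf).
{ unfold dBf; apply cts_mult; [cts|].
  apply (cts_RInt (fun nu ph => (1 - z nu ph ^ (2 * n)) * m (z nu ph) xi - 2 * INR n * z nu ph ^ (2 * n) * k (z nu ph) xi)).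
  cts. }
assert (EB : forall be, RInt dBf 0 be = Bf be).
{ intros be; transitivity (Bf be - Bf 0).
  - apply is_RInt_unique, (is_RInt_derive Bf dBf); intros; [apply HB | apply cdB].
  - unfold Bf; rewrite sin_0; Rring. }
pose (Df := fun nu => sin nu ^ 2 * RInt (fun ph => (B * cos ph - A * sin ph) ^ 2 * kz (z nu ph)) 0 (2 * PI)).
pose (dDf := fun nu => sin nu * cos nu * RInt (fun ph => (1 - z nu ph ^ (2 * n)) * k (z nu ph) xi) 0 (2 * PI) + sin nu * RInt dBf 0 nu).
assert (HD : forall nu, is_derive Df nu (dDf nu)).
{ intros nu.
  assert (E := circle_kernel_derive A B C HABC kz nu ckz).
  match type of E with is_derive _ _ ?v => replace (dDf nu) with v end; [exact E|].
  unfold dDf; rewrite EB; unfold Bf.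
  f_equal.
  - f_equal; apply RInt_ext; intros ph _; unfold kz; fold (z nu ph).
    rewrite <- geom_mul; Rring.
  - rewrite <- Rmult_assoc; simpl (sin nu ^ 2); rewrite Rmult_1_r.
    f_equal; apply RInt_ext; intros ph _; unfold kz, F; fold (z nu ph); fold (y nu ph); Rring. }
assert (cdD : cts dDf).
{ unfold dDf; apply cts_plus; apply cts_mult; [cts | | cts |].
  - apply (cts_RInt (fun nu ph => (1 - z nu ph ^ (2 * n)) * k (z nu ph) xi)); cts.
  - apply (cts_RInt_upper (fun _ => dBf) (fun u => u)); [|cts].
    apply (cts_comp snd dBf); [cts | exact cdB]. }
transitivity (Df alpha).
{ unfold Df; f_equal; apply RInt_ext; intros ph _.
  unfold hx, kz; rewrite dot_T, dot_l; fold A B C; fold (z alpha ph); Rring. }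
transitivity (RInt dDf 0 alpha).
{ symmetry; transitivity (Df alpha - Df 0).
  - apply is_RInt_unique, (is_RInt_derive Df dDf); intros; [apply HD | apply cdD].
  - unfold Df; rewrite sin_0; Rring. }
apply RInt_ext; intros be _; unfold dDf; f_equal; f_equal.
- apply RInt_ext; intros ph _; unfold hx; rewrite dot_l; reflexivity.
- apply RInt_ext; intros nu _; unfold dBf; f_equal.
  apply RInt_ext; intros ph _; unfold hx; rewrite dot_l; reflexivity.
Qed.

Definition mass_n (n : nat) (x : V3) : R := / 2 * sint (fun xi => (1 - dot x xi ^ (2 * n)) * hx k x xi).
Definition source_n (n : nat) (x : V3) : R :=
  / 2 * sint (fun xi => (1 - dot x xi ^ (2 * n)) * hx m x xi - 2 * INR n * dot x xi ^ (2 * n) * hx k x xi).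

(** The average of [circle_identity] over all normals; with the cutoff in place every integrand is
    continuous and Fubini applies. *)
Lemma cap_identity_n n alpha :
  sin alpha ^ 2 * RInt (fun ph => rho_n n k (l alpha ph) (T ph) (l alpha ph)) 0 (2 * PI)
  = RInt (fun be => sin be * cos be * RInt (fun ph => mass_n n (l be ph)) 0 (2 * PI)
      + sin be * RInt (fun nu => sin nu * RInt (fun ph => source_n n (l nu ph)) 0 (2 * PI)) 0 be) 0 alpha.
Proof.
unfold rho_n, mass_n, source_n, l, T.
transitivity (/ 2 * sint (fun xi => sin alpha ^ 2 * RInt (fun ph => dot (T ph) xi ^ 2 * geom n (dot (l alpha ph) xi) * hx k (l alpha ph) xi) 0 (2 * PI))).
{ unfold l, T; rewrite sint_scal by ctsk.
  rewrite (sint_RInt (fun ph xi => _)) by ctsk.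
  rewrite RInt_Rmult by ctsk; ring. }
rewrite (sint_ext _ _ (fun xi Hxi => circle_identity n xi alpha Hxi)).
unfold l, T.
rewrite (sint_RInt (fun be xi => _)) by ctsk.
rewrite <- RInt_Rmult by ctsk.
apply RInt_ext; intros be _.
rewrite sint_plus, !sint_scal by ctsk.
rewrite !(sint_RInt (fun nu xi => _)) by ctsk.
transitivity (sin be * cos be *
   RInt (fun ph => / 2 * sint (fun xi => (1 - dot (disc_pt a b c be ph) xi ^ (2 * n)) * hx k (disc_pt a b c be ph) xi)) 0 (2 * PI)
  + sin be * (/ 2 * RInt (fun t => sint (fun xi => sin t * RInt (fun ph =>
          (1 - dot (disc_pt a b c t ph) xi ^ (2 * n)) * hx m (disc_pt a b c t ph) xi - 2 * INR n * dot (disc_pt a b c t ph) xi ^ (2 * n) * hx k (disc_pt a b c t ph) xi) 0 (2 * PI))) 0 be)).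
{ rewrite RInt_Rmult by ctsk; Rring. }
f_equal; f_equal.
rewrite <- RInt_Rmult by ctsk.
apply RInt_ext; intros nu _.
rewrite sint_scal by ctsk.
rewrite (sint_RInt (fun ph xi => _)) by ctsk.
rewrite RInt_Rmult by ctsk; Rring.
Qed.

End Pair.
End Frame.

(** * Removing the cutoff *)

(** A tube lemma that must make a bound uniform along with the neighbourhood; monotonicity in the
    bound lets the largest of finitely many serve. *)
Lemma locally_exists_segment {U : UniformSpace} (Q : U -> R -> R -> Prop) (u0 : U) a b :
  (forall u t C C', C <= C' -> Q u t C -> Q u t C') ->
  (forall t, a <= t <= b -> exists C, locally ((u0, t) : U * R) (fun p => Q (fst p) (snd p) C)) ->
  exists C, locally u0 (fun u => forall t, a <= t <= b -> Q u t C).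
Proof.
intros Qm H.
assert (D : forall t, exists d : posreal, a <= t <= b ->
   forall u s, ball u0 d u -> ball t d s -> Q u s (/ d)).
{ intros t; destruct (classic (a <= t <= b)) as [Ht|Ht].
  - destruct (H t Ht) as [C [d Hd]].
    (* One positive number encodes both data: it is below the radius, and its inverse is above the
       bound. A common lower bound then serves both purposes. *)
    assert (P : 0 < Rmin d (/ (1 + Rabs C))).
    { apply Rmin_pos; [apply cond_pos | apply Rinv_0_lt_compat; pose proof (Rabs_pos C); lra]. }
    exists (mkposreal _ P); intros _ u s Hu Hs.
    apply Qm with C.
    + cbn [pos]; apply Rle_trans with (1 + Rabs C); [pose proof (Rle_abs C); lra|].
      rewrite <- (Rinv_inv (1 + Rabs C)) at 1; apply Rinv_le_contravar; [exact P | apply Rmin_r].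
    + apply (Hd (u, s)); split; (eapply ball_le; [|eassumption]; apply Rmin_l).
  - exists (mkposreal 1 Rlt_0_1); tauto. }
destruct (choice _ D) as [delta Hdelta].
destruct (compactness_value_1d a b delta) as [d Hd].
exists (/ d); exists d; intros u Hu t Ht.
apply NNPP; intros HQ; apply (Hd t Ht); intros [s [Hs [Hts Hds]]]; apply HQ.
apply Qm with (/ delta s); [apply Rinv_le_contravar; [apply cond_pos | exact Hds]|].
apply (Hdelta s Hs); [now apply ball_le with d | exact Hts].
Qed.

Definition cts4 (f : R -> R -> R -> R -> R) :=
  cts (fun q : ((R * R) * R) * R => f (fst (fst (fst q))) (snd (fst (fst q))) (snd (fst q)) (snd q)).

(* Uniform version, on a compact box, of: where the continuous function [f] does not vanish, [g] is positive. *)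
Lemma dominated4 (f g : R -> R -> R -> R -> R) a1 b1 a2 b2 a3 b3 a4 b4 eta :
  cts4 f -> cts4 g -> 0 < eta ->
  (forall x y z t, 0 <= g x y z t) ->
  (forall x y z t, f x y z t = 0 \/ 0 < g x y z t) ->
  exists C, forall x y z t, a1 <= x <= b1 -> a2 <= y <= b2 -> a3 <= z <= b3 -> a4 <= t <= b4 ->
    Rabs (f x y z t) <= eta + C * g x y z t.
Proof.
intros cf cg He Hg H.
pose (Q := fun x y z t C => Rabs (f x y z t) <= eta + C * g x y z t).
assert (Qm : forall x y z t C C', C <= C' -> Q x y z t C -> Q x y z t C').
{ unfold Q; intros x y z t C C' HC HQ; pose proof (Hg x y z t); nra. }
assert (L4 : forall (q : ((R * R) * R) * R), exists C, locally q (fun q => Q (fst (fst (fst q))) (snd (fst (fst q))) (snd (fst q)) (snd q) C)).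
{ intros q.
  pose (F := fun q : ((R * R) * R) * R => f (fst (fst (fst q))) (snd (fst (fst q))) (snd (fst q)) (snd q)).
  pose (G := fun q : ((R * R) * R) * R => g (fst (fst (fst q))) (snd (fst (fst q))) (snd (fst q)) (snd q)).
  assert (aF : cts (fun q => Rabs (F q))) by (apply cts_Rabs; exact cf).
  destruct (H (fst (fst (fst q))) (snd (fst (fst q))) (snd (fst q)) (snd q)) as [E|E].
  - exists 0. generalize (proj1 (filterlim_locally _ _) (aF q) (mkposreal _ He)).
    apply filter_imp; intros q' Hq'.
    change (Rabs (Rabs (F q') - Rabs (F q)) < eta) in Hq'.
    unfold F at 2 in Hq'; rewrite E, Rabs_R0, Rminus_0_r, Rabs_Rabsolu in Hq'.
    unfold Q; change (Rabs (F q') <= eta + 0 * G q'); lra.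
  - change (0 < G q) in E.
    (* Near [q], |F| stays below |F q| + 1 and G stays above G q / 2. *)
    pose (C := (Rabs (F q) + 1) / (G q / 2)).
    assert (HC : 0 <= C).
    { apply Rle_div_r; [lra|]; pose proof (Rabs_pos (F q)); lra. }
    assert (E2 : 0 < G q / 2) by lra.
    exists C.
    generalize (filter_and _ _ (proj1 (filterlim_locally _ _) (aF q) (mkposreal _ Rlt_0_1))
       (proj1 (filterlim_locally _ _) (cg q) (mkposreal _ E2))).
    apply filter_imp; intros q' [H1 H2].
    change (Rabs (Rabs (F q') - Rabs (F q)) < 1) in H1.
    change (Rabs (G q' - G q) < G q / 2) in H2.
    apply Rabs_def2 in H1; apply Rabs_def2 in H2.
    unfold Q; change (Rabs (F q') <= eta + C * G q').
    assert (C * (G q / 2) = Rabs (F q) + 1) by (unfold C; field; lra).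
    nra. }
assert (L3 : forall q : (R * R) * R, exists C, locally q (fun q => forall t, a4 <= t <= b4 -> Q (fst (fst q)) (snd (fst q)) (snd q) t C)).
{ intros q; apply (locally_exists_segment (fun (q : (R * R) * R) t C => Q (fst (fst q)) (snd (fst q)) (snd q) t C)).
  - intros u t C C'; apply Qm.
  - intros t _; exact (L4 (q, t)). }
assert (L2 : forall q : R * R, exists C, locally q (fun q => forall z, a3 <= z <= b3 -> forall t, a4 <= t <= b4 -> Q (fst q) (snd q) z t C)).
{ intros q; apply (locally_exists_segment (fun (q : R * R) z C => forall t, a4 <= t <= b4 -> Q (fst q) (snd q) z t C)).
  - intros u z C C' HC H1 t Ht; eapply Qm; [exact HC | now apply H1].
  - intros z _; exact (L3 (q, z)). }
assert (L1 : forall x : R, exists C, locally x (fun x => forall y, a2 <= y <= b2 -> forall z, a3 <= z <= b3 -> forall t, a4 <= t <= b4 -> Q x y z t C)).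
{ intros x; apply (locally_exists_segment (fun x y C => forall z, a3 <= z <= b3 -> forall t, a4 <= t <= b4 -> Q x y z t C)).
  - intros u z C C' HC H1 y Hy t Ht; eapply Qm; [exact HC | now apply H1].
  - intros y _; exact (L2 (x, y)). }
(* The last coordinate has no parameter left, so a dummy parameter at 0 takes its place. *)
destruct (locally_exists_segment (fun (_ : R) x C => forall y, a2 <= y <= b2 -> forall z, a3 <= z <= b3 -> forall t, a4 <= t <= b4 -> Q x y z t C) 0 a1 b1) as [C HC].
- intros _ x C C' HC H1 y Hy z Hz t Ht; eapply Qm; [exact HC | now apply H1].
- intros x _; destruct (L1 x) as [C [d Hd]]; exists C, d; intros [u x'] [_ Hx']; apply Hd, Hx'.
- exists C; intros x y z t Hx Hy Hz Ht; apply locally_singleton in HC; now apply HC.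
Qed.

Lemma bounded4 (f : R -> R -> R -> R -> R) a1 b1 a2 b2 a3 b3 a4 b4 :
  cts4 f -> exists B, forall x y z t, a1 <= x <= b1 -> a2 <= y <= b2 -> a3 <= z <= b3 -> a4 <= t <= b4 ->
    Rabs (f x y z t) <= B.
Proof.
intros cf.
destruct (dominated4 f (fun _ _ _ _ => 1) a1 b1 a2 b2 a3 b3 a4 b4 1 cf) as [C HC].
- unfold cts4; cts.
- lra.
- intros; lra.
- intros; right; lra.
- exists (1 + C); intros; rewrite <- (Rmult_1_r C); now apply HC.
Qed.

Lemma Mass_eq k x : plane_cts k -> Mass k x = / 2 * sint (hx k x).
Proof. intros Hk; unfold Mass; rewrite sphere_int_eq by ctsk; reflexivity. Qed.

Section Frame.
Variables a b c : V3.
Hypothesis Ha : unit_vec a.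
Hypothesis Hb : unit_vec b.
Hypothesis Hab : dot a b = 0.
Hypothesis Hc : c = cross a b.

Let l := disc_pt a b c.
Let T := bd_tan a b.

Variables k m : R -> V3 -> R.
Hypothesis ck : plane_cts k.
Hypothesis cm : plane_cts m.
Hypothesis wk : plane_fun_wd k.

Lemma cts4_hx (f : R -> V3 -> R) : plane_cts f -> cts4 (fun nu ph th ps => hx f (l nu ph) (sph_pt th ps)).
Proof. intros Hf; unfold cts4, l; ctsk. Qed.

Lemma sint_pow_hx_le (f : V3 -> R) B s n : unit_vec s -> sph_cts f ->
  (forall th ps, 0 <= th <= PI -> 0 <= ps <= 2 * PI -> Rabs (f (sph_pt th ps)) <= B) ->
  Rabs (sint (fun xi => dot s xi ^ (2 * n) * f xi)) <= B * (4 * PI / (2 * INR n + 1)).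
Proof.
intros Hs cf HB.
rewrite <- (sint_dot_pow s n Hs), <- sint_scal by ctsk.
apply sint_abs; [unfold sph_cts in *; ctsk | ctsk |].
intros th ps Hth Hps; rewrite Rabs_mult.
destruct (even_pow_bounds (dot s (sph_pt th ps)) n) as [P _]; [apply dot_sq_le_1; [exact Hs | apply unit_sph_pt]|].
rewrite (Rabs_pos_eq _ P), Rmult_comm; apply Rmult_le_compat_r; [exact P | now apply HB].
Qed.

Lemma unit_eq_of_dot u v : unit_vec u -> unit_vec v -> dot u v = 1 -> u = v.
Proof.
unfold unit_vec; intros Hu Hv H.
assert (E : (vx u - vx v)² + (vy u - vy v)² + (vz u - vz v)² = 0).
{ transitivity (dot u u - 2 * dot u v + dot v v); [unfold dot, Rsqr; ring | rewrite Hu, Hv, H; ring]. }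
pose proof (Rle_0_sqr (vx u - vx v)); pose proof (Rle_0_sqr (vy u - vy v)); pose proof (Rle_0_sqr (vz u - vz v)).
destruct u as [u1 u2 u3], v as [v1 v2 v3]; cbn [vx vy vz] in *.
f_equal; apply Rminus_diag_uniq, Rsqr_0_uniq; lra.
Qed.

Lemma mass_n_lim alpha : exists K, forall n nu ph, 0 <= nu <= alpha -> 0 <= ph <= 2 * PI ->
  Rabs (mass_n k n (l nu ph) - Mass k (l nu ph)) <= K / (2 * INR n + 1).
Proof.
destruct (bounded4 _ 0 alpha 0 (2 * PI) 0 PI 0 (2 * PI) (cts4_hx k ck)) as [B HB].
exists (2 * PI * B); intros n nu ph Hnu Hph.
rewrite Mass_eq by assumption; unfold mass_n.
rewrite <- Rmult_minus_distr_l, <- sint_minus by ctsk.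
rewrite (sint_ext _ (fun xi => -1 * (dot (l nu ph) xi ^ (2 * n) * hx k (l nu ph) xi))) by (intros; ring).
rewrite sint_scal by ctsk.
rewrite !Rabs_mult, (Rabs_pos_eq (/ 2)), Rabs_m1, Rmult_1_l by lra.
pose proof (sint_pow_hx_le (hx k (l nu ph)) B (l nu ph) n (unit_l a b c Ha Hb Hab Hc nu ph) ltac:(ctsk) ltac:(intros; now apply HB)) as P.
replace (2 * PI * B / (2 * INR n + 1)) with (/ 2 * (B * (4 * PI / (2 * INR n + 1)))) by (field; pose proof (pos_INR n); lra).
lra.
Qed.

(** Concentration: the weight 2n z^(2n) has mass 2n * 4 pi / (2n + 1), while 2n z^(2n) (1 - z^2) has
    mass O(1/n). The difference hx k - k(1, l) vanishes where z^2 = 1, so on the cap it is at most a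
    small constant plus C (1 - z^2), and only the small constant survives in the limit. *)
Lemma source_n_lim alpha eta : 0 < eta -> exists K, forall n nu ph, 0 <= nu <= alpha -> 0 <= ph <= 2 * PI ->
  Rabs (source_n k m n (l nu ph) - (Mass m (l nu ph) - 2 * PI * k 1 (l nu ph))) <= eta + K / (2 * INR n + 1).
Proof.
intros He.
pose proof PI_RGT_0 as Hpi.
pose proof (unit_l a b c Ha Hb Hab Hc) as ul; fold l in ul.
destruct (bounded4 _ 0 alpha 0 (2 * PI) 0 PI 0 (2 * PI) (cts4_hx m cm)) as [B HB].
destruct (bounded4 (fun nu ph _ _ => k 1 (l nu ph)) 0 alpha 0 (2 * PI) 0 PI 0 (2 * PI)) as [D HD].
{ unfold cts4, l; ctsk; intros; apply (unit_l a b c Ha Hb Hab Hc). }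
(* Half of the mass 2n * 4 pi / (2n + 1) is below 2 pi, so this share costs at most eta. *)
assert (He' : 0 < eta / (2 * PI)) by (apply Rdiv_lt_0_compat; lra).
destruct (dominated4 (fun nu ph th ps => hx k (l nu ph) (sph_pt th ps) - k 1 (l nu ph))
   (fun nu ph th ps => 1 - dot (l nu ph) (sph_pt th ps) ^ 2) 0 alpha 0 (2 * PI) 0 PI 0 (2 * PI) (eta / (2 * PI))) as [C HC].
- unfold cts4, l; ctsk; intros; apply (unit_l a b c Ha Hb Hab Hc).
- unfold cts4, l; ctsk.
- exact He'.
- intros; pose proof (dot_sq_le_1 (l x y) (sph_pt z t) (ul x y) (unit_sph_pt z t)); lra.
- intros nu ph th ps.
  pose proof (dot_sq_le_1 (l nu ph) (sph_pt th ps) (ul nu ph) (unit_sph_pt th ps)) as H1.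
  destruct (Req_dec (dot (l nu ph) (sph_pt th ps) ^ 2) 1) as [E|E]; [left | right; lra].
  unfold hx.
  assert (E2 : (dot (l nu ph) (sph_pt th ps) - 1) * (dot (l nu ph) (sph_pt th ps) + 1) = 0) by lra.
  apply Rmult_integral in E2; destruct E2 as [E2|E2].
  + rewrite (unit_eq_of_dot (l nu ph) (sph_pt th ps)) by (auto using unit_sph_pt; lra).
    rewrite (unit_sph_pt th ps : dot _ _ = 1); ring.
  (* Opposite pole: the plane through l with normal -l is again the tangent plane (1, l). *)
  + rewrite wk by apply unit_sph_pt.
    rewrite (unit_eq_of_dot (l nu ph) (vscal (-1) (sph_pt th ps))).
    * replace (- dot _ _) with 1; [ring|].
      replace (dot (vscal (-1) (sph_pt th ps)) (sph_pt th ps)) with (- dot (sph_pt th ps) (sph_pt th ps)) by (unfold dot, vscal; cbn [vx vy vz]; ring).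
      rewrite (unit_sph_pt th ps : dot _ _ = 1); ring.
    * apply ul.
    * unfold unit_vec; rewrite <- (unit_sph_pt th ps : dot _ _ = 1) at 1; unfold dot, vscal; cbn [vx vy vz]; ring.
    * replace (dot _ _) with (- dot (l nu ph) (sph_pt th ps)) by (unfold dot, vscal; cbn [vx vy vz]; ring); lra.
(* [dominated4] does not give a sign for [C]. The three terms of the next constant pay for z^(2n) in
   the mass of m, for the C (1 - z^2) part, and for 2n / (2n + 1) falling short of 1. *)
- pose (C' := Rmax C 0).
  exists (2 * PI * B + 4 * PI * C' + 2 * PI * D); intros n nu ph Hnu Hph.
  rewrite Mass_eq by assumption; unfold source_n.
  pose (s := l nu ph); fold s.
  assert (us : unit_vec s) by apply ul.
  pose (N := INR n); pose proof (pos_INR n) as HN; fold N in HN; fold N.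
  pose proof (sint_pow_hx_le (hx m s) B s n us ltac:(ctsk) ltac:(intros; now apply HB)) as P1.
  fold N in P1.
  assert (P2 : Rabs (sint (fun xi => 2 * N * (dot s xi ^ (2 * n) * (hx k s xi - k 1 s)))) <=
     sint (fun xi => (2 * N * (eta / (2 * PI))) * dot s xi ^ (2 * n) + (2 * N * C') * (dot s xi ^ (2 * n) - dot s xi ^ (2 * S n)))).
  { apply sint_abs; [ctsk | ctsk |].
    intros th ps Hth Hps.
    rewrite !Rabs_mult, (Rabs_pos_eq (IZR 2)), (Rabs_pos_eq N) by lra.
    destruct (even_pow_bounds (dot s (sph_pt th ps)) n) as [P _]; [apply dot_sq_le_1; [exact us | apply unit_sph_pt]|].
    rewrite (Rabs_pos_eq _ P).
    replace (2 * S n)%nat with (2 * n + 2)%nat by lia; rewrite pow_add.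
    pose proof (HC nu ph th ps Hnu Hph Hth Hps) as H1; fold s in H1.
    pose proof (dot_sq_le_1 s (sph_pt th ps) us (unit_sph_pt th ps)) as H2.
    assert (H3 : C * (1 - dot s (sph_pt th ps) ^ 2) <= C' * (1 - dot s (sph_pt th ps) ^ 2))
      by (apply Rmult_le_compat_r; [lra | apply Rmax_l]).
    apply Rle_trans with (2 * N * (dot s (sph_pt th ps) ^ (2 * n) * (eta / (2 * PI) + C' * (1 - dot s (sph_pt th ps) ^ 2)))).
    - apply Rmult_le_compat_l; [lra|]; apply Rmult_le_compat_l; lra.
    - apply Req_le; ring. }
  set (I3 := sint (fun xi => 2 * N * (dot s xi ^ (2 * n) * (hx k s xi - k 1 s)))) in P2.
  rewrite sint_plus, !sint_scal, sint_minus, !sint_dot_pow in P2 by (ctsk || exact us).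
  rewrite S_INR in P2; fold N in P2.
  pose proof (HD nu ph 0 0 Hnu Hph ltac:(lra) ltac:(lra)) as P3; cbn beta in P3; fold s in P3.
  assert (E : sint (fun xi => (1 - dot s xi ^ (2 * n)) * hx m s xi - 2 * N * dot s xi ^ (2 * n) * hx k s xi)
    = sint (hx m s) - sint (fun xi => dot s xi ^ (2 * n) * hx m s xi)
      - (sint (fun xi => 2 * N * (dot s xi ^ (2 * n) * (hx k s xi - k 1 s))) + 2 * N * k 1 s * (4 * PI / (2 * N + 1)))).
  { pose proof (sint_dot_pow s n us) as SD; fold N in SD; rewrite <- SD, <- sint_scal, <- sint_minus, <- sint_plus, <- sint_minus by ctsk.
    apply sint_ext; intros; ring. }
  rewrite E.
  set (I1 := sint (hx m s)); set (I2 := sint (fun xi => dot s xi ^ (2 * n) * hx m s xi)) in *.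
  fold I3.
  assert (Hd : 0 < 2 * N + 1) by lra.
  replace (/ 2 * (I1 - I2 - (I3 + 2 * N * k 1 s * (4 * PI / (2 * N + 1)))) - (/ 2 * I1 - 2 * PI * k 1 s))
    with (- (/ 2 * I2) + (- (/ 2 * I3) + (2 * PI * k 1 s) / (2 * N + 1))) by (field; lra).
  assert (Q3 : Rabs (2 * PI * k 1 s / (2 * N + 1)) <= 2 * PI * D / (2 * N + 1)).
  { unfold Rdiv; rewrite !Rabs_mult, (Rabs_pos_eq 2), (Rabs_pos_eq PI), (Rabs_pos_eq (/ (2 * N + 1)))
      by (try lra; apply Rlt_le, Rinv_0_lt_compat; lra).
    apply Rmult_le_compat_r; [apply Rlt_le, Rinv_0_lt_compat; lra|].
    apply Rmult_le_compat_l; lra. }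
  assert (Q2 : Rabs (/ 2 * I3) <= eta + 4 * PI * C' / (2 * N + 1)).
  { rewrite Rabs_mult, Rabs_pos_eq by lra.
    assert (0 <= C') by apply Rmax_r.
    assert (S1 : 2 * N * (eta / (2 * PI)) * (4 * PI / (2 * N + 1)) <= 2 * eta).
    { replace (2 * N * (eta / (2 * PI)) * (4 * PI / (2 * N + 1))) with ((2 * eta) * (2 * N / (2 * N + 1))) by (field; lra).
      rewrite <- (Rmult_1_r (2 * eta)) at 2; apply Rmult_le_compat_l; [lra|].
      apply Rle_div_l; lra. }
    assert (S2 : 2 * N * C' * (4 * PI / (2 * N + 1) - 4 * PI / (2 * (N + 1) + 1)) <= 8 * PI * C' / (2 * N + 1)).
    { replace (2 * N * C' * (4 * PI / (2 * N + 1) - 4 * PI / (2 * (N + 1) + 1))) with ((8 * PI * C' / (2 * N + 1)) * (2 * N / (2 * N + 3))) by (field; lra).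
      rewrite <- (Rmult_1_r (8 * PI * C' / (2 * N + 1))) at 2; apply Rmult_le_compat_l.
      - apply Rle_div_r; [lra|]; nra.
      - apply Rle_div_l; lra. }
    apply Rle_trans with (/ 2 * (2 * eta + 8 * PI * C' / (2 * N + 1))).
    { apply Rmult_le_compat_l; [lra|]; eapply Rle_trans; [exact P2|]; now apply Rplus_le_compat. }
    apply Req_le; field; lra. }
  assert (Q1 : Rabs (/ 2 * I2) <= 2 * PI * B / (2 * N + 1)).
  { rewrite Rabs_mult, Rabs_pos_eq by lra.
    replace (2 * PI * B / (2 * N + 1)) with (/ 2 * (B * (4 * PI / (2 * N + 1)))) by (field; lra); lra. }
  eapply Rle_trans; [apply Rabs_triang|]; rewrite Rabs_Ropp.
  eapply Rle_trans; [apply Rplus_le_compat_l, Rabs_triang|]; rewrite Rabs_Ropp.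
  replace ((2 * PI * B + 4 * PI * C' + 2 * PI * D) / (2 * N + 1)) with
     (2 * PI * B / (2 * N + 1) + 4 * PI * C' / (2 * N + 1) + 2 * PI * D / (2 * N + 1)) by (field; lra).
  lra.
Qed.

End Frame.

(** * Limit of the cap identity for a differentiable p k *)

Lemma cts_Mass {U : UniformSpace} k (x : U -> V3) : plane_cts k -> ctsV x -> cts (fun u => Mass k (x u)).
Proof.
intros Hk Hx.
apply cts_ext with (fun u => / 2 * sint (hx k (x u))); [intros u; now rewrite Mass_eq|].
apply cts_mult; [apply cts_const|].
assert (ctsV (fun q : (U * R) * R => x (fst (fst q)))).
{ destruct Hx as [H1 [H2 H3]]; repeat split;
  [exact (cts_comp (fun q : (U * R) * R => fst (fst q)) _ ltac:(cts) H1)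
  |exact (cts_comp (fun q : (U * R) * R => fst (fst q)) _ ltac:(cts) H2)
  |exact (cts_comp (fun q : (U * R) * R => fst (fst q)) _ ltac:(cts) H3)]. }
ctsk.
Qed.

(** The same double integral serves for the cutoff data, the averaged density and the limit: [P1]
    stands for the mass, [P2] for the source. *)
Definition cap_rhs (P1 P2 : R -> R -> R) (alpha : R) : R :=
  RInt (fun be => sin be * cos be * RInt (P1 be) 0 (2 * PI)
    + sin be * RInt (fun nu => sin nu * RInt (P2 nu) 0 (2 * PI)) 0 be) 0 alpha.

Definition cts2 (P : R -> R -> R) := cts (fun p : R * R => P (fst p) (snd p)).

Lemma cts2_RInt P r s : cts2 P -> cts (fun nu => RInt (P nu) r s).
Proof. exact (cts_RInt P r s). Qed.

Lemma cap_inner_cts P r s : cts2 P -> cts (fun nu => sin nu * RInt (P nu) r s).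
Proof. intros H; apply (cts2_RInt P r s) in H; cts. Qed.

Lemma cap_inner2_cts P r s : cts2 P -> cts (fun be => RInt (fun nu => sin nu * RInt (P nu) r s) 0 be).
Proof.
intros H; apply (cts_RInt_upper (fun _ nu => sin nu * RInt (P nu) r s) (fun be => be)); [|cts].
exact (cts_comp snd (fun nu => sin nu * RInt (P nu) r s) ltac:(cts) (cap_inner_cts P r s H)).
Qed.

Lemma cap_rhs_integrand_cts P1 P2 : cts2 P1 -> cts2 P2 ->
  cts (fun be => sin be * cos be * RInt (P1 be) 0 (2 * PI)
    + sin be * RInt (fun nu => sin nu * RInt (P2 nu) 0 (2 * PI)) 0 be).
Proof.
intros H1 H2; pose proof (cts2_RInt P1 0 (2 * PI) H1); pose proof (cap_inner2_cts P2 0 (2 * PI) H2); cts.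
Qed.

Lemma Rabs_sin_le x : Rabs (sin x) <= 1.
Proof. apply Rabs_le, SIN_bound. Qed.
Lemma Rabs_cos_le x : Rabs (cos x) <= 1.
Proof. apply Rabs_le, COS_bound. Qed.

Lemma cap_rhs_dist P1 P2 Q1 Q2 alpha e : 0 <= alpha -> 0 <= e ->
  cts2 P1 -> cts2 P2 -> cts2 Q1 -> cts2 Q2 ->
  (forall nu ph, 0 <= nu <= alpha -> 0 <= ph <= 2 * PI -> Rabs (P1 nu ph - Q1 nu ph) <= e) ->
  (forall nu ph, 0 <= nu <= alpha -> 0 <= ph <= 2 * PI -> Rabs (P2 nu ph - Q2 nu ph) <= e) ->
  Rabs (cap_rhs P1 P2 alpha - cap_rhs Q1 Q2 alpha) <= (alpha * (2 * PI + alpha * (2 * PI))) * e.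
Proof.
intros Hal He cP1 cP2 cQ1 cQ2 H1 H2.
pose proof PI_RGT_0 as Hpi.
replace (alpha * (2 * PI + alpha * (2 * PI)) * e) with ((alpha - 0) * (2 * PI * e + alpha * (2 * PI * e))) by ring.
unfold cap_rhs; apply RInt_dist;
  [exact Hal | now apply cts_ex_RInt, cap_rhs_integrand_cts | now apply cts_ex_RInt, cap_rhs_integrand_cts |].
intros be Hbe.
assert (sl : forall P nu, cts2 P -> cts (P nu)) by (intros P nu; exact (cts_slice P nu)).
assert (D1 : Rabs (RInt (P1 be) 0 (2 * PI) - RInt (Q1 be) 0 (2 * PI)) <= 2 * PI * e).
{ replace (2 * PI * e) with ((2 * PI - 0) * e) by ring.
  apply RInt_dist; [lra | apply cts_ex_RInt; auto | apply cts_ex_RInt; auto |].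
  intros t Ht; now apply H1. }
assert (D2 : Rabs (RInt (fun nu => sin nu * RInt (P2 nu) 0 (2 * PI)) 0 be - RInt (fun nu => sin nu * RInt (Q2 nu) 0 (2 * PI)) 0 be) <= alpha * (2 * PI * e)).
{ apply Rle_trans with ((be - 0) * (2 * PI * e)).
  - apply RInt_dist; [lra | now apply cts_ex_RInt, cap_inner_cts | now apply cts_ex_RInt, cap_inner_cts |].
    intros nu Hnu.
    rewrite <- Rmult_minus_distr_l, Rabs_mult.
    assert (D : Rabs (RInt (P2 nu) 0 (2 * PI) - RInt (Q2 nu) 0 (2 * PI)) <= 2 * PI * e).
    { replace (2 * PI * e) with ((2 * PI - 0) * e) by ring.
      apply RInt_dist; [lra | apply cts_ex_RInt; auto | apply cts_ex_RInt; auto |].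
      intros t Ht; apply H2; lra. }
    rewrite <- (Rmult_1_l (2 * PI * e)).
    apply Rmult_le_compat; try apply Rabs_pos; [apply Rabs_sin_le | exact D].
  - apply Rmult_le_compat_r; [|lra]. apply Rmult_le_pos; lra. }
set (i1 := RInt (P1 be) 0 (2 * PI)) in *; set (i2 := RInt (Q1 be) 0 (2 * PI)) in *.
match type of D2 with Rabs (?u - ?v) <= _ => set (j1 := u) in *; set (j2 := v) in * end.
replace (sin be * cos be * i1 + sin be * j1 - (sin be * cos be * i2 + sin be * j2))
  with (sin be * cos be * (i1 - i2) + sin be * (j1 - j2)) by ring.
eapply Rle_trans; [apply Rabs_triang|]; rewrite !Rabs_mult.
apply Rplus_le_compat.
- rewrite <- (Rmult_1_l (2 * PI * e)); apply Rmult_le_compat; [|apply Rabs_pos| |exact D1].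
  + apply Rmult_le_pos; apply Rabs_pos.
  + rewrite <- (Rmult_1_l 1); apply Rmult_le_compat; try apply Rabs_pos; [apply Rabs_sin_le | apply Rabs_cos_le].
- rewrite <- (Rmult_1_l (alpha * _)); apply Rmult_le_compat; try apply Rabs_pos; [apply Rabs_sin_le | exact D2].
Qed.

Lemma inv_affine_small K e : 0 < e -> exists N, forall n, (N <= n)%nat -> K / (2 * INR n + 1) <= e.
Proof.
intros He; destruct (INR_unbounded (K / e)) as [N HN].
exists N; intros n Hn; apply le_INR in Hn; pose proof (pos_INR n).
apply Rle_div_l; [lra|].
assert (E : K / e <= 2 * INR n + 1) by lra.
apply Rmult_le_compat_l with (r := e) in E; [|lra].
replace (e * (K / e)) with K in E by (field; lra); exact E.
Qed.

Lemma eq_of_approx x y K : (forall e, 0 < e -> Rabs (x - y) <= K * e) -> x = y.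
Proof.
intros H; apply Rminus_diag_uniq; apply NNPP; intros N.
assert (P : 0 < Rabs (x - y)) by now apply Rabs_pos_lt.
destruct (Rle_or_lt K 0) as [HK|HK].
- specialize (H 1 Rlt_0_1); lra.
- assert (0 < Rabs (x - y) / (2 * K)) as E by (apply Rdiv_lt_0_compat; lra).
  specialize (H _ E).
  replace (K * (Rabs (x - y) / (2 * K))) with (Rabs (x - y) / 2) in H by (field; lra); lra.
Qed.

Section Frame.
Variables a b c : V3.
Hypothesis Ha : unit_vec a.
Hypothesis Hb : unit_vec b.
Hypothesis Hab : dot a b = 0.
Hypothesis Hc : c = cross a b.

Let l := disc_pt a b c.
Let T := bd_tan a b.

Lemma rho_tangent_lim k alpha : plane_cts k -> 0 <= alpha ->
  forall e, 0 < e -> exists N, forall n, (N <= n)%nat -> forall ph, 0 <= ph <= 2 * PI ->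
  Rabs (rho_n n k (l alpha ph) (T ph) (l alpha ph) - rho k (l alpha ph) (T ph) (l alpha ph)) <= e.
Proof.
intros ck Hal e He.
destruct (bounded4 _ 0 alpha 0 (2 * PI) 0 PI 0 (2 * PI) (cts4_hx a b c k ck)) as [B HB].
destruct (inv_sqrt_small (B * PI ^ 2) e He) as [N HN].
exists N; intros n Hn ph Hph; rewrite Rabs_minus_sym; eapply Rle_trans; [|now apply (HN n)].
apply rho_approx; [exact ck | now apply unit_T | now apply unit_l | now apply dot_T_l |].
intros th ps Hth Hps; apply HB; lra.
Qed.

Lemma rho_n_tangent_cts n k : plane_cts k -> cts2 (fun nu ph => rho_n n k (l nu ph) (T ph) (l nu ph)).
Proof. intros ck; unfold cts2, rho_n, l, T; ctsk. Qed.

Lemma rho_tangent_ex_RInt k alpha : plane_cts k -> 0 <= alpha ->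
  ex_RInt (fun ph => rho k (l alpha ph) (T ph) (l alpha ph)) 0 (2 * PI).
Proof.
intros ck Hal.
apply RInt_unif_lim with (fun n ph => rho_n n k (l alpha ph) (T ph) (l alpha ph)).
- pose proof PI_RGT_0; lra.
- intros n; apply cts_ex_RInt, (cts_slice _ alpha (rho_n_tangent_cts n k ck)).
- now apply rho_tangent_lim.
Qed.

Lemma cap_identity k m alpha : plane_cts k -> plane_cts m ->
  (forall xi, unit_vec xi -> forall p, is_derive (fun p => p * k p xi) p (m p xi)) ->
  plane_fun_wd k -> 0 <= alpha ->
  sin alpha ^ 2 * RInt (fun ph => rho k (l alpha ph) (T ph) (l alpha ph)) 0 (2 * PI)
  = cap_rhs (fun nu ph => Mass k (l nu ph)) (fun nu ph => Mass m (l nu ph) - 2 * PI * k 1 (l nu ph)) alpha.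
Proof.
intros ck cm Hkm wk Hal.
pose proof PI_RGT_0 as Hpi.
pose (A := alpha * (2 * PI + alpha * (2 * PI))).
apply eq_of_approx with (2 * PI + A); intros e He.
destruct (rho_tangent_lim k alpha ck Hal e He) as [N1 H1].
destruct (mass_n_lim a b c Ha Hb Hab Hc k ck alpha) as [K2 H2].
destruct (inv_affine_small K2 e He) as [N2 HN2].
(* Half of [e] is the concentration error. The constant [K3] depends on it, so the index is chosen
   afterwards to absorb [K3] in the other half. *)
destruct (source_n_lim a b c Ha Hb Hab Hc k m ck cm wk alpha (e / 2)) as [K3 H3]; [lra|].
destruct (inv_affine_small K3 (e / 2)) as [N3 HN3]; [lra|].
pose (n := (N1 + N2 + N3)%nat).
specialize (H1 n ltac:(unfold n; lia)); specialize (H2 n); specialize (HN2 n ltac:(unfold n; lia)).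
specialize (H3 n); specialize (HN3 n ltac:(unfold n; lia)).
assert (E := cap_identity_n a b c Ha Hb Hab Hc k m ck cm Hkm n alpha).
fold l T in E.
fold (cap_rhs (fun nu ph => mass_n k n (l nu ph)) (fun nu ph => source_n k m n (l nu ph)) alpha) in E.
set (Ln := RInt (fun ph => rho_n n k (l alpha ph) (T ph) (l alpha ph)) 0 (2 * PI)) in *.
set (L := RInt (fun ph => rho k (l alpha ph) (T ph) (l alpha ph)) 0 (2 * PI)).
assert (D1 : Rabs (Ln - L) <= (2 * PI - 0) * e).
{ apply RInt_dist; [lra | apply cts_ex_RInt, (cts_slice _ alpha (rho_n_tangent_cts n k ck)) | now apply rho_tangent_ex_RInt | exact H1]. }
assert (D2 : Rabs (cap_rhs (fun nu ph => mass_n k n (l nu ph)) (fun nu ph => source_n k m n (l nu ph)) alpha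
   - cap_rhs (fun nu ph => Mass k (l nu ph)) (fun nu ph => Mass m (l nu ph) - 2 * PI * k 1 (l nu ph)) alpha) <= A * e).
{ assert (cl : ctsV (fun p : R * R => l (fst p) (snd p))) by (unfold l; ctsk).
  apply cap_rhs_dist.
  - exact Hal.
  - lra.
  - unfold cts2, mass_n, l; ctsk.
  - unfold cts2, source_n, l; ctsk.
  - now apply cts_Mass.
  - apply cts_minus; [now apply cts_Mass|].
    ctsk; intros; now apply unit_l.
  - intros nu ph Hnu Hph; eapply Rle_trans; [now apply H2 | exact HN2].
  - intros nu ph Hnu Hph; eapply Rle_trans; [now apply H3 | lra]. }
match type of D2 with Rabs (?u - ?v) <= _ => set (Rn := u) in *; set (Rr := v) in * end.
replace (sin alpha ^ 2 * L - Rr) with (- (sin alpha ^ 2 * (Ln - L)) + (Rn - Rr)) by (rewrite <- E; ring).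
eapply Rle_trans; [apply Rabs_triang|]; rewrite Rabs_Ropp, Rabs_mult.
assert (S : Rabs (sin alpha ^ 2) <= 1).
{ rewrite <- RPow_abs; rewrite <- (pow1 2); apply pow_incr; split; [apply Rabs_pos | apply Rabs_sin_le]. }
assert (Rabs (sin alpha ^ 2) * Rabs (Ln - L) <= 1 * (2 * PI * e)).
{ apply Rmult_le_compat; try apply Rabs_pos; [exact S | lra]. }
lra.
Qed.

(** The cutoff kernel satisfies 0 <= x^2 q_n <= (1 - z^2) q_n <= 1, so the bound holds at each n and
    passes to the limit, without linearity for integrals of the singular kernel. *)
Lemma rho_dist k k' alpha ph : plane_cts k -> plane_cts k' -> 0 <= alpha -> 0 <= ph <= 2 * PI ->
  Rabs (rho k (l alpha ph) (T ph) (l alpha ph) - rho k' (l alpha ph) (T ph) (l alpha ph))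
  <= / 2 * sint (fun xi => Rabs (hx k (l alpha ph) xi - hx k' (l alpha ph) xi)).
Proof.
intros ck ck' Hal Hph.
apply le_epsilon; intros e He.
destruct (rho_tangent_lim k alpha ck Hal (e / 2)) as [N1 H1]; [lra|].
destruct (rho_tangent_lim k' alpha ck' Hal (e / 2)) as [N2 H2]; [lra|].
pose (n := (N1 + N2)%nat).
specialize (H1 n ltac:(unfold n; lia) ph Hph); specialize (H2 n ltac:(unfold n; lia) ph Hph).
set (r := rho k _ _ _) in *; set (r' := rho k' _ _ _) in *.
set (s := rho_n n k _ _ _) in *; set (s' := rho_n n k' _ _ _) in *.
assert (D : Rabs (s - s') <= / 2 * sint (fun xi => Rabs (hx k (l alpha ph) xi - hx k' (l alpha ph) xi))).
{ unfold s, s', rho_n, l, T.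
  rewrite <- Rmult_minus_distr_l, <- sint_minus, Rabs_mult, Rabs_pos_eq by (ctsk || lra).
  apply Rmult_le_compat_l; [lra|]; apply sint_abs; [ctsk | ctsk |].
  intros th ps _ _.
  rewrite <- Rmult_minus_distr_l, Rabs_mult.
  rewrite <- (Rmult_1_l (Rabs (hx _ _ _ - _))) at 2.
  apply Rmult_le_compat_r; [apply Rabs_pos|].
  set (x := dot (bd_tan a b ph) _); set (z := dot (disc_pt _ _ _ _ _) _).
  assert (Hxz : x ^ 2 + z ^ 2 <= 1).
  { apply bessel; [now apply unit_T | now apply unit_l | now apply dot_T_l | apply unit_sph_pt]. }
  assert (G : forall n, 0 <= geom n z).
  { induction n0 as [|q IH]; cbn [geom]; [lra|].
    pose proof (pow2_ge_0 x).
    destruct (even_pow_bounds z q); lra. }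
  pose proof (geom_mul n z) as GM; pose proof (G n).
  pose proof (pow2_ge_0 x).
  destruct (even_pow_bounds z n); [lra|].
  rewrite Rabs_pos_eq; nra. }
replace (r - r') with (- (s - r) + ((s - s') + (s' - r'))) by ring.
eapply Rle_trans; [apply Rabs_triang|]; rewrite Rabs_Ropp.
pose proof (Rabs_triang (s - s') (s' - r')); lra.
Qed.

End Frame.


(** * Densities that are only continuous *)

(* The average of [h] over the parallel planes at distances between [p] and [(1 + d) p]: it makes
   [p * h p] differentiable in [p] while [h] is only continuous. *)
Definition radial_avg (h : R -> V3 -> R) (d : R) (p : R) (xi : V3) : R :=
  RInt (fun t => h (p * (1 + t * d)) xi) 0 1.
(** The derivative in p of p times the average; it is the difference quotient of r h(r p, xi)
    between r = 1 and r = 1 + d. *)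
Definition radial_diff (h : R -> V3 -> R) (d : R) (p : R) (xi : V3) : R :=
  ((1 + d) * h ((1 + d) * p) xi - h p xi) / d.

Lemma ctsV_fst {U V : UniformSpace} (x : U -> V3) : ctsV x -> ctsV (fun p : U * V => x (fst p)).
Proof.
intros [H1 [H2 H3]]; repeat split;
  [exact (cts_comp (fun q : U * V => fst q) _ ltac:(cts) H1)
  |exact (cts_comp (fun q : U * V => fst q) _ ltac:(cts) H2)
  |exact (cts_comp (fun q : U * V => fst q) _ ltac:(cts) H3)].
Qed.

Section Avg.
Variable h : R -> V3 -> R.
Hypothesis ch : plane_cts h.

(** Joint continuity includes [d], because d -> 0 is later taken as continuity at 0. *)
Lemma cts_radial_avg {U : UniformSpace} (d p : U -> R) (xi : U -> V3) :
  cts d -> cts p -> ctsV xi -> (forall u, unit_vec (xi u)) -> cts (fun u => radial_avg h (d u) (p u) (xi u)).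
Proof.
intros Hd Hp Hxi Hu; unfold radial_avg.
apply (cts_RInt (fun u t => h (p u * (1 + t * d u)) (xi u))).
assert (cts (fun q : U * R => d (fst q))) by (apply (cts_comp fst d); [cts | exact Hd]).
assert (cts (fun q : U * R => p (fst q))) by (apply (cts_comp fst p); [cts | exact Hp]).
apply ch; [cts | now apply ctsV_fst | intros; apply Hu].
Qed.

Lemma radial_avg_cts d : plane_cts (radial_avg h d).
Proof. intros U p xi Hp Hxi Hu; apply (cts_radial_avg (fun _ => d)); [cts | assumption..]. Qed.

Lemma radial_diff_cts d : plane_cts (radial_diff h d).
Proof.
intros U p xi Hp Hxi Hu; unfold radial_diff, Rdiv.
assert (cts (fun u => h ((1 + d) * p u) (xi u))) by (apply ch; [cts | assumption | assumption]).
assert (cts (fun u => h (p u) (xi u))) by (apply ch; assumption).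
cts.
Qed.

Lemma radial_avg_wd d : plane_fun_wd h -> plane_fun_wd (radial_avg h d).
Proof.
intros Hw p xi Hu; apply RInt_ext; intros t _; rewrite Hw by exact Hu; f_equal; Rring.
Qed.

(** The reason for averaging over the fixed segment [0, 1] instead of dividing by d: the formula
    remains valid at d = 0 and returns [h] itself. *)
Lemma radial_avg_0 p xi : radial_avg h 0 p xi = h p xi.
Proof.
unfold radial_avg; rewrite (RInt_ext _ (fun _ => h p xi)).
- rewrite RInt_const; change (scal (1 - 0) (h p xi)) with ((1 - 0) * h p xi); Rring.
- intros t _; f_equal; Rring.
Qed.

(** With a primitive H of h in its first argument, p times the average is (H((1 + d) p) - H(p)) / d,
    also at p = 0. *)
Lemma radial_avg_derive d xi : d <> 0 -> unit_vec xi ->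
  forall p, is_derive (fun p => p * radial_avg h d p xi) p (radial_diff h d p xi).
Proof.
intros Hd Hu p0.
assert (c1 : cts (fun p => h p xi)) by (apply ch; [cts | apply ctsV_const | intros; exact Hu]).
assert (EH : exists H : R -> R, (forall t, is_derive H t (h t xi)) /\ forall s t, RInt (fun p => h p xi) s t = H t - H s).
{ exists (fun t => RInt (fun p => h p xi) 0 t); split.
  - intros t; now apply (is_derive_RInt_upper (fun p => h p xi)).
  - intros s t.
    rewrite <- (RInt_Chasles (fun p => h p xi) 0 s t) by now apply cts_ex_RInt.
    unfold plus; cbn; Rring. }
destruct EH as [H [HH HI]].
assert (DH : forall t, Derive (fun t => H t) t = h t xi) by (intros; apply is_derive_unique, HH).
apply is_derive_ext with (fun p => (H ((1 + d) * p) - H p) / d).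
- intros p.
  replace ((1 + d) * p) with (p * d * 1 + p) by Rring.
  replace (H p) with (H (p * d * 0 + p)) by (f_equal; Rring).
  rewrite <- HI.
  rewrite <- (RInt_comp_lin (fun p => h p xi) (p * d) p 0 1) by now apply cts_ex_RInt.
  unfold radial_avg.
  rewrite (RInt_ext _ (fun t => (p * d) * h (p * (1 + t * d)) xi)).
  + rewrite RInt_Rmult.
    * Rfield; exact Hd.
    * apply cts_ex_RInt, ch; [cts | apply ctsV_const | intros; exact Hu].
  + intros t _; unfold scal; cbn; unfold mult; cbn; f_equal; f_equal; Rring.
- unfold radial_diff; auto_derive.
  + repeat split; exact (ex_intro _ _ (HH _)).
  + rewrite !DH; Rfield; exact Hd.
Qed.

End Avg.

(** The identity f = g is available only for d <> 0 and continuity of f is not; instead f stays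
    within [e d] of [F], and [e] tends to 0. *)
Lemma continuous_eq_at_0 (f g : R -> R) (F : R) (e : R -> R) :
  cts g -> cts e -> e 0 = 0 ->
  (forall d, d <> 0 -> f d = g d) -> (forall d, Rabs (f d - F) <= e d) -> F = g 0.
Proof.
intros cg ce e0 Hfg Hf.
apply eq_of_approx with 2; intros r Hr.
generalize (filter_and _ _ (proj1 (filterlim_locally _ _) (cg 0) (mkposreal _ Hr))
  (proj1 (filterlim_locally _ _) (ce 0) (mkposreal _ Hr))); intros [d Hd].
assert (Hd2 : ball 0 d (d / 2)).
{ change (Rabs (d / 2 - 0) < d); pose proof (cond_pos d); rewrite Rabs_pos_eq; lra. }
destruct (Hd _ Hd2) as [B1 B2].
change (Rabs (g (d / 2) - g 0) < r) in B1; change (Rabs (e (d / 2) - e 0) < r) in B2.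
rewrite e0, Rminus_0_r in B2.
assert (N : d / 2 <> 0) by (pose proof (cond_pos d); lra).
specialize (Hf (d / 2)); rewrite Hfg in Hf by exact N.
replace (F - g 0) with (- (g (d / 2) - F) + (g (d / 2) - g 0)) by Rring.
eapply Rle_trans; [apply Rabs_triang|]; rewrite Rabs_Ropp.
pose proof (Rle_abs (e (d / 2))); lra.
Qed.

Section Frame.
Variables a b c : V3.
Hypothesis Ha : unit_vec a.
Hypothesis Hb : unit_vec b.
Hypothesis Hab : dot a b = 0.
Hypothesis Hc : c = cross a b.

Let l := disc_pt a b c.
Let T := bd_tan a b.

(** The density enters through its mass alone, apart from the tangent planes: the mass of
    [radial_diff h d] is the difference quotient of r M(r l), that is, the average of [G] over
    [1, 1 + d], which tends to [G 1]. *)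
Lemma cap_identity_radial h (G : R -> R -> R -> R) alpha :
  plane_cts h -> plane_fun_wd h -> 0 <= alpha ->
  cts (fun q : (R * R) * R => G (fst (fst q)) (snd (fst q)) (snd q)) ->
  (forall r nu ph, is_derive (fun r => r * Mass h (vscal r (l nu ph))) r (G r nu ph)) ->
  sin alpha ^ 2 * RInt (fun ph => rho h (l alpha ph) (T ph) (l alpha ph)) 0 (2 * PI)
  = cap_rhs (fun nu ph => Mass h (l nu ph)) (fun nu ph => G 1 nu ph - 2 * PI * h 1 (l nu ph)) alpha.
Proof.
intros ch wh Hal cG HG.
pose proof PI_RGT_0 as Hpi.
pose (k := radial_avg h).
pose (P1 := fun d nu ph => Mass (k d) (l nu ph)).
(* Written as an average over [0, 1], the source is continuous in d even at 0. *)
pose (P2 := fun d nu ph => RInt (fun t => G (1 + t * d) nu ph) 0 1 - 2 * PI * k d 1 (l nu ph)).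
assert (cP1 : cts (fun q : (R * R) * R => P1 (fst (fst q)) (snd (fst q)) (snd q))).
{ apply cts_ext with (fun q : (R * R) * R => / 2 * sint (hx (k (fst (fst q))) (l (snd (fst q)) (snd q)))).
  - intros q; unfold P1; rewrite Mass_eq; [reflexivity | now apply radial_avg_cts].
  - apply cts_mult; [cts|]; apply (cts_sint (fun q : (R * R) * R => hx (k (fst (fst q))) (l (snd (fst q)) (snd q)))).
    unfold hx, k, l; apply cts_radial_avg; [exact ch | cts | ctsk | ctsk | intros; apply unit_sph_pt]. }
assert (cP2 : cts (fun q : (R * R) * R => P2 (fst (fst q)) (snd (fst q)) (snd q))).
{ apply cts_minus.
  - apply (cts_RInt (fun (q : (R * R) * R) t => G (1 + t * fst (fst q)) (snd (fst q)) (snd q))).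
    refine (cts_comp (fun p : ((R * R) * R) * R => (((1 + snd p * fst (fst (fst p)), snd (fst (fst p))), snd (fst p)) : (R * R) * R)) _ _ cG).
    cts.
  - apply cts_mult; [cts|]; unfold k, l.
    apply cts_radial_avg; [exact ch | cts | cts | ctsk | intros; now apply unit_l]. }
pose (e := fun d => sin alpha ^ 2 * RInt (fun ph => / 2 * sint (fun xi => Rabs (hx (k d) (l alpha ph) xi - hx h (l alpha ph) xi))) 0 (2 * PI)).
assert (ce2 : cts (fun p : R * R => / 2 * sint (fun xi => Rabs (hx (k (fst p)) (l alpha (snd p)) xi - hx h (l alpha (snd p)) xi)))).
{ apply cts_mult; [cts|].
  apply (cts_sint (fun (p : R * R) xi => Rabs (hx (k (fst p)) (l alpha (snd p)) xi - hx h (l alpha (snd p)) xi))).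
  apply cts_Rabs, cts_minus; unfold l.
  - unfold hx, k; apply cts_radial_avg; [exact ch | cts | ctsk | ctsk | intros; apply unit_sph_pt].
  - ctsk. }
replace (cap_rhs _ _ alpha) with (cap_rhs (P1 0) (P2 0) alpha).
2:{ unfold cap_rhs; apply RInt_ext; intros be _; f_equal; f_equal.
  - apply RInt_ext; intros ph _; unfold P1; rewrite !Mass_eq by (auto; now apply radial_avg_cts).
    f_equal; apply sint_ext; intros; apply radial_avg_0.
  - apply RInt_ext; intros nu _; f_equal; apply RInt_ext; intros ph _; unfold P2, k; rewrite radial_avg_0.
    f_equal; rewrite (RInt_ext _ (fun _ => G 1 nu ph)).
    + rewrite RInt_const; change (scal (1 - 0) (G 1 nu ph)) with ((1 - 0) * G 1 nu ph); Rring.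
    + intros t _; f_equal; Rring. }
apply (continuous_eq_at_0
  (fun d => sin alpha ^ 2 * RInt (fun ph => rho (k d) (l alpha ph) (T ph) (l alpha ph)) 0 (2 * PI))
  (fun d => cap_rhs (P1 d) (P2 d) alpha) _ e).
- unfold cap_rhs.
  assert (I1 : cts (fun q : R * R => RInt (P1 (fst q) (snd q)) 0 (2 * PI))).
  { exact (cts_RInt (fun (q : R * R) ph => P1 (fst q) (snd q) ph) 0 (2 * PI) cP1). }
  assert (I2 : cts (fun q : R * R => RInt (P2 (fst q) (snd q)) 0 (2 * PI))).
  { exact (cts_RInt (fun (q : R * R) ph => P2 (fst q) (snd q) ph) 0 (2 * PI) cP2). }
  apply (cts_RInt (fun d be => sin be * cos be * RInt (P1 d be) 0 (2 * PI) + sin be * RInt (fun nu => sin nu * RInt (P2 d nu) 0 (2 * PI)) 0 be)).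
  apply cts_plus; apply cts_mult; [cts | exact I1 | cts |].
  apply (cts_RInt_upper (fun (q : R * R) nu => sin nu * RInt (P2 (fst q) nu) 0 (2 * PI)) snd); [|cts].
  apply cts_mult; [cts|].
  refine (cts_comp (fun p : (R * R) * R => ((fst (fst p), snd p) : R * R)) _ _ I2); cts.
- unfold e; apply cts_mult; [cts|].
  apply (cts_RInt (fun d ph => / 2 * sint (fun xi => Rabs (hx (k d) (l alpha ph) xi - hx h (l alpha ph) xi)))).
  exact ce2.
- unfold e. rewrite (RInt_ext _ (fun _ => 0)).
  + rewrite RInt_const; change (scal (2 * PI - 0) 0) with ((2 * PI - 0) * 0); Rring.
  + intros ph _; rewrite (sint_ext _ (fun xi => 0 * 1)).
    * rewrite sint_scal by (unfold sph_cts; cts); Rring.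
    * intros xi _; unfold k, hx; rewrite radial_avg_0, Rminus_eq_0, Rabs_R0; Rring.
- intros d Hd.
  etransitivity; [apply (cap_identity a b c Ha Hb Hab Hc (k d) (radial_diff h d) alpha)|].
  6:{ fold l; unfold cap_rhs; apply RInt_ext; intros be _; f_equal; f_equal.
    apply RInt_ext; intros nu _; f_equal; apply RInt_ext; intros ph _; unfold P2; f_equal.
    assert (EM : Mass (radial_diff h d) (l nu ph) = ((1 + d) * Mass h (vscal (1 + d) (l nu ph)) - 1 * Mass h (vscal 1 (l nu ph))) / d).
    { rewrite !Mass_eq by (auto; now apply radial_diff_cts).
      rewrite (sint_ext (hx (radial_diff h d) (l nu ph)) (fun xi => (1 + d) / d * hx h (vscal (1 + d) (l nu ph)) xi - / d * hx h (vscal 1 (l nu ph)) xi)).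
      - unfold l; rewrite sint_minus, !sint_scal by ctsk; Rfield; exact Hd.
      - intros xi _; unfold hx, radial_diff.
        replace (dot (vscal (1 + d) (l nu ph)) xi) with ((1 + d) * dot (l nu ph) xi) by (unfold dot, vscal; cbn [vx vy vz]; Rring).
        replace (dot (vscal 1 (l nu ph)) xi) with (dot (l nu ph) xi) by (unfold dot, vscal; cbn [vx vy vz]; Rring).
        Rfield; exact Hd. }
    rewrite EM.
    assert (cGr : cts (fun r => G r nu ph)).
    { refine (cts_comp (fun r : R => (((r, nu), ph) : (R * R) * R)) _ _ cG); cts. }
    assert (EI : RInt (fun r => G r nu ph) (d * 0 + 1) (d * 1 + 1) = (1 + d) * Mass h (vscal (1 + d) (l nu ph)) - 1 * Mass h (vscal 1 (l nu ph))).
    { replace (d * 0 + 1) with 1 by Rring; replace (d * 1 + 1) with (1 + d) by Rring.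
      apply is_RInt_unique, (is_RInt_derive (fun r => r * Mass h (vscal r (l nu ph))) (fun r => G r nu ph)); intros; [apply HG | apply cGr]. }
    rewrite <- EI, <- (RInt_comp_lin (fun r => G r nu ph) d 1 0 1) by now apply cts_ex_RInt.
    rewrite (RInt_ext _ (fun t => d * G (1 + t * d) nu ph)).
    * rewrite RInt_Rmult; [Rfield; exact Hd|].
      apply cts_ex_RInt; refine (cts_comp (fun t : R => 1 + t * d) (fun r => G r nu ph) _ cGr); cts.
    * intros t _; unfold scal; cbn; unfold mult; cbn; f_equal; f_equal; Rring. }
  + now apply radial_avg_cts.
  + now apply radial_diff_cts.
  + intros xi Hxi; now apply radial_avg_derive.
  + now apply radial_avg_wd.
  + exact Hal.
- intros d; unfold e.
  assert (ckd : plane_cts (k d)) by now apply radial_avg_cts.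
  assert (i1 : ex_RInt (fun ph => rho (k d) (l alpha ph) (T ph) (l alpha ph)) 0 (2 * PI)) by now apply rho_tangent_ex_RInt.
  assert (i2 : ex_RInt (fun ph => rho h (l alpha ph) (T ph) (l alpha ph)) 0 (2 * PI)) by now apply rho_tangent_ex_RInt.
  rewrite <- Rmult_minus_distr_l, Rabs_mult, (Rabs_pos_eq (sin alpha ^ 2)) by apply pow2_ge_0.
  apply Rmult_le_compat_l; [apply pow2_ge_0|].
  apply RInt_abs_sub_le; [lra | exact i1 | exact i2 | apply cts_ex_RInt; exact (cts_slice (fun d ph => / 2 * sint (fun xi => Rabs (hx (k d) (l alpha ph) xi - hx h (l alpha ph) xi))) d ce2) |].
  intros ph Hph; now apply rho_dist.
Qed.

End Frame.

(** * Chain rule and the radial derivative of the bundle mass *)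

Fixpoint vsum (n : nat) (g : nat -> R) : R :=
  match n with O => 0 | S m => vsum m g + g m end.

(** [contn] tests only the first n coordinates, which forces [f] to ignore all others; this replaces
    extensionality for sequences. *)
Lemma contn_ext n f x y : contn n f -> (forall i, (i < n)%nat -> x i = y i) -> f x = f y.
Proof.
intros Hf E; apply eq_of_approx with 1; intros e He.
destruct (Hf y e He) as [d [Hd H]].
rewrite Rmult_1_l; apply Rlt_le, H; intros i Hi; rewrite E, Rminus_eq_0, Rabs_R0 by exact Hi; exact Hd.
Qed.

Definition has_partials (n : nat) (f : (nat -> R) -> R) (D : nat -> (nat -> R) -> R) : Prop :=
  (forall i x, (i < n)%nat -> derivable_pt_lim (fun s => f (upd x i s)) (x i) (D i x)) /\
  (forall i, (i < n)%nat -> contn n (D i)) /\ contn n f.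

Lemma C2n_partials n f : C2n n f -> exists D, has_partials n f D.
Proof.
intros [D [H1 [H2 H3]]]; exists D; split; [exact H1|]; split; [|exact H3].
intros i Hi; destruct (H2 i Hi) as [D' [_ [_ H]]]; exact H.
Qed.

(** Coordinates are switched from [x] to [y] one at a time, [mix j y] having switched the first j;
    the mean value theorem handles each switch and continuity of the partial moves its value back to
    [x]. *)
Lemma partials_differentiable n f D x e : has_partials n f D -> 0 < e ->
  exists d, 0 < d /\ forall y, (forall i, (i < n)%nat -> Rabs (y i - x i) < d) ->
    Rabs (f y - f x - vsum n (fun i => D i x * (y i - x i))) <= e * vsum n (fun i => Rabs (y i - x i)).
Proof.
intros [H1 [H2 H3]] He.
pose (mix := fun (j : nat) (y : nat -> R) i => if Nat.ltb i j then y i else x i).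
assert (P : forall j, (j <= n)%nat -> exists d, 0 < d /\ forall y, (forall i, (i < n)%nat -> Rabs (y i - x i) < d) ->
    Rabs (f (mix j y) - f x - vsum j (fun i => D i x * (y i - x i))) <= e * vsum j (fun i => Rabs (y i - x i))).
{ induction j as [|j IH]; intros Hj.
  - exists 1; split; [lra|]; intros y _; cbn [vsum].
    replace (f (mix O y)) with (f x) by (apply contn_ext with n; [exact H3 | reflexivity]).
    rewrite Rminus_eq_0, Rminus_0_r, Rabs_R0; lra.
  - destruct IH as [d1 [Hd1 IH]]; [lia|].
    destruct (H2 j ltac:(lia) x e He) as [d2 [Hd2 HD]].
    exists (Rmin d1 d2); split; [now apply Rmin_pos|]; intros y Hy.
    assert (Hy1 : forall i, (i < n)%nat -> Rabs (y i - x i) < d1)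
      by (intros i Hi; eapply Rlt_le_trans; [now apply Hy | apply Rmin_l]).
    assert (Hy2 : forall i, (i < n)%nat -> Rabs (y i - x i) < d2)
      by (intros i Hi; eapply Rlt_le_trans; [now apply Hy | apply Rmin_r]).
    specialize (IH y Hy1).
    pose (g := fun s => f (upd (mix j y) j s)).
    assert (Hg : forall s, is_derive g s (D j (upd (mix j y) j s))).
    { intros s; apply is_derive_Reals.
      pose proof (H1 j (upd (mix j y) j s) ltac:(lia)) as H.
      assert (Eu : upd (mix j y) j s j = s) by (unfold upd; now rewrite Nat.eqb_refl).
      rewrite Eu in H.
      apply is_derive_Reals in H; apply is_derive_Reals; revert H; apply is_derive_ext.
      intros t; unfold g; apply contn_ext with n; [exact H3|].
      intros i _; unfold upd; destruct (Nat.eqb i j); reflexivity. }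
    destruct (MVT_gen g (x j) (y j) (fun s => D j (upd (mix j y) j s))) as [s [Hs E]].
    + intros; apply Hg.
    + intros t _; apply continuity_pt_filterlim.
      apply (ex_derive_continuous (V := R_NormedModule) g); eexists; apply Hg.
    + replace (f (mix (S j) y)) with (g (y j)).
      2:{ apply contn_ext with n; [exact H3|]; intros i _; unfold upd, mix.
          destruct (Nat.eqb_spec i j) as [->|Ne].
          - rewrite (proj2 (Nat.ltb_lt _ _)) by lia; reflexivity.
          - destruct (Nat.ltb_spec i j), (Nat.ltb_spec i (S j)); try reflexivity; lia. }
      replace (f (mix j y)) with (g (x j)) in IH.
      2:{ apply contn_ext with n; [exact H3|]; intros i _; unfold upd, mix.
          destruct (Nat.eqb_spec i j) as [->|Ne]; [|reflexivity].
          rewrite (proj2 (Nat.ltb_ge _ _)) by lia; reflexivity. }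
      cbn [vsum].
      assert (HDs : Rabs (D j (upd (mix j y) j s) - D j x) <= e).
      { apply Rlt_le, HD; intros i Hi; unfold upd, mix.
        destruct (Nat.eqb_spec i j) as [->|Ne].
        - eapply Rle_lt_trans; [|apply (Hy2 j Hi)].
          unfold Rmin, Rmax in Hs; unfold Rabs; repeat destruct Rcase_abs; destruct Rle_dec; lra.
        - destruct (Nat.ltb i j); [now apply Hy2|]; rewrite Rminus_eq_0, Rabs_R0; exact Hd2. }
      set (V := vsum j (fun i => D i x * (y i - x i))) in *.
      set (Ds := D j (upd (mix j y) j s)) in *.
      replace (g (y j) - f x - (V + D j x * (y j - x j)))
        with ((g (x j) - f x - V) + (Ds - D j x) * (y j - x j)) by lra.
      eapply Rle_trans; [apply Rabs_triang|]; rewrite Rabs_mult, Rmult_plus_distr_l.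
      apply Rplus_le_compat; [exact IH|].
      apply Rmult_le_compat_r; [apply Rabs_pos | exact HDs]. }
destruct (P n (le_n n)) as [d [Hd H]]; exists d; split; [exact Hd|]; intros y Hy.
replace (f y) with (f (mix n y)); [now apply H|].
apply contn_ext with n; [exact H3|]; intros i Hi; unfold mix; rewrite (proj2 (Nat.ltb_lt _ _)) by exact Hi; reflexivity.
Qed.

Lemma is_derive_lipschitz (f : R -> R) (x l : R) : is_derive f x l ->
  locally x (fun t => Rabs (f t - f x) <= (Rabs l + 1) * Rabs (t - x)).
Proof.
intros H; apply is_derive_Reals in H.
destruct (H 1 Rlt_0_1) as [d Hd]; exists d.
assert (E : forall t : R, Rabs (t - x) < d -> Rabs (f t - f x) <= (Rabs l + 1) * Rabs (t - x)); [|intros t Ht; now apply E].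
intros t Ht.
destruct (Req_dec t x) as [->|Ne].
- rewrite !Rminus_eq_0, Rabs_R0; lra.
- specialize (Hd (t - x) ltac:(lra) Ht).
  replace (x + (t - x)) with t in Hd by Rring.
  replace (f t - f x) with ((f t - f x) / (t - x) * (t - x)) by (Rfield; lra).
  rewrite Rabs_mult; apply Rmult_le_compat_r; [apply Rabs_pos|].
  replace ((f t - f x) / (t - x)) with (l + ((f t - f x) / (t - x) - l)) by Rring.
  eapply Rle_trans; [apply Rabs_triang|]; lra.
Qed.

Lemma locally_all_lt {U : UniformSpace} (u : U) n (P : nat -> U -> Prop) :
  (forall i, (i < n)%nat -> locally u (P i)) -> locally u (fun t => forall i, (i < n)%nat -> P i t).
Proof.
induction n as [|n IH]; intros H.
- apply filter_forall; intros; lia.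
- assert (H1 : locally u (fun t => forall i, (i < n)%nat -> P i t)) by (apply IH; intros; apply H; lia).
  assert (H2 : locally u (P n)) by (apply H; lia).
  generalize (filter_and _ _ H1 H2); clear H1 H2.
  apply filter_imp; intros t [H1 H2] i Hi.
  destruct (Nat.eq_dec i n) as [->|Ne]; [exact H2 | apply H1; lia].
Qed.

Lemma vsum_le n f g : (forall i, (i < n)%nat -> f i <= g i) -> vsum n f <= vsum n g.
Proof.
induction n as [|n IH]; intros H; cbn [vsum]; [lra|].
apply Rplus_le_compat; [apply IH; intros; apply H; lia | apply H; lia].
Qed.

Lemma is_derive_affine (q : R -> R) (k r t0 dq : R) : is_derive q t0 dq ->
  is_derive (fun t => k * (q t - r)) t0 (k * dq).
Proof.
intros H; auto_derive; [exact (ex_intro _ _ H)|].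
replace (Derive _ t0) with dq by (symmetry; apply is_derive_unique, H); ring.
Qed.

Lemma is_derive_id_mul (q : R -> R) (t0 dq : R) : is_derive q t0 dq ->
  is_derive (fun t => t * q t) t0 (q t0 + t0 * dq).
Proof.
intros H; auto_derive; [exact (ex_intro _ _ H)|].
replace (Derive _ t0) with dq by (symmetry; apply is_derive_unique, H); ring.
Qed.

Lemma chain_rule n f D (v : R -> nat -> R) (dv : nat -> R) t0 : has_partials n f D ->
  (forall i, (i < n)%nat -> is_derive (fun t => v t i) t0 (dv i)) ->
  is_derive (fun t => f (v t)) t0 (vsum n (fun i => D i (v t0) * dv i)).
Proof.
intros Hf Hv.
pose (x := v t0).
assert (L : is_derive (fun t => vsum n (fun i => D i x * (v t i - x i))) t0 (vsum n (fun i => D i x * dv i))).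
{ clear Hf; induction n as [|n IH]; cbn [vsum].
  - auto_derive; [exact I | reflexivity].
  - apply (is_derive_plus (fun t => vsum n (fun i => D i x * (v t i - x i))) (fun t => D n x * (v t n - x n))).
    + apply IH; intros; apply Hv; lia.
    + pose proof (Hv n ltac:(lia)) as Hn.
      exact (is_derive_affine _ _ _ _ _ Hn). }
pose (r := fun t => f (v t) - f x - vsum n (fun i => D i x * (v t i - x i))).
pose (K := vsum n (fun i => Rabs (dv i) + 1)).
assert (HK : 0 <= K).
{ unfold K; clear; induction n as [|n IH]; cbn [vsum]; [lra|]; pose proof (Rabs_pos (dv n)); lra. }
assert (Er : is_derive r t0 0).
{ apply is_derive_Reals; intros eps Heps.
  (* The remainder is at most e K |s|; the 1 avoids a zero denominator and the 2 makes the
     inequality strict. *)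
  pose (e := eps / (2 * (K + 1))).
  assert (He : 0 < e) by (apply Rdiv_lt_0_compat; lra).
  destruct (partials_differentiable n f D x e Hf He) as [d [Hd H]].
  assert (L1 : locally t0 (fun t => forall i, (i < n)%nat -> Rabs (v t i - x i) <= (Rabs (dv i) + 1) * Rabs (t - t0))).
  { apply locally_all_lt; intros i Hi; exact (is_derive_lipschitz _ _ _ (Hv i Hi)). }
  assert (L2 : locally t0 (fun t => forall i, (i < n)%nat -> Rabs (v t i - x i) < d)).
  { apply locally_all_lt; intros i Hi.
    assert (C : continuous (fun t => v t i) t0) by (apply (ex_derive_continuous (V := R_NormedModule)); exact (ex_intro _ _ (Hv i Hi))).
    exact (proj1 (filterlim_locally _ _) C (mkposreal d Hd)). }
  destruct (filter_and _ _ L1 L2) as [del Hdel].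
  exists del; intros s Hs0 Hs.
  destruct (Hdel (t0 + s)) as [G1 G2].
  { change (Rabs (t0 + s - t0) < del); replace (t0 + s - t0) with s by Rring; exact Hs. }
  specialize (H (v (t0 + s)) G2).
  assert (R0 : r t0 = 0).
  { unfold r; fold x; rewrite Rminus_eq_0.
    assert (E0 : vsum n (fun i => D i x * (x i - x i)) = 0).
    { clear; induction n as [|n IH]; cbn [vsum]; [reflexivity | rewrite IH; Rring]. }
    rewrite E0; Rring. }
  rewrite R0, !Rminus_0_r; unfold Rdiv; rewrite Rabs_mult, Rabs_inv.
  assert (Ps : 0 < Rabs s) by now apply Rabs_pos_lt.
  apply Rle_lt_trans with (e * K); [|].
  - apply Rle_div_l; [exact Ps|].
    change (Rabs (r (t0 + s)) <= e * vsum n (fun i => Rabs (v (t0 + s) i - x i))) in H.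
    eapply Rle_trans; [exact H|]; rewrite Rmult_assoc; apply Rmult_le_compat_l; [lra|].
    eapply Rle_trans; [apply (vsum_le n _ (fun i => (Rabs (dv i) + 1) * Rabs s))|].
    + intros i Hi; replace s with (t0 + s - t0) at 2 by Rring; now apply G1.
    + apply Req_le; unfold K; clear; induction n as [|n IH]; cbn [vsum]; [Rring | rewrite IH; Rring].
  - assert (E : e * (2 * (K + 1)) = eps) by (unfold e; Rfield; lra). nra. }
apply is_derive_ext with (fun t => r t + (f x + vsum n (fun i => D i x * (v t i - x i)))).
- intros t; unfold r; Rring.
- fold x; replace (vsum n (fun i => D i x * dv i)) with (plus 0 (plus 0 (vsum n (fun i => D i x * dv i)))) by (unfold plus; cbn; Rring).
  apply (is_derive_plus r (fun t => f x + vsum n (fun i => D i x * (v t i - x i)))); [exact Er|].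
  apply (is_derive_plus (fun _ => f x) (fun t => vsum n (fun i => D i x * (v t i - x i)))); [|exact L].
  auto_derive; [exact I | reflexivity].
Qed.

Lemma continuous_contn {U : UniformSpace} n g (v : U -> nat -> R) u :
  contn n g -> (forall i, (i < n)%nat -> continuous (fun u => v u i) u) -> continuous (fun u => g (v u)) u.
Proof.
intros Hg Hv; apply filterlim_locally; intros eps.
destruct (Hg (v u) eps (cond_pos eps)) as [d [Hd H]].
generalize (locally_all_lt u n (fun i u' => Rabs (v u' i - v u i) < d)).
intros L; eapply filter_imp; [|apply L].
- intros u' Hu'; now apply H.
- intros i Hi; exact (proj1 (filterlim_locally _ _) (Hv i Hi) (mkposreal d Hd)).
Qed.

Lemma cts_contn {U : UniformSpace} n g (v : U -> nat -> R) :
  contn n g -> (forall i, (i < n)%nat -> cts (fun u => v u i)) -> cts (fun u => g (v u)).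
Proof. intros Hg Hv u; apply continuous_contn with n; [exact Hg | intros i Hi; now apply Hv]. Qed.

(** * Regularity of the bundle mass *)

Definition e1 := mkV 1 0 0.
Definition e2 := mkV 0 1 0.
Definition e3 := mkV 0 0 1.

(** For two orthogonal lines in one plane the squared cosines add up to 1, so M is a sum of two flag
    densities and inherits their regularity. The kernels are added after the cutoff, where the sum
    is 1 - z^(2n). *)
Lemma Mass_rho h x : plane_cts h -> Mass h x = rho h x e1 e3 + rho h x e2 e3.
Proof.
intros ch.
pose proof PI_RGT_0 as Hpi.
assert (u1 : unit_vec e1) by (unfold unit_vec, dot, e1; cbn [vx vy vz]; Rring).
assert (u2 : unit_vec e2) by (unfold unit_vec, dot, e2; cbn [vx vy vz]; Rring).
assert (u3 : unit_vec e3) by (unfold unit_vec, dot, e3; cbn [vx vy vz]; Rring).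
assert (o1 : dot e1 e3 = 0) by (unfold dot, e1, e3; cbn [vx vy vz]; Rring).
assert (o2 : dot e2 e3 = 0) by (unfold dot, e2, e3; cbn [vx vy vz]; Rring).
destruct (bounded4 (fun _ _ th ps => hx h x (sph_pt th ps)) 0 0 0 0 0 PI 0 (2 * PI)) as [B HB].
{ unfold cts4; ctsk. }
assert (HB' : forall th ps, 0 <= th <= PI -> 0 <= ps <= 2 * PI -> Rabs (hx h x (sph_pt th ps)) <= B).
{ intros; apply (HB 0 0); lra. }
apply eq_of_approx with 3; intros e He.
destruct (inv_sqrt_small (B * PI ^ 2) e He) as [N1 H1].
destruct (inv_affine_small (2 * PI * B) e He) as [N2 H2].
pose (n := (N1 + N2)%nat).
pose proof (rho_approx h x e1 e3 B n ch u1 u3 o1 HB') as A1.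
pose proof (rho_approx h x e2 e3 B n ch u2 u3 o2 HB') as A2.
specialize (H1 n ltac:(unfold n; lia)); specialize (H2 n ltac:(unfold n; lia)).
pose proof (sint_pow_hx_le (hx h x) B e3 n u3 ltac:(ctsk) HB') as A3.
assert (E : rho_n n h x e1 e3 + rho_n n h x e2 e3 = Mass h x - / 2 * sint (fun xi => dot e3 xi ^ (2 * n) * hx h x xi)).
{ unfold rho_n; rewrite Mass_eq by exact ch.
  rewrite <- Rmult_plus_distr_l, <- sint_plus, <- Rmult_minus_distr_l, <- sint_minus by ctsk.
  f_equal; apply sint_ext; intros xi Hxi.
  replace (dot e3 xi ^ (2 * n)) with (1 - (1 - dot e3 xi ^ 2) * geom n (dot e3 xi)) by (rewrite geom_mul; Rring).
  replace (1 - dot e3 xi ^ 2) with (dot e1 xi ^ 2 + dot e2 xi ^ 2); [Rring|].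
  rewrite <- (Hxi : dot xi xi = 1); unfold dot, e1, e2, e3; cbn [vx vy vz]; Rring. }
set (I := sint (fun xi => dot e3 xi ^ (2 * n) * hx h x xi)) in *.
replace (B * (4 * PI / (2 * INR n + 1))) with (2 * (2 * PI * B / (2 * INR n + 1))) in A3 by (Rfield; pose proof (pos_INR n); lra).
set (q := 2 * PI * B / (2 * INR n + 1)) in *; set (q' := B * PI ^ 2 / sqrt (2 * INR n + 1)) in *.
apply Rabs_le_between in A1, A2, A3; apply Rabs_le; lra.
Qed.

(** Padding with zeros makes this a point of the six-dimensional chart: a translation with zero
    Euler angles. *)
Definition vec3 (x : V3) : nat -> R :=
  fun i => match i with 0%nat => vx x | 1%nat => vy x | 2%nat => vz x | _ => 0 end.

Lemma rot3_0 u : rot3 0 0 0 u = u.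
Proof.
destruct u as [x y z]; unfold rot3, rotX, rotY, rotZ; cbn [vx vy vz]; rewrite cos_0, sin_0; f_equal; Rring.
Qed.

Lemma rho_chart_vec3 h u om x : rho h x u om = flag_chart_fun (rho h) (mkV 0 0 0) u om (vec3 x).
Proof.
unfold flag_chart_fun; cbn [vec3]; rewrite !rot3_0; f_equal.
destruct x as [x y z]; unfold vadd; cbn [vx vy vz]; f_equal; Rring.
Qed.

(** The translations of a chart based at the origin reach every point of space, so one family of
    partials serves globally. *)
Lemma Mass_C1 h : plane_cts h -> flag_C2 (rho h) ->
  exists D : nat -> (nat -> R) -> R,
    (forall i, (i < 3)%nat -> contn 6 (D i)) /\
    forall (x : R -> V3) dx t0, is_derive (fun t => vx (x t)) t0 (vx dx) -> is_derive (fun t => vy (x t)) t0 (vy dx) ->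
      is_derive (fun t => vz (x t)) t0 (vz dx) ->
      is_derive (fun t => Mass h (x t)) t0
        (D 0%nat (vec3 (x t0)) * vx dx + D 1%nat (vec3 (x t0)) * vy dx + D 2%nat (vec3 (x t0)) * vz dx).
Proof.
intros ch C2.
assert (F1 : is_flag (mkV 0 0 0) e1 e3) by (repeat split; unfold unit_vec, dot, e1, e3; cbn [vx vy vz]; Rring).
assert (F2 : is_flag (mkV 0 0 0) e2 e3) by (repeat split; unfold unit_vec, dot, e2, e3; cbn [vx vy vz]; Rring).
destruct (C2n_partials _ _ (C2 _ _ _ F1)) as [D1 H1].
destruct (C2n_partials _ _ (C2 _ _ _ F2)) as [D2 H2].
exists (fun i v => D1 i v + D2 i v); split.
- intros i Hi v eps Heps.
  destruct (proj1 (proj2 H1) i ltac:(lia) v (eps / 2) ltac:(lra)) as [d1 [Hd1 K1]].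
  destruct (proj1 (proj2 H2) i ltac:(lia) v (eps / 2) ltac:(lra)) as [d2 [Hd2 K2]].
  exists (Rmin d1 d2); split; [now apply Rmin_pos|]; intros y Hy.
  specialize (K1 y (fun j Hj => Rlt_le_trans _ _ _ (Hy j Hj) (Rmin_l _ _))).
  specialize (K2 y (fun j Hj => Rlt_le_trans _ _ _ (Hy j Hj) (Rmin_r _ _))).
  apply Rabs_def2 in K1, K2; apply Rabs_def1; lra.
- intros x dx t0 X Y Z.
  assert (V : forall i, (i < 6)%nat -> is_derive (fun t => vec3 (x t) i) t0 (vec3 dx i)).
  { intros i Hi; destruct i as [|[|[|i]]]; cbn [vec3]; try assumption.
    auto_derive; [exact I | reflexivity]. }
  apply is_derive_ext with (fun t => flag_chart_fun (rho h) (mkV 0 0 0) e1 e3 (vec3 (x t)) + flag_chart_fun (rho h) (mkV 0 0 0) e2 e3 (vec3 (x t))).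
  { intros t; rewrite Mass_rho by exact ch; rewrite <- !rho_chart_vec3; reflexivity. }
  pose proof (chain_rule 6 _ D1 (fun t => vec3 (x t)) (vec3 dx) t0 H1 V) as E1.
  pose proof (chain_rule 6 _ D2 (fun t => vec3 (x t)) (vec3 dx) t0 H2 V) as E2.
  pose proof (is_derive_plus _ _ _ _ _ E1 E2) as E.
  match goal with |- is_derive _ _ ?v => match type of E with is_derive _ _ ?v' => replace v with v' end end; [exact E|].
  unfold plus; cbn [vsum vec3]; cbn; Rring.
Qed.

(** The product rule for r M(r s) at r = 1 is where M and dM/dn come from together. *)
Lemma radial_Mass_derive a b c h : plane_cts h -> flag_C2 (rho h) ->
  exists G : R -> R -> R -> R,
    cts (fun q : (R * R) * R => G (fst (fst q)) (snd (fst q)) (snd q)) /\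
    (forall r nu ph, is_derive (fun r => r * Mass h (vscal r (disc_pt a b c nu ph))) r (G r nu ph)) /\
    (forall nu ph, G 1 nu ph = Mass h (disc_pt a b c nu ph) + dMdn h (disc_pt a b c nu ph)).
Proof.
intros ch C2.
destruct (Mass_C1 h ch C2) as [D [cD HD]].
pose (g := fun r s => D 0%nat (vec3 (vscal r s)) * vx s + D 1%nat (vec3 (vscal r s)) * vy s + D 2%nat (vec3 (vscal r s)) * vz s).
assert (Hg : forall r s, is_derive (fun r => Mass h (vscal r s)) r (g r s)).
{ intros r s; apply (HD (fun r => vscal r s) s r); unfold vscal; cbn [vx vy vz]; auto_derive; auto; Rring. }
exists (fun r nu ph => Mass h (vscal r (disc_pt a b c nu ph)) + r * g r (disc_pt a b c nu ph)).
assert (cV : ctsV (fun q : (R * R) * R => vscal (fst (fst q)) (disc_pt a b c (snd (fst q)) (snd q)))).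
{ split; [|split]; unfold disc_pt, vadd, vscal; cbn [vx vy vz]; ctsk. }
split; [|split].
- apply cts_plus; [now apply cts_Mass|].
  apply cts_mult; [cts|]; unfold g.
  assert (P : forall i, (i < 3)%nat -> cts (fun q : (R * R) * R => D i (vec3 (vscal (fst (fst q)) (disc_pt a b c (snd (fst q)) (snd q)))))).
  { intros i Hi; apply (cts_contn 6 (D i)); [now apply cD|].
    destruct cV as [c1 [c2 c3]]; intros j _; destruct j as [|[|[|j]]]; cbn [vec3]; assumption || apply cts_const. }
  assert (W : ctsV (fun q : (R * R) * R => disc_pt a b c (snd (fst q)) (snd q))) by ctsk.
  destruct W as [w1 [w2 w3]].
  apply cts_plus; [apply cts_plus|]; apply cts_mult; auto.
- intros r nu ph.
  pose proof (Hg r (disc_pt a b c nu ph)) as H.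
  exact (is_derive_id_mul _ _ _ H).
- intros nu ph; set (s := disc_pt a b c nu ph).
  replace (vscal 1 s) with s by (destruct s as [x y z]; unfold vscal; cbn [vx vy vz]; f_equal; Rring).
  f_equal; rewrite Rmult_1_l; symmetry; unfold dMdn; apply Deriv_eq.
  apply is_derive_ext with (fun t => Mass h (vscal (t + 1) s)).
  { intros t; f_equal; destruct s as [x y z]; unfold vscal, vadd; cbn [vx vy vz]; f_equal; Rring. }
  replace (g 1 s) with (g (0 + 1) s) by (f_equal; Rring).
  unfold g; apply (HD (fun t => vscal (t + 1) s) s 0); unfold vscal; cbn [vx vy vz]; auto_derive; auto; apply Rmult_1_l.
Qed.

(** * Tangent flags in the Euler chart *)

(** T, n, l are the axes x1, x2, x3 of a flag with line T and normal l: a left triad, hence n = T x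
    l. *)
Record frame3 (T n l : V3) : Prop := Frame3 {
  frame_T : dot T T = 1; frame_l : dot l l = 1; frame_Tl : dot T l = 0; frame_n : n = cross T l }.

Lemma V3_eq u v : vx u = vx v -> vy u = vy v -> vz u = vz v -> u = v.
Proof. destruct u, v; cbn; congruence. Qed.

Lemma cross_cross u v : cross u (cross v u) = vadd (vscal (dot u u) v) (vscal (- dot u v) u).
Proof. apply V3_eq; unfold cross, dot, vadd, vscal; cbn [vx vy vz]; ring. Qed.

Lemma cross_anti u v : cross u v = vscal (-1) (cross v u).
Proof. apply V3_eq; unfold cross, vscal; cbn [vx vy vz]; ring. Qed.

Lemma frame_cross T n l : frame3 T n l -> cross l n = T /\ cross n T = l.
Proof.
intros [H1 H2 H3 H4]; rewrite H4; split.
- rewrite cross_cross, H2, dot_comm, H3; apply V3_eq; unfold vadd, vscal; cbn [vx vy vz]; ring.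
- rewrite cross_anti, (cross_anti T l).
  replace (cross T (vscal (-1) (cross l T))) with (vscal (-1) (cross T (cross l T)))
    by (apply V3_eq; unfold cross, vscal; cbn [vx vy vz]; ring).
  rewrite cross_cross, H1, H3; apply V3_eq; unfold vadd, vscal; cbn [vx vy vz]; ring.
Qed.

Lemma frame_complete T n l : frame3 T n l ->
  (vx T * vx T + vx n * vx n + vx l * vx l = 1 /\ vy T * vy T + vy n * vy n + vy l * vy l = 1 /\ vz T * vz T + vz n * vz n + vz l * vz l = 1) /\
  (vx T * vy T + vx n * vy n + vx l * vy l = 0 /\ vx T * vz T + vx n * vz n + vx l * vz l = 0 /\ vy T * vz T + vy n * vz n + vy l * vz l = 0).
Proof.
intros [H1 H2 H3 H4]; rewrite H4.
set (p := dot T T * dot l l - dot T l ^ 2).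
assert (Hp : p = 1) by (unfold p; rewrite H1, H2, H3; ring).
(* The expression collects the defects in the Gram relations of T and l; adding it turns each claim
   into a polynomial identity. *)
assert (Q : forall ti li tj lj, (1 - dot l l) * ti * tj + (1 - dot T T) * li * lj + dot T l * (ti * lj + li * tj) = 0).
{ intros; rewrite H1, H2, H3; ring. }
repeat split.
- rewrite <- Hp, <- (Rplus_0_r p), <- (Q (vx T) (vx l) (vx T) (vx l)); unfold p, dot, cross; cbn [vx vy vz]; ring.
- rewrite <- Hp, <- (Rplus_0_r p), <- (Q (vy T) (vy l) (vy T) (vy l)); unfold p, dot, cross; cbn [vx vy vz]; ring.
- rewrite <- Hp, <- (Rplus_0_r p), <- (Q (vz T) (vz l) (vz T) (vz l)); unfold p, dot, cross; cbn [vx vy vz]; ring.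
- rewrite <- (Q (vx T) (vx l) (vy T) (vy l)); unfold dot, cross; cbn [vx vy vz]; ring.
- rewrite <- (Q (vx T) (vx l) (vz T) (vz l)); unfold dot, cross; cbn [vx vy vz]; ring.
- rewrite <- (Q (vy T) (vy l) (vz T) (vz l)); unfold dot, cross; cbn [vx vy vz]; ring.
Qed.

Lemma frame_dots_n T n l : frame3 T n l -> dot n T = 0 /\ dot n l = 0.
Proof. intros [_ _ _ ->]; split; unfold dot, cross; cbn [vx vy vz]; ring. Qed.

Lemma cos_atan_div f g : 0 < g -> cos (atan (f / g)) = g / sqrt (f ^ 2 + g ^ 2) /\ sin (atan (f / g)) = f / sqrt (f ^ 2 + g ^ 2).
Proof.
intros Hg.
pose proof (pow2_ge_0 f).
assert (Hs : 0 < sqrt (f ^ 2 + g ^ 2)) by (apply sqrt_lt_R0; nra).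
assert (E : sqrt (1 + (f / g)²) = sqrt (f ^ 2 + g ^ 2) / g).
{ apply sqrt_lem_1.
  - pose proof (Rle_0_sqr (f / g)); lra.
  - apply Rlt_le, Rdiv_lt_0_compat; assumption.
  - transitivity (sqrt (f ^ 2 + g ^ 2) * sqrt (f ^ 2 + g ^ 2) / (g * g)); [field; lra|].
    rewrite sqrt_sqrt by nra; unfold Rsqr; field; lra. }
rewrite cos_atan, sin_atan, E; split; field; lra.
Qed.

(** For the matrix r of [rot3 a b c]: r13 = sin b, r23 / r33 = - tan a and r12 / r11 = - tan c.
    These two functions read the angles off; [ang_sin] is the arcsine. *)
Definition ang_ratio (f g : R) : R := atan (- f / g).
Definition ang_sin (f : R) : R := atan (f / sqrt (1 - f ^ 2)).

(** The angles reproduce the first row and the third column directly. The other four entries times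
    q^2, with q the cosine of the middle angle, follow from orthogonality of the columns and two
    cofactor relations that fix the orientation. *)
Lemma euler_angles r11 r12 r13 r21 r22 r23 r31 r32 r33 v :
  r11 * r11 + r12 * r12 + r13 * r13 = 1 -> r13 * r13 + r23 * r23 + r33 * r33 = 1 ->
  r11 * r13 + r21 * r23 + r31 * r33 = 0 -> r12 * r13 + r22 * r23 + r32 * r33 = 0 ->
  r12 = r23 * r31 - r33 * r21 -> r11 = r22 * r33 - r32 * r23 ->
  0 < r11 -> 0 < r33 -> r13 ^ 2 < 1 ->
  rot3 (ang_ratio r23 r33) (ang_sin r13) (ang_ratio r12 r11) v
  = mkV (r11 * vx v + r12 * vy v + r13 * vz v) (r21 * vx v + r22 * vy v + r23 * vz v) (r31 * vx v + r32 * vy v + r33 * vz v).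
Proof.
intros E1 E2 E3 E4 E5 E6 P1 P3 P.
set (q := sqrt (1 - r13 ^ 2)).
assert (Hq : 0 < q) by (apply sqrt_lt_R0; lra).
assert (Hqq : q * q = 1 - r13 ^ 2) by (apply sqrt_sqrt; lra).
destruct (cos_atan_div (- r23) r33 P3) as [cA sA].
destruct (cos_atan_div (- r12) r11 P1) as [cC sC].
destruct (cos_atan_div r13 q Hq) as [cB sB].
replace (sqrt ((- r23) ^ 2 + r33 ^ 2)) with q in cA, sA by (unfold q; f_equal; lra).
replace (sqrt ((- r12) ^ 2 + r11 ^ 2)) with q in cC, sC by (unfold q; f_equal; lra).
replace (sqrt (r13 ^ 2 + q ^ 2)) with 1 in cB, sB.
2:{ replace (r13 ^ 2 + q ^ 2) with 1 by (simpl (q ^ 2); rewrite Rmult_1_r, Hqq; ring); symmetry; apply sqrt_1. }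
unfold rot3, rotX, rotY, rotZ, ang_ratio, ang_sin; fold q; cbn [vx vy vz].
rewrite cA, sA, cC, sC, cB, sB.
assert (Q21 : - (r33 * r12 + r23 * r13 * r11) = r21 * (q * q)).
{ replace (q * q) with (r23 * r23 + r33 * r33) by (rewrite Hqq; lra).
  transitivity (- r33 * (r23 * r31 - r33 * r21) + r23 * (r21 * r23 + r31 * r33) - r23 * (r11 * r13 + r21 * r23 + r31 * r33));
  [rewrite <- E5; ring | rewrite E3; ring]. }
assert (Q22 : r33 * r11 - r23 * r13 * r12 = r22 * (q * q)).
{ replace (q * q) with (r23 * r23 + r33 * r33) by (rewrite Hqq; lra).
  transitivity (r33 * (r22 * r33 - r32 * r23) + r23 * (r22 * r23 + r32 * r33) - r23 * (r12 * r13 + r22 * r23 + r32 * r33));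
  [rewrite <- E6; ring | rewrite E4; ring]. }
assert (Q31 : r23 * r12 - r33 * r13 * r11 = r31 * (q * q)).
{ replace (q * q) with (r23 * r23 + r33 * r33) by (rewrite Hqq; lra).
  transitivity (r23 * (r23 * r31 - r33 * r21) + r33 * (r21 * r23 + r31 * r33) - r33 * (r11 * r13 + r21 * r23 + r31 * r33));
  [rewrite <- E5; ring | rewrite E3; ring]. }
assert (Q32 : - (r23 * r11) - r33 * r13 * r12 = r32 * (q * q)).
{ replace (q * q) with (r23 * r23 + r33 * r33) by (rewrite Hqq; lra).
  transitivity (- r23 * (r22 * r33 - r32 * r23) + r33 * (r22 * r23 + r32 * r33) - r33 * (r12 * r13 + r22 * r23 + r32 * r33));
  [rewrite <- E6; ring | rewrite E4; ring]. }
assert (D : forall s t, s = t * (q * q) -> t = s / (q * q)) by (intros s t ->; field; lra).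
rewrite (D _ _ Q21), (D _ _ Q22), (D _ _ Q31), (D _ _ Q32).
apply V3_eq; cbn [vx vy vz]; field; lra.
Qed.

(** An entry of the matrix that carries the frame (T0, n0, l0) to (T, n, l), the coordinate
    functions [pi] and [pj] selecting its row and column. *)
Definition rcoef (T n l T0 n0 l0 : V3) (pi pj : V3 -> R) : R := pi T * pj T0 + pi n * pj n0 + pi l * pj l0.

Lemma euler_frames T n l T0 n0 l0 : frame3 T n l -> frame3 T0 n0 l0 ->
  let r := rcoef T n l T0 n0 l0 in
  0 < r vx vx -> 0 < r vz vz -> r vx vz ^ 2 < 1 ->
  rot3 (ang_ratio (r vy vz) (r vz vz)) (ang_sin (r vx vz)) (ang_ratio (r vx vy) (r vx vx)) T0 = T /\
  rot3 (ang_ratio (r vy vz) (r vz vz)) (ang_sin (r vx vz)) (ang_ratio (r vx vy) (r vx vx)) l0 = l.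
Proof.
intros F F0 r P1 P3 P.
destruct (frame_complete _ _ _ F) as [[C1 [C2 C3]] [C4 [C5 C6]]].
destruct (frame_complete _ _ _ F0) as [[K1 [K2 K3]] [K4 [K5 K6]]].
destruct (frame_cross _ _ _ F) as [X1 X2]; destruct (frame_cross _ _ _ F0) as [Y1 Y2].
destruct (frame_dots_n _ _ _ F) as [N1 N2]; destruct (frame_dots_n _ _ _ F0) as [M1 M2].
destruct F as [H1 H2 H3 H4]; destruct F0 as [G1 G2 G3 G4].
assert (nn : dot n n = 1).
{ transitivity (dot T T * dot l l - dot T l ^ 2); [rewrite H4; unfold dot, cross; cbn [vx vy vz]; ring | rewrite H1, H2, H3; ring]. }
assert (nn0 : dot n0 n0 = 1).
{ transitivity (dot T0 T0 * dot l0 l0 - dot T0 l0 ^ 2); [rewrite G4; unfold dot, cross; cbn [vx vy vz]; ring | rewrite G1, G2, G3; ring]. }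
(* The columns of [r] have the Gram matrix of the rows of the old frame, its rows that of the new one. *)
assert (Col : forall p p' : V3 -> R, r vx p * r vx p' + r vy p * r vy p' + r vz p * r vz p' = p T0 * p' T0 + p n0 * p' n0 + p l0 * p' l0).
{ intros p p'; unfold r, rcoef.
  transitivity (dot T T * (p T0 * p' T0) + dot n n * (p n0 * p' n0) + dot l l * (p l0 * p' l0)
    + dot n T * (p T0 * p' n0 + p n0 * p' T0) + dot T l * (p T0 * p' l0 + p l0 * p' T0) + dot n l * (p n0 * p' l0 + p l0 * p' n0)).
  - unfold dot; ring.
  - rewrite H1, nn, H2, N1, H3, N2; ring. }
assert (Row : forall p p' : V3 -> R, r p vx * r p' vx + r p vy * r p' vy + r p vz * r p' vz = p T * p' T + p n * p' n + p l * p' l).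
{ intros p p'; unfold r, rcoef.
  transitivity (dot T0 T0 * (p T * p' T) + dot n0 n0 * (p n * p' n) + dot l0 l0 * (p l * p' l)
    + dot n0 T0 * (p T * p' n + p n * p' T) + dot T0 l0 * (p T * p' l + p l * p' T) + dot n0 l0 * (p n * p' l + p l * p' n)).
  - unfold dot; ring.
  - rewrite G1, nn0, G2, M1, G3, M2; ring. }
(* Each frame vector is the cross product of the other two, with the same orientation in both
   frames; so the matrix equals its cofactor matrix. *)
assert (E5 : r vx vy = r vy vz * r vz vx - r vz vz * r vy vx).
{ transitivity (vx (cross l n) * vy (cross l0 n0) + vx (cross T l) * vy (cross T0 l0) + vx (cross n T) * vy (cross n0 T0)).
  - rewrite X1, X2, Y1, Y2, <- H4, <- G4; reflexivity.
  - unfold r, rcoef, cross; cbn [vx vy vz]; ring. }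
assert (E6 : r vx vx = r vy vy * r vz vz - r vz vy * r vy vz).
{ transitivity (vx (cross l n) * vx (cross l0 n0) + vx (cross T l) * vx (cross T0 l0) + vx (cross n T) * vx (cross n0 T0)).
  - rewrite X1, X2, Y1, Y2, <- H4, <- G4; reflexivity.
  - unfold r, rcoef, cross; cbn [vx vy vz]; ring. }
assert (A : forall v, rot3 (ang_ratio (r vy vz) (r vz vz)) (ang_sin (r vx vz)) (ang_ratio (r vx vy) (r vx vx)) v
   = vadd (vscal (dot T0 v) T) (vadd (vscal (dot n0 v) n) (vscal (dot l0 v) l))).
{ intros v.
  rewrite (euler_angles (r vx vx) (r vx vy) (r vx vz) (r vy vx) (r vy vy) (r vy vz) (r vz vx) (r vz vy) (r vz vz)); try assumption.
  - apply V3_eq; unfold r, rcoef, vadd, vscal, dot; cbn [vx vy vz]; ring.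
  - rewrite Row; exact C1.
  - rewrite Col; exact K3.
  - rewrite Col; exact K5.
  - rewrite Col; exact K6. }
rewrite !A, G1, G2, G3, M1, M2, (dot_comm l0 T0), G3.
split; apply V3_eq; unfold vadd, vscal; cbn [vx vy vz]; ring.
Qed.

Lemma ang_ratio_derive (f g : R -> R) (t df dg : R) : is_derive f t df -> is_derive g t dg -> g t <> 0 ->
  is_derive (fun t => ang_ratio (f t) (g t)) t ((f t * dg - df * g t) / (f t ^ 2 + g t ^ 2)).
Proof.
intros Hf Hg N; unfold ang_ratio.
assert (f t ^ 2 + g t ^ 2 <> 0) by (pose proof (pow2_ge_0 (f t)); pose proof (pow2_gt_0 (g t) N); lra).
auto_derive.
- repeat split; [exact (ex_intro _ _ Hf) | exact (ex_intro _ _ Hg) | exact N].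
- replace (Derive (fun t => f t) t) with df by (symmetry; apply is_derive_unique, Hf).
  replace (Derive (fun t => g t) t) with dg by (symmetry; apply is_derive_unique, Hg).
  field; repeat split; assumption.
Qed.

Lemma ang_sin_derive (f : R -> R) (t df : R) : is_derive f t df -> f t ^ 2 < 1 ->
  is_derive (fun t => ang_sin (f t)) t (df / sqrt (1 - f t ^ 2)).
Proof.
intros Hf N; unfold ang_sin.
assert (Hs : 0 < sqrt (1 - f t ^ 2)) by (apply sqrt_lt_R0; lra).
assert (Hss : sqrt (1 - f t ^ 2) * sqrt (1 - f t ^ 2) = 1 - f t ^ 2) by (apply sqrt_sqrt; lra).
assert (D1 : is_derive (fun t => sqrt (1 - f t ^ 2)) t (- (f t * df) / sqrt (1 - f t ^ 2))).
{ auto_derive.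
  - repeat split; [exact (ex_intro _ _ Hf) | simpl in N; lra].
  - replace (Derive (fun t => f t) t) with df by (symmetry; apply is_derive_unique, Hf).
    replace (1 + - (f t * (f t * 1))) with (1 - f t ^ 2) by ring. simpl (f t ^ 1). field; lra. }
set (s := fun t => sqrt (1 - f t ^ 2)) in *.
change (0 < s t) in Hs; change (s t * s t = 1 - f t ^ 2) in Hss.
change (is_derive (fun t => atan (f t / s t)) t (df / s t)).
change (is_derive s t (- (f t * df) / s t)) in D1.
auto_derive.
- repeat split; [exact (ex_intro _ _ Hf) | exact (ex_intro _ _ D1) | lra].
- replace (Derive (fun t => f t) t) with df by (symmetry; apply is_derive_unique, Hf).
  replace (Derive (fun t => s t) t) with (- (f t * df) / s t) by (symmetry; apply is_derive_unique, D1).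
  assert (E : s t * s t + f t * f t = 1) by (rewrite Hss; ring).
  assert (Es : 1 + f t * / s t * (f t * / s t * 1) = / (s t * s t)).
  { transitivity ((s t * s t + f t * f t) / (s t * s t)); [field; lra | rewrite E; field; lra]. }
  rewrite Es.
  transitivity (df * (s t * s t + f t * f t) / s t); [field; lra | rewrite E; field; lra].
Qed.

Lemma continuous_Rdiv {U : UniformSpace} (f g : U -> R) u :
  continuous f u -> continuous g u -> g u <> 0 -> continuous (fun u => f u / g u) u.
Proof.
intros Hf Hg N; apply continuous_Rmult; [exact Hf|].
apply continuous_R_comp with (phi := Rinv); [auto_derive; exact N | exact Hg].
Qed.

Lemma locally_pos {U : UniformSpace} (f : U -> R) u : continuous f u -> 0 < f u -> locally u (fun u => 0 < f u).
Proof.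
intros Hf P; generalize (proj1 (filterlim_locally _ _) Hf (mkposreal _ P)).
apply filter_imp; intros u' H; change (Rabs (f u' - f u) < f u) in H; apply Rabs_def2 in H; lra.
Qed.

Lemma ang_ratio_continuous {U : UniformSpace} (f g : U -> R) u :
  continuous f u -> continuous g u -> g u <> 0 -> continuous (fun u => ang_ratio (f u) (g u)) u.
Proof.
intros Hf Hg N; unfold ang_ratio; apply continuous_R_comp with (phi := atan); [auto_derive; exact I|].
apply continuous_Rdiv; [exact (continuous_opp f u Hf) | exact Hg | exact N].
Qed.

Lemma sqrt_1_sq_continuous {U : UniformSpace} (f : U -> R) u :
  continuous f u -> f u ^ 2 < 1 -> continuous (fun u => sqrt (1 - f u ^ 2)) u.
Proof.
intros Hf N; apply continuous_R_comp with (phi := fun t => sqrt (1 - t ^ 2)); [|exact Hf].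
auto_derive; simpl in N; lra.
Qed.

Lemma ang_sin_continuous {U : UniformSpace} (f : U -> R) u :
  continuous f u -> f u ^ 2 < 1 -> continuous (fun u => ang_sin (f u)) u.
Proof.
intros Hf N; unfold ang_sin; apply continuous_R_comp with (phi := atan); [auto_derive; exact I|].
apply continuous_Rdiv; [exact Hf | now apply sqrt_1_sq_continuous |].
apply Rgt_not_eq, sqrt_lt_R0; lra.
Qed.

Lemma vsum_continuous {U : UniformSpace} n (g : U -> nat -> R) u :
  (forall i, (i < n)%nat -> continuous (fun u => g u i) u) -> continuous (fun u => vsum n (g u)) u.
Proof.
induction n as [|n IH]; intros H; cbn [vsum]; [apply continuous_const|].
apply (continuous_plus (fun u => vsum n (g u)) (fun u => g u n)); [apply IH; intros; apply H; lia | apply H; lia].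
Qed.

Lemma vsum_ext n f g : (forall i, (i < n)%nat -> f i = g i) -> vsum n f = vsum n g.
Proof. induction n as [|n IH]; intros H; cbn [vsum]; [reflexivity|]; rewrite IH, H by (intros; auto with arith); reflexivity. Qed.

Lemma vsum_plus n f g : vsum n f + vsum n g = vsum n (fun i => f i + g i).
Proof. induction n as [|n IH]; cbn [vsum]; [ring | rewrite <- IH; ring]. Qed.

Lemma is_derive_shift (q : R -> R) (al d : R) : is_derive q al d -> is_derive (fun t => q (t + al)) 0 d.
Proof.
intros H; rewrite <- (Rplus_0_l al) in H.
assert (D : is_derive (fun t => t + al) 0 1) by (auto_derive; [exact I | reflexivity]).
pose proof (is_derive_comp q (fun t => t + al) 0 d 1 H D) as E.
replace d with (scal 1 d) by (unfold scal; cbn; unfold mult; cbn; Rring); exact E.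
Qed.

Section Frame.
Variables a b c : V3.
Hypothesis Ha : unit_vec a.
Hypothesis Hb : unit_vec b.
Hypothesis Hab : dot a b = 0.
Hypothesis Hc : c = cross a b.

Let l := disc_pt a b c.
Let T := bd_tan a b.
(** The derivative of [disc_pt] in [nu]: the unit conormal of the parallel circle, pointing away
    from the cap. *)
Definition bd_normal (nu ph : R) : V3 :=
  vadd (vscal (cos nu) (vadd (vscal (cos ph) a) (vscal (sin ph) b))) (vscal (- sin nu) c).
Let n := bd_normal.

(** This fixes the signs of the theorem: with the cap on the left, x2 points outward, so both flag
    derivatives go in the direction of growing [nu]. *)
Lemma tangent_flag_x2 nu ph : flag_x2 (T ph) (l nu ph) = n nu ph.
Proof.
assert (E1 : cross b c = a).
{ rewrite Hc, cross_cross, (Hb : dot b b = 1), (dot_comm b a), Hab; apply V3_eq; unfold vadd, vscal; cbn [vx vy vz]; ring. }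
assert (E2 : cross a c = vscal (-1) b).
{ rewrite Hc, (cross_anti a b).
  replace (cross a (vscal (-1) (cross b a))) with (vscal (-1) (cross a (cross b a)))
    by (apply V3_eq; unfold cross, vscal; cbn [vx vy vz]; ring).
  rewrite cross_cross, (Ha : dot a a = 1), Hab; apply V3_eq; unfold vadd, vscal; cbn [vx vy vz]; ring. }
assert (S : (sin ph)² + (cos ph)² = 1) by apply sin2_cos2; unfold Rsqr in S.
transitivity (vadd (vscal (- sin nu * (sin ph * sin ph + cos ph * cos ph)) (cross a b))
   (vadd (vscal (- sin ph * cos nu) (cross a c)) (vscal (cos ph * cos nu) (cross b c)))).
- apply V3_eq; unfold flag_x2, T, l, bd_tan, disc_pt, vadd, vscal, cross; cbn [vx vy vz]; ring.
- rewrite E1, E2, <- Hc, S; apply V3_eq; unfold n, bd_normal, vadd, vscal; cbn [vx vy vz]; ring.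
Qed.

Lemma tangent_frame nu ph : frame3 (T ph) (n nu ph) (l nu ph).
Proof.
split; [now apply unit_T | now apply unit_l | now apply dot_T_l | symmetry; apply tangent_flag_x2].
Qed.

Lemma ctsV_bd_normal {U : UniformSpace} (f g : U -> R) : cts f -> cts g -> ctsV (fun u => n (f u) (g u)).
Proof. intros Hf Hg; split; [|split]; unfold n, bd_normal, vadd, vscal; cbn [vx vy vz]; cts. Qed.

(** Turning the plane about its line by t gives the normal of the tangent flag at latitude nu +
    t. *)
Lemma disc_pt_rotate nu ph t : vadd (vscal (cos t) (l nu ph)) (vscal (sin t) (n nu ph)) = l (t + nu) ph.
Proof.
apply V3_eq; unfold l, n, disc_pt, bd_normal, vadd, vscal; cbn [vx vy vz]; rewrite sin_plus, cos_plus; ring.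
Qed.

Section Base.
Variables nu0 ph0 : R.

Let r (p : R * R) (q q' : V3 -> R) : R :=
  rcoef (T (snd p)) (n (fst p) (snd p)) (l (fst p) (snd p)) (T ph0) (n nu0 ph0) (l nu0 ph0) q q'.
(** The derivative of [r] in the latitude, from dn = -l and dl = n; T does not depend on the
    latitude. *)
Let dr (p : R * R) (q q' : V3 -> R) : R :=
  - q (l (fst p) (snd p)) * q' (n nu0 ph0) + q (n (fst p) (snd p)) * q' (l nu0 ph0).

Definition is_coord (q : V3 -> R) : Prop := q = vx \/ q = vy \/ q = vz.

Lemma rcoef_derive t ph q q' : is_coord q -> is_derive (fun t => r (t, ph) q q') t (dr (t, ph) q q').
Proof.
intros Hq; unfold r, dr, rcoef; cbn [fst snd].
destruct Hq as [->|[->| ->]]; unfold l, n, T, disc_pt, bd_tan, bd_normal, vadd, vscal; cbn [vx vy vz];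
  auto_derive; try exact I; ring.
Qed.

Lemma rcoef_cts q q' : is_coord q -> cts (fun p => r p q q').
Proof.
intros Hq; unfold r, rcoef.
destruct Hq as [->|[->| ->]]; unfold l, n, T, disc_pt, bd_tan, bd_normal, vadd, vscal; cbn [vx vy vz]; cts.
Qed.

Lemma drcoef_cts q q' : is_coord q -> cts (fun p => dr p q q').
Proof.
intros Hq; unfold dr.
destruct Hq as [->|[->| ->]]; unfold l, n, T, disc_pt, bd_tan, bd_normal, vadd, vscal; cbn [vx vy vz]; cts.
Qed.

(** The open region where the angle formulas hold; at the base point the matrix is the identity. *)
Let good (p : R * R) : Prop := 0 < r p vx vx /\ 0 < r p vz vz /\ 0 < 1 - r p vx vz ^ 2.

Lemma good_locally : locally ((nu0, ph0) : R * R) good.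
Proof.
destruct (frame_complete _ _ _ (tangent_frame nu0 ph0)) as [[C1 [C2 C3]] [C4 [C5 C6]]].
assert (X : is_coord vx) by now left.
assert (Z : is_coord vz) by now right; right.
pose proof (rcoef_cts vx vx X) as c1; pose proof (rcoef_cts vz vz Z) as c2; pose proof (rcoef_cts vx vz X) as c3.
apply filter_and; [|apply filter_and].
- apply (locally_pos (fun p => r p vx vx)); [apply c1|].
  unfold r, rcoef; cbn [fst snd]; rewrite C1; lra.
- apply (locally_pos (fun p => r p vz vz)); [apply c2|].
  unfold r, rcoef; cbn [fst snd]; rewrite C3; lra.
- apply (locally_pos (fun p => 1 - r p vx vz ^ 2)).
  + assert (C : cts (fun p => 1 - r p vx vz ^ 2)) by cts; apply C.
  + unfold r, rcoef; cbn [fst snd]; rewrite C5; lra.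
Qed.

Let ang (p : R * R) (i : nat) : R :=
  match i with
  | 3%nat => ang_ratio (r p vy vz) (r p vz vz)
  | 4%nat => ang_sin (r p vx vz)
  | 5%nat => ang_ratio (r p vx vy) (r p vx vx)
  | _ => 0 end.
Let dang (p : R * R) (i : nat) : R :=
  match i with
  | 3%nat => (r p vy vz * dr p vz vz - dr p vy vz * r p vz vz) / (r p vy vz ^ 2 + r p vz vz ^ 2)
  | 4%nat => dr p vx vz / sqrt (1 - r p vx vz ^ 2)
  | 5%nat => (r p vx vy * dr p vx vx - dr p vx vy * r p vx vx) / (r p vx vy ^ 2 + r p vx vx ^ 2)
  | _ => 0 end.
(** Location [x] and frame parameter [p] are kept independent, since rotation moves only the frame
    and translation only the location. *)
Let coords (x : V3) (p : R * R) (i : nat) : R := vec3 x i + ang p i.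

Lemma coords_chart F x p : good p ->
  F x (T (snd p)) (l (fst p) (snd p)) = flag_chart_fun F (mkV 0 0 0) (T ph0) (l nu0 ph0) (coords x p).
Proof.
intros [G1 [G2 G3]].
destruct (euler_frames _ _ _ _ _ _ (tangent_frame (fst p) (snd p)) (tangent_frame nu0 ph0)) as [E1 E2];
  [exact G1 | exact G2 | fold (r p vx vz); lra |].
unfold flag_chart_fun, coords; cbn [vec3 ang]; rewrite !Rplus_0_l.
unfold r; rewrite E1, E2; f_equal.
apply V3_eq; unfold vadd; cbn [vx vy vz]; ring.
Qed.

Lemma ang_derive t ph i : good (t, ph) -> is_derive (fun t => ang (t, ph) i) t (dang (t, ph) i).
Proof.
intros [G1 [G2 G3]].
destruct i as [|[|[|[|[|[|i]]]]]]; cbn [ang dang];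
  try (apply (is_derive_const (K := R_AbsRing) (V := R_NormedModule) 0)).
- apply (ang_ratio_derive (fun t => r (t, ph) vy vz) (fun t => r (t, ph) vz vz)); try apply rcoef_derive; unfold is_coord; auto; lra.
- apply (ang_sin_derive (fun t => r (t, ph) vx vz)); [apply rcoef_derive; unfold is_coord; auto | lra].
- apply (ang_ratio_derive (fun t => r (t, ph) vx vy) (fun t => r (t, ph) vx vx)); try apply rcoef_derive; unfold is_coord; auto; lra.
Qed.

Lemma ang_continuous p i : good p -> continuous (fun p => ang p i) p.
Proof.
intros [G1 [G2 G3]].
destruct i as [|[|[|[|[|[|i]]]]]]; cbn [ang]; try apply continuous_const.
- apply ang_ratio_continuous; try apply rcoef_cts; unfold is_coord; auto; lra.
- apply ang_sin_continuous; try apply rcoef_cts; unfold is_coord; auto; lra.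
- apply ang_ratio_continuous; try apply rcoef_cts; unfold is_coord; auto; lra.
Qed.

Lemma dang_continuous p i : good p -> continuous (fun p => dang p i) p.
Proof.
intros [G1 [G2 G3]].
assert (X : is_coord vx) by now left.
assert (Y : is_coord vy) by now right; left.
assert (Z : is_coord vz) by now right; right.
pose proof (rcoef_cts vx vx X); pose proof (rcoef_cts vx vy X); pose proof (rcoef_cts vx vz X).
pose proof (rcoef_cts vy vz Y); pose proof (rcoef_cts vz vz Z).
pose proof (drcoef_cts vx vx X); pose proof (drcoef_cts vx vy X); pose proof (drcoef_cts vx vz X).
pose proof (drcoef_cts vy vz Y); pose proof (drcoef_cts vz vz Z).
destruct i as [|[|[|[|[|[|i]]]]]]; cbn [dang]; try apply continuous_const.
- apply (continuous_Rdiv (fun p => r p vy vz * dr p vz vz - dr p vy vz * r p vz vz) (fun p => r p vy vz ^ 2 + r p vz vz ^ 2)).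
  + assert (C : cts (fun p => r p vy vz * dr p vz vz - dr p vy vz * r p vz vz)) by cts; apply C.
  + assert (C : cts (fun p => r p vy vz ^ 2 + r p vz vz ^ 2)) by cts; apply C.
  + pose proof (pow2_ge_0 (r p vy vz)); nra.
- apply (continuous_Rdiv (fun p => dr p vx vz) (fun p => sqrt (1 - r p vx vz ^ 2))); [auto | apply sqrt_1_sq_continuous; [auto | lra] |].
  apply Rgt_not_eq, sqrt_lt_R0; lra.
- apply (continuous_Rdiv (fun p => r p vx vy * dr p vx vx - dr p vx vy * r p vx vx) (fun p => r p vx vy ^ 2 + r p vx vx ^ 2)).
  + assert (C : cts (fun p => r p vx vy * dr p vx vx - dr p vx vy * r p vx vx)) by cts; apply C.
  + assert (C : cts (fun p => r p vx vy ^ 2 + r p vx vx ^ 2)) by cts; apply C.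
  + pose proof (pow2_ge_0 (r p vx vy)); nra.
Qed.

(** Regularity is given on flags only, so the moving flag is read in the chart at a base flag. There
    rotation changes the angles, translation the location and motion along the meridian both; one
    set of partials thus yields all three derivatives, the last as a sum. The chart being local, so
    is the conclusion. *)
Lemma tangent_flag_derivatives h : flag_C2 (rho h) ->
  exists GP GY : R * R -> R,
    continuous GP (nu0, ph0) /\ continuous GY (nu0, ph0) /\
    continuous (fun p : R * R => rho h (l (fst p) (snd p)) (T (snd p)) (l (fst p) (snd p))) (nu0, ph0) /\
    locally ((nu0, ph0) : R * R) (fun p =>
      rhoPhi h (l (fst p) (snd p)) (T (snd p)) (l (fst p) (snd p)) = GP p /\
      rhoY h (l (fst p) (snd p)) (T (snd p)) (l (fst p) (snd p)) = GY p /\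
      is_derive (fun nu => rho h (l nu (snd p)) (T (snd p)) (l nu (snd p))) (fst p) (GP p + GY p)).
Proof.
intros C2.
pose proof (tangent_frame nu0 ph0) as F0.
destruct (C2n_partials _ _ (C2 (mkV 0 0 0) (T ph0) (l nu0 ph0)
   (conj (frame_T _ _ _ F0) (conj (frame_l _ _ _ F0) (frame_Tl _ _ _ F0))))) as [D HD].
set (f := flag_chart_fun (rho h) (mkV 0 0 0) (T ph0) (l nu0 ph0)) in *.
pose (base := fun p : R * R => coords (l (fst p) (snd p)) p).
exists (fun p => vsum 6 (fun i => D i (base p) * dang p i)), (fun p => vsum 6 (fun i => D i (base p) * vec3 (n (fst p) (snd p)) i)).
assert (cb : forall i, continuous (fun p => base p i) (nu0, ph0)).
{ intros i; apply (continuous_plus (fun p : R * R => vec3 (l (fst p) (snd p)) i) (fun p => ang p i)).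
  - assert (C : ctsV (fun p : R * R => l (fst p) (snd p))) by (unfold l; ctsk).
    destruct C as [c1 [c2 c3]]; destruct i as [|[|[|i]]]; cbn [vec3]; [apply c1 | apply c2 | apply c3 | apply continuous_const].
  - apply ang_continuous, (locally_singleton _ _ good_locally). }
assert (cD : forall i, (i < 6)%nat -> continuous (fun p => D i (base p)) (nu0, ph0)).
{ intros i Hi; apply continuous_contn with 6%nat; [now apply HD | intros; apply cb]. }
split; [|split; [|split]].
- apply vsum_continuous; intros i Hi; apply continuous_Rmult; [now apply cD|].
  apply dang_continuous, (locally_singleton _ _ good_locally).
- apply vsum_continuous; intros i Hi; apply continuous_Rmult; [now apply cD|].
  assert (C : ctsV (fun p : R * R => n (fst p) (snd p))) by (apply ctsV_bd_normal; cts).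
  destruct C as [c1 [c2 c3]]; destruct i as [|[|[|i]]]; cbn [vec3]; [apply c1 | apply c2 | apply c3 | apply continuous_const].
- apply continuous_ext_loc with (fun p => f (base p)).
  + generalize good_locally; apply filter_imp; intros p Gp; symmetry; exact (coords_chart (rho h) _ p Gp).
  + apply continuous_contn with 6%nat; [apply HD | intros; apply cb].
(* Differentiating at a nearby flag requires the chart identity on a neighbourhood of that flag. *)
- generalize (locally_locally _ _ good_locally); apply filter_imp; intros [al ph] L; cbn [fst snd].
  pose proof (locally_singleton _ _ L) as G.
  assert (Ls : locally al (fun t => good (t, ph))).
  { destruct L as [d Hd]; exists d; intros t Ht; apply Hd; split; [exact Ht | apply ball_center]. }
  set (x := l al ph).
  split; [|split].
  + unfold rhoPhi, x; rewrite tangent_flag_x2; fold x; apply Deriv_eq.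
    apply is_derive_ext with (fun t => rho h x (T ph) (l (t + al) ph)).
    { intros t; unfold x; now rewrite disc_pt_rotate. }
    apply (is_derive_shift (fun t => rho h x (T ph) (l t ph))).
    apply is_derive_ext_loc with (fun t => f (coords x (t, ph))).
    { revert Ls; apply filter_imp; intros t Gt; symmetry; exact (coords_chart (rho h) x (t, ph) Gt). }
    apply (chain_rule 6 f D (fun t => coords x (t, ph)) (dang (al, ph)) al HD).
    intros i _; replace (dang (al, ph) i) with (plus 0 (dang (al, ph) i)) by (unfold plus; cbn; Rring).
    apply (is_derive_plus (fun _ => vec3 x i) (fun t => ang (t, ph) i)); [|now apply ang_derive].
    apply (is_derive_const (K := R_AbsRing) (V := R_NormedModule) (vec3 x i)).
  + unfold rhoY, x; rewrite tangent_flag_x2; fold x; apply Deriv_eq.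
    apply is_derive_ext with (fun t => f (coords (vadd x (vscal t (n al ph))) (al, ph))).
    { intros t; symmetry; exact (coords_chart (rho h) _ (al, ph) G). }
    assert (E0 : vadd x (vscal 0 (n al ph)) = x).
    { apply V3_eq; unfold vadd, vscal; cbn [vx vy vz]; ring. }
    pose proof (chain_rule 6 f D (fun t => coords (vadd x (vscal t (n al ph))) (al, ph)) (vec3 (n al ph)) 0 HD) as CR.
    cbn beta in CR; rewrite E0 in CR; apply CR.
    intros i _; destruct i as [|[|[|i]]]; unfold coords, vadd, vscal; cbn [vec3 vx vy vz];
      auto_derive; try exact I; apply Rmult_1_l || reflexivity.
  + apply is_derive_ext_loc with (fun t => f (coords (l t ph) (t, ph))).
    { revert Ls; apply filter_imp; intros t Gt; symmetry; exact (coords_chart (rho h) (l t ph) (t, ph) Gt). }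
    rewrite vsum_plus.
    rewrite (vsum_ext 6 _ (fun i => D i (base (al, ph)) * (vec3 (n al ph) i + dang (al, ph) i))) by (intros; ring).
    apply (chain_rule 6 f D (fun t => coords (l t ph) (t, ph)) (fun i => vec3 (n al ph) i + dang (al, ph) i) al HD).
    intros i _; apply (is_derive_plus (fun t => vec3 (l t ph) i) (fun t => ang (t, ph) i)); [|now apply ang_derive].
    destruct i as [|[|[|i]]]; unfold l, n, disc_pt, bd_normal, vadd, vscal; cbn [vec3 vx vy vz];
      auto_derive; try exact I; ring.
Qed.

End Base.

Lemma tangent_rhoPhi_cts h : flag_C2 (rho h) -> cts2 (fun nu ph => rhoPhi h (l nu ph) (T ph) (l nu ph)).
Proof.
intros C2 [nu ph]; destruct (tangent_flag_derivatives nu ph h C2) as [GP [GY [H1 [H2 [_ H3]]]]].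
apply continuous_ext_loc with GP; [|exact H1].
revert H3; apply filter_imp; intros p [E _]; symmetry; exact E.
Qed.

Lemma tangent_rhoY_cts h : flag_C2 (rho h) -> cts2 (fun nu ph => rhoY h (l nu ph) (T ph) (l nu ph)).
Proof.
intros C2 [nu ph]; destruct (tangent_flag_derivatives nu ph h C2) as [GP [GY [H1 [H2 [_ H3]]]]].
apply continuous_ext_loc with GY; [|exact H2].
revert H3; apply filter_imp; intros p [_ [E _]]; symmetry; exact E.
Qed.

Lemma tangent_rho_cts h : flag_C2 (rho h) -> cts2 (fun nu ph => rho h (l nu ph) (T ph) (l nu ph)).
Proof. intros C2 [nu ph]; destruct (tangent_flag_derivatives nu ph h C2) as [GP [GY [_ [_ [H _]]]]]; exact H. Qed.

(* Moving the tangent flag along the meridian at unit speed translates its location along [x2] and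
   rotates its plane about [g], both at unit speed. *)
Lemma tangent_rho_derive h nu ph : flag_C2 (rho h) ->
  is_derive (fun nu => rho h (l nu ph) (T ph) (l nu ph)) nu
    (rhoPhi h (l nu ph) (T ph) (l nu ph) + rhoY h (l nu ph) (T ph) (l nu ph)).
Proof.
intros C2; destruct (tangent_flag_derivatives nu ph h C2) as [GP [GY [_ [_ [_ H3]]]]].
destruct (locally_singleton _ _ H3) as [E1 [E2 H]]; cbn [fst snd] in *.
rewrite E1, E2; exact H.
Qed.

End Frame.

(** * Conclusion *)

(** Latitude becomes the outer variable, the order in which the cap identity integrates. *)
Lemma disc_int_eq a b c alpha f : cts2 (fun nu ph => f (disc_pt a b c nu ph)) ->
  disc_int a b c alpha f = RInt (fun nu => sin nu * RInt (fun ph => f (disc_pt a b c nu ph)) 0 (2 * PI)) 0 alpha.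
Proof.
intros Hf; unfold cts2 in Hf; unfold disc_int.
assert (Hs : cts (fun p : R * R => f (disc_pt a b c (snd p) (fst p)))).
{ refine (cts_comp (fun p : R * R => ((snd p, fst p) : R * R)) (fun p => f (disc_pt a b c (fst p) (snd p))) _ Hf); cts. }
replace (fun ph => Defs.RInt (fun nu => f (disc_pt a b c nu ph) * sin nu) 0 alpha)
  with (fun ph => RInt (fun nu => f (disc_pt a b c nu ph) * sin nu) 0 alpha).
- rewrite Defs_RInt_cts.
  + rewrite (RInt_swap (fun ph nu => f (disc_pt a b c nu ph) * sin nu)) by cts.
    apply RInt_ext; intros nu _; rewrite <- RInt_Rmult.
    * apply RInt_ext; intros; Rring.
    * apply cts_ex_RInt; exact (cts_slice (fun nu ph => f (disc_pt a b c nu ph)) nu Hf).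
  + apply (cts_RInt (fun ph nu => f (disc_pt a b c nu ph) * sin nu)); cts.
- apply FunctionalExtensionality.functional_extensionality; intros ph; symmetry; apply Defs_RInt_cts.
  pose proof (cts_slice (fun ph nu => f (disc_pt a b c nu ph)) ph Hs); cts.
Qed.

Lemma bd_int_eq a b c alpha G : cts2 (fun nu ph => G (disc_pt a b c nu ph) (bd_tan a b ph) (disc_pt a b c nu ph)) ->
  bd_int a b c alpha G = RInt (fun ph => G (disc_pt a b c alpha ph) (bd_tan a b ph) (disc_pt a b c alpha ph)) 0 (2 * PI).
Proof.
intros H; apply Defs_RInt_cts.
exact (cts_slice (fun nu ph => G (disc_pt a b c nu ph) (bd_tan a b ph) (disc_pt a b c nu ph)) alpha H).
Qed.

Theorem theorem5 (h : R -> V3 -> R) (a b c : V3) (alpha : R) :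
  plane_fun_wd h ->
  plane_fun_continuous h ->
  flag_C2 (rho h) ->
  unit_vec a -> unit_vec b -> dot a b = 0 -> c = cross a b ->
  0 < alpha -> alpha < PI / 2 ->
  2 * PI * disc_int a b c alpha (hstar h)
  = disc_int a b c alpha (Mass h)
    + disc_int a b c alpha (dMdn h)
    + cos alpha * bd_int a b c alpha (fun l _ _ => Mass h l)
    - sin alpha * bd_int a b c alpha (rhoPhi h)
    - 2 * cos alpha * bd_int a b c alpha (rho h)
    - sin alpha * bd_int a b c alpha (rhoY h).
Proof.
intros wh hh C2 Ha Hb Hab Hc Hal0 Hal1.
pose proof (plane_fun_continuous_cts h hh) as ch.
destruct (radial_Mass_derive a b c h ch C2) as [G [cG [dG G1]]].
pose proof (tangent_rho_cts a b c Ha Hb Hab Hc h C2) as cr.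
pose proof (tangent_rhoPhi_cts a b c Ha Hb Hab Hc h C2) as cP.
pose proof (tangent_rhoY_cts a b c Ha Hb Hab Hc h C2) as cY.
assert (cM : cts2 (fun nu ph => Mass h (disc_pt a b c nu ph))) by (apply cts_Mass; [exact ch | ctsk]).
assert (cG1 : cts2 (fun nu ph => G 1 nu ph)).
{ refine (cts_comp (fun p : R * R => (((1, fst p), snd p) : (R * R) * R)) _ _ cG); cts. }
assert (cS : cts2 (fun nu ph => hstar h (disc_pt a b c nu ph))).
{ unfold cts2, hstar; ctsk; intros; now apply unit_l. }
assert (cN : cts2 (fun nu ph => dMdn h (disc_pt a b c nu ph))).
{ unfold cts2 in *; apply cts_ext with (fun p : R * R => G 1 (fst p) (snd p) - Mass h (disc_pt a b c (fst p) (snd p))); [intros p; rewrite G1; Rring | cts]. }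
rewrite !disc_int_eq, !bd_int_eq by assumption.
pose (P2 := fun nu ph => G 1 nu ph - 2 * PI * h 1 (disc_pt a b c nu ph)).
assert (cP2 : cts2 P2) by (unfold cts2, P2, hstar in *; cts).
pose (E := fun nu => RInt (fun ph => rho h (disc_pt a b c nu ph) (bd_tan a b ph) (disc_pt a b c nu ph)) 0 (2 * PI)).
assert (dE : is_derive E alpha (RInt (fun ph => rhoPhi h (disc_pt a b c alpha ph) (bd_tan a b ph) (disc_pt a b c alpha ph)
    + rhoY h (disc_pt a b c alpha ph) (bd_tan a b ph) (disc_pt a b c alpha ph)) 0 (2 * PI))).
{ apply (is_derive_RInt_cts (fun nu ph => rho h (disc_pt a b c nu ph) (bd_tan a b ph) (disc_pt a b c nu ph))
    (fun nu ph => rhoPhi h (disc_pt a b c nu ph) (bd_tan a b ph) (disc_pt a b c nu ph)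
       + rhoY h (disc_pt a b c nu ph) (bd_tan a b ph) (disc_pt a b c nu ph))).
  - intros nu ph; now apply tangent_rho_derive.
  - intros nu; exact (cts_slice (fun nu ph => rho h (disc_pt a b c nu ph) (bd_tan a b ph) (disc_pt a b c nu ph)) nu cr).
  - unfold cts2 in *; cts. }
rewrite RInt_Rplus in dE.
2:{ apply cts_ex_RInt; exact (cts_slice (fun nu ph => rhoPhi h (disc_pt a b c nu ph) (bd_tan a b ph) (disc_pt a b c nu ph)) alpha cP). }
2:{ apply cts_ex_RInt; exact (cts_slice (fun nu ph => rhoY h (disc_pt a b c nu ph) (bd_tan a b ph) (disc_pt a b c nu ph)) alpha cY). }
set (IP := RInt (fun ph => rhoPhi h _ _ _) 0 (2 * PI)) in *.
set (IY := RInt (fun ph => rhoY h _ _ _) 0 (2 * PI)) in *.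
change (RInt (fun ph => rho h (disc_pt a b c alpha ph) (bd_tan a b ph) (disc_pt a b c alpha ph)) 0 (2 * PI)) with (E alpha).
pose (Q := fun be => sin be * cos be * RInt (fun ph => Mass h (disc_pt a b c be ph)) 0 (2 * PI)
    + sin be * RInt (fun nu => sin nu * RInt (P2 nu) 0 (2 * PI)) 0 be).
assert (dR : is_derive (fun al => RInt Q 0 al) alpha (Q alpha)).
{ apply is_derive_RInt_upper. exact (cap_rhs_integrand_cts _ _ cM cP2). }
assert (dL : is_derive (fun al => sin al ^ 2 * E al) alpha (2 * sin alpha * cos alpha * E alpha + sin alpha ^ 2 * (IP + IY))).
{ auto_derive; [exact (ex_intro _ _ dE)|].
  replace (Derive (fun al => E al) alpha) with (IP + IY) by (symmetry; apply is_derive_unique, dE); ring. }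
assert (dL2 : is_derive (fun al => RInt Q 0 al) alpha (2 * sin alpha * cos alpha * E alpha + sin alpha ^ 2 * (IP + IY))).
{ revert dL; apply is_derive_ext_loc.
  (* The cap identity is available for nonnegative radii; the ball of radius [alpha] around [alpha]
     stays among them. *)
  exists (mkposreal alpha Hal0); intros al Hb'.
  change (Rabs (al - alpha) < alpha) in Hb'; apply Rabs_def2 in Hb'.
  apply (cap_identity_radial a b c Ha Hb Hab Hc h G al ch wh); [lra | exact cG | exact dG]. }
assert (EQ : 2 * sin alpha * cos alpha * E alpha + sin alpha ^ 2 * (IP + IY) = Q alpha).
{ rewrite <- (is_derive_unique _ _ _ dL2); apply is_derive_unique, dR. }
assert (Hs : 0 < sin alpha) by (apply sin_gt_0; lra).
unfold Q in EQ.
set (IM := RInt (fun ph => Mass h (disc_pt a b c alpha ph)) 0 (2 * PI)) in *.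
assert (EJ : RInt (fun nu => sin nu * RInt (P2 nu) 0 (2 * PI)) 0 alpha
  = RInt (fun nu => sin nu * RInt (fun ph => Mass h (disc_pt a b c nu ph)) 0 (2 * PI)) 0 alpha
    + RInt (fun nu => sin nu * RInt (fun ph => dMdn h (disc_pt a b c nu ph)) 0 (2 * PI)) 0 alpha
    - 2 * PI * RInt (fun nu => sin nu * RInt (fun ph => hstar h (disc_pt a b c nu ph)) 0 (2 * PI)) 0 alpha).
{ pose proof (cap_inner_cts _ 0 (2 * PI) cM); pose proof (cap_inner_cts _ 0 (2 * PI) cN); pose proof (cap_inner_cts _ 0 (2 * PI) cS).
  rewrite <- RInt_Rmult, <- RInt_Rplus, <- RInt_Rminus by (apply cts_ex_RInt; cts).
  apply RInt_ext; intros nu _.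
  pose proof (cts_slice _ nu cM); pose proof (cts_slice _ nu cN); pose proof (cts_slice _ nu cS).
  transitivity (sin nu * (RInt (fun ph => Mass h (disc_pt a b c nu ph)) 0 (2 * PI)
    + RInt (fun ph => dMdn h (disc_pt a b c nu ph)) 0 (2 * PI)
    - 2 * PI * RInt (fun ph => hstar h (disc_pt a b c nu ph)) 0 (2 * PI))); [|Rring].
  f_equal; rewrite <- RInt_Rmult, <- RInt_Rplus, <- RInt_Rminus by (apply cts_ex_RInt; cts).
  apply RInt_ext; intros ph _; unfold P2, hstar; rewrite G1; reflexivity. }
rewrite EJ in EQ.
(* Both derivatives contain the factor sin alpha, which is cancelled here. *)
apply Rmult_eq_reg_l with (sin alpha); [|lra].
lra.
Qed.
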